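(* Let $p$ be a prime with $p\equiv\pm 1\pmod 5$. Suppose that either $p\equiv 1,3,4,5$ or $9 \pmod{11}$ and both $3+2\sqrt{5}$ and $3-2\sqrt{5}$ are squares modulo $p$, or $p\equiv 2,6,7,8$ or $10\pmod{11}$. Let $\mathcal Q$ be a finite locally spherical directly regular $4$-polytope of type $\{3,5,3\}$ such that $p(p^{2}-1)$ does not divide $|\Gamma(\mathcal{Q})|$. Then there exists a locally spherical chiral $4$-polytope of type $\{3,5,3\}$ whose automorphism group is isomorphic to $L_{2}(p)\times\Gamma^{+}(\mathcal{Q})$.
   Context: An abstract $n$-polytope is a ranked poset (ranks $-1,\dots,n$) with a least and a greatest face, all flags of size $n+2$, strongly flag-connected, and satisfying the diamond condition; $\Gamma(\mathcal P)$ is its automorphism group. $\mathcal P$ is regular if $\Gamma(\mathcal P)$ is flag-transitive, and chiral if $\Gamma(\mathcal P)$ has exactly two flag orbits with adjacent flags always in distinct orbits. For regular $\mathcal P$, $\Gamma(\mathcal P)$ is generated by involutions $\rho_0,\dots,\rho_{n-1}$ ($\rho_i$ maps a base flag to its $i$-adjacent flag); the rotation subgroup $\Gamma^+(\mathcal P)$ is generated by $\sigma_i=\rho_{i-1}\rho_i$, has index at most $2$, and $\mathcal P$ is directly regular if the index is $2$. The type $\{p_1,\dots,p_{n-1}\}$ records the orders $p_i$ of the (rotation) generators $\sigma_i$. A $4$-polytope is locally spherical if its facets and vertex-figures are spherical maps (finite regular polyhedra on the $2$-sphere). Here $\sqrt5$ denotes a square root of $5$ modulo $p$ (which exists since $p\equiv\pm1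 \pmod 5$). $L_2(p)=PSL_2(p)$. *)

(* Defs.v *)
From HB Require Import structures.
From mathcomp Require Import all_boot all_order all_algebra all_fingroup.
From mathcomp Require Import all_solvable.

Set Implicit Arguments.
Unset Strict Implicit.
Unset Printing Implicit Defensive.

Import Order.TTheory GroupScope.

Section Faces.
Context {d : Order.disp_t} {P : finPOrderType d}.
Implicit Types (x y F G H : P) (C Phi Psi : {set P}).

Definition is_chain C : bool :=
  [forall x in C, forall y in C, (x >=< y)%O].

Definition flags : {set {set P}} := [set Phi | maxset is_chain Phi].

Definition least F : Prop := forall x, (F <= x)%O.
Definition greatest F : Prop := forall x, (x <= F)%O.

(* In a poset satisfying the polytope axioms below, every maximal chain below
   a face has the same size, and this is the usual rank function, with value
   -1 at the least face and n at the greatest face. *)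
Definition face_rank F : int :=
  ((\max_(C : {set P} | is_chain C && [forall x in C, (x < F)%O]) #|C|)%:Z
     - 1)%R.

Definition adjacent Phi Psi : bool :=
  (#|Phi :\: Psi| == 1%N) && (#|Psi :\: Phi| == 1%N).

Definition strongly_flag_connected : Prop :=
  forall Phi Psi, Phi \in flags -> Psi \in flags ->
    connect [rel A B : {set P} |
      [&& A \in flags, B \in flags, adjacent A B,
          Phi :&: Psi \subset A & Phi :&: Psi \subset B]] Phi Psi.

Definition diamond_condition : Prop :=
  forall F G, (F < G)%O -> face_rank G = (face_rank F + 2)%R ->
    #|[set H | (F < H < G)%O]| = 2.

Definition Gamma : {set {perm P}} :=
  [set s : {perm P} | [forall x, forall y, (s x <= s y)%O == (x <= y)%O]].

Lemma Gamma_group_set : group_set Gamma.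
Proof.
apply/group_setP; split=> [|s t].
  by rewrite inE; apply/forallP=> x; apply/forallP=> y; rewrite !perm1.
rewrite !inE => /forallP s_le /forallP t_le.
apply/forallP=> x; apply/forallP=> y; rewrite !permM.
by rewrite (eqP (forallP (t_le _) _)) (eqP (forallP (s_le _) _)).
Qed.

Canonical Gamma_group : {group {perm P}} := Group Gamma_group_set.

(* The flag agreeing with Phi in every face except the one of rank i. *)
Definition adjacent_flag Phi (i : nat) : {set P} :=
  odflt Phi [pick Psi in flags |
    adjacent Phi Psi & [forall x in Phi :\: Psi, face_rank x == Posz i]].

Definition moving Phi Psi : {perm P} :=
  odflt 1 [pick s in Gamma | s @: Phi == Psi].

Definition rho Phi (i : nat) : {perm P} := moving Phi (adjacent_flag Phi i).

(* The indices of sigma and chiral_sigma range over 1, ..., n - 1. *)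
Definition sigma Phi (i : nat) : {perm P} := rho Phi i.-1 * rho Phi i.

(* When P is chiral the reflections rho do not exist, and the i-th rotation
   is the automorphism taking the base flag Phi to the (i-1)-adjacent flag of
   its i-adjacent flag; when P is regular, sigma Phi i does this too. *)
Definition chiral_sigma Phi (i : nat) : {perm P} :=
  moving Phi (adjacent_flag (adjacent_flag Phi i) i.-1).

End Faces.

Arguments flags {d} P.
Arguments strongly_flag_connected {d} P.
Arguments diamond_condition {d} P.
Arguments Gamma {d} P.
Arguments Gamma_group {d} P.

Section Polytopes.
Context {d : Order.disp_t}.
Implicit Type P : finPOrderType d.

Definition is_polytope (n : nat) P : Prop :=
  [/\ exists F : P, least F,
      exists F : P, greatest F,
      forall Phi, Phi \in flags P -> #|Phi| = n.+2,
      strongly_flag_connected P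
    & diamond_condition P].

Definition regular P : Prop := [transitive Gamma P, on flags P | 'P^*].

Definition chiral P : Prop :=
  #|[set orbit 'P^* (Gamma P) Phi | Phi in flags P]| = 2 /\
  forall Phi Psi, Phi \in flags P -> Psi \in flags P -> adjacent Phi Psi ->
    orbit 'P^* (Gamma P) Phi <> orbit 'P^* (Gamma P) Psi.

Definition rotation_subgroup (n : nat) P (Phi : {set P}) : {group {perm P}} :=
  <<[set sigma Phi i.+1 | i : 'I_n.-1]>>%G.

Definition directly_regular (n : nat) P : Prop :=
  regular P /\
  forall Phi, Phi \in flags P ->
    #|Gamma P : rotation_subgroup n Phi| = 2.

Definition regular_type P (ps : seq nat) : Prop :=
  forall Phi, Phi \in flags P ->
    forall i, i < size ps -> #[sigma Phi i.+1] = nth 0 ps i.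

Definition chiral_type P (ps : seq nat) : Prop :=
  forall Phi, Phi \in flags P ->
    forall i, i < size ps -> #[chiral_sigma Phi i.+1] = nth 0 ps i.

(* A finite abstract polyhedron is a map on a closed connected surface, which
   is the 2-sphere exactly when its Euler characteristic V - E + F is 2. *)
Definition spherical_map P : Prop :=
  [/\ is_polytope 3 P,
      regular P
    & (#|[set x : P | face_rank x == 0%R]|%:Z
       - #|[set x : P | face_rank x == 1%R]|%:Z
       + #|[set x : P | face_rank x == 2%R]|%:Z)%R = 2%R].

End Polytopes.

Section PolytopeSections.
Context {d : Order.disp_t} {P : finPOrderType d}.

Record face_section (F G : P) := FaceSection {
  underlying_face : P;
  underlying_faceP : (F <= underlying_face <= G)%O }.

Context (F G : P).
HB.instance Definition _ := [isSub for @underlying_face F G].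
HB.instance Definition _ := [Finite of face_section F G by <:].
HB.instance Definition _ :=
  [SubChoice_isSubPOrder of face_section F G by <: with d].

End PolytopeSections.

Definition locally_spherical {d : Order.disp_t} (P : finPOrderType d) : Prop :=
  (forall F G : P, least F -> face_rank G = 3%R ->
     spherical_map (face_section F G)) /\
  (forall F G : P, face_rank F = 0%R -> greatest G ->
     spherical_map (face_section F G)).

Section LinearGroups.
Context (p : nat).

Definition SL2 : {set {'GL_2(p)}} := [set g | (\det (GLval g) == 1)%R].

Lemma SL2_group_set : group_set SL2.
Proof.
apply/group_setP; split=> [|g h]; first by rewrite inE det1.
by rewrite !inE det_mulmx => /eqP-> /eqP->; rewrite GRing.mulr1.
Qed.

Canonical SL2_group : {group {'GL_2(p)}} := Group SL2_group_set.

Definition L2 := (SL2 / 'Z(SL2))%G.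

End LinearGroups.

(* Main.v *)
(** Mix [Q] with a chiral pair coming from [L_2(p)]. With [phi] a root of [x^2 = x + 1] and
    [3 - 2 sqrt 5] a square modulo [p], there are matrices [a, b, c] in [SL_2(p)] whose images
    satisfy the relations of the products [rho_0 rho_i] in the rotation group of type {3,5,3}.
    When [p] is a nonresidue modulo 11 such a square exists for one choice of [sqrt 5], because
    [(3 + 2 sqrt 5) (3 - 2 sqrt 5) = -11] is not a square (Gauss periods of 11th roots of unity).

    The group [H] generated by [a, b, c] is all of [SL_2(p)]: if [p] divides [|H|], a transvection
    and a conjugate of it that does not commute with it generate [SL_2(p)]; otherwise the
    centralizers of noncentral elements partition [H], and counting as in the classification of
    finite subgroups of [SL_2] leaves the centralizer of [a] with only 6 elements, which the
    trace of [b c] excludes. No automorphism of [L_2(p)] inverts [a], [b] and [c]: it would be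
    conjugation by a matrix, forcing [tr (a b c) = tr (c b a)].

    The subgroup [E] of [L_2(p) x Gamma^+(Q)] generated by the pairs of corresponding generators
    projects onto both factors, and by simplicity of [L_2(p)] and the condition on [|Gamma(Q)|]
    it is the whole product; an automorphism of [E] inverting the generators would restrict to
    [L_2(p)]. Since the vertex, edge, face and facet stabilizers in [E] map injectively to
    [Gamma^+(Q)], the coset geometry of [E] covers [Q] isomorphically on proper sections, so it
    is a locally spherical polytope; it is chiral because the generators cannot be inverted. *)

Require Import Defs.
From HB Require Import structures.
From mathcomp Require Import all_boot all_order all_algebra all_fingroup.
From mathcomp Require Import all_solvable all_field.
From mathcomp Require Import ring lra zify.

Set Implicit Arguments.
Unset Strict Implicit.
Unset Printing Implicit Defensive.

Import Order.TTheory GroupScope.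

(** * Ranked posets and flags *)

(** The free data are a point on a conic and a square root. With [a] fixed, the trace-zero matrices
    [b] with tr(a^-1 b) = [phi] form a two-parameter family in which determinant one is a conic, and
    counting squares gives it a point. For [c] the conditions on tr c, tr(a^-1 c) and tr(b^-1 c) are
    linear, and determinant one is then solved by means of a root [s] of [s ^+ 2 = s + 1 - phi].
    Since (2s - 1)^2 = 3 - 2 sqrt 5, this is where the hypothesis on squares enters. Replacing [s]
    by 1 - [s] reverses the sign of tr(abc) - tr(cba) = 1 - 2s; this number is nonzero because [p]
    is not 11.

    On the geometric side, the obstacle is that incidence of cosets must be transitive. Injectivity
    of the stabilizers settles it: they satisfy the relations of A5 or of the dihedral group of
    order 6, and by a normal form for these groups a homomorphism killing neither generator is
    faithful. Every question about chains and flags can then be decided in [Q].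

    For the subgroup of SL_2(p), the counting leaves centralizers of orders 10, 6 and 4, as in the
    binary icosahedral group. That group could contain [a] and [b], so only a trace involving [c]
    can rule the case out. *)

Lemma imset_setD (aT rT : finType) (f : aT -> rT) (A B : {set aT}) :
  {in A & B, forall x y, f x = f y -> x = y} ->
  f @: (A :\: B) = f @: A :\: f @: B.
Proof.
move=> f_inj; apply/setP=> z; apply/imsetP/setDP => [[x /setDP[xA xB] ->]|].
  split; first exact: imset_f.
  by apply: contra xB => /imsetP[y yB /f_inj->].
case=> /imsetP[x xA ->] fB; exists x => //; rewrite inE xA andbT.
by apply: contra fB; apply: imset_f.
Qed.

Section Chains.
Context {d : Order.disp_t} {P : finPOrderType d}.
Implicit Types (x y : P) (C D Psi : {set P}).

Lemma is_chainP C : reflect {in C &, forall x y, (x >=< y)%O} (is_chain C).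
Proof.
apply: (iffP forall_inP) => [h x y xC yC|h x xC].
  exact: (forall_inP (h x xC)).
by apply/forall_inP => y yC; apply: h.
Qed.

Lemma is_chainS C D : D \subset C -> is_chain C -> is_chain D.
Proof.
by move=> /subsetP sDC /is_chainP cC; apply/is_chainP => x y xD yD;
  apply: cC; apply: sDC.
Qed.

Lemma is_chainU1 C x :
  is_chain C -> {in C, forall y, (x >=< y)%O} -> is_chain (x |: C).
Proof.
move=> /is_chainP cC cx; apply/is_chainP => y z; rewrite !in_setU1.
case/predU1P=> [->|yC] /predU1P[->|zC].
- exact: comparablexx.
- exact: cx.
- by rewrite comparable_sym; apply: cx.
- exact: cC.
Qed.

Lemma flag_is_chain Psi : Psi \in flags P -> is_chain Psi.
Proof. by rewrite inE => /maxsetP[]. Qed.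

Lemma flag_comparable Psi x y :
  Psi \in flags P -> x \in Psi -> y \in Psi -> (x >=< y)%O.
Proof. by move=> /flag_is_chain /is_chainP h xP yP; apply: h. Qed.

Lemma chain_flag C : is_chain C -> exists2 Psi, Psi \in flags P & C \subset Psi.
Proof. by move=> /maxset_exists[Psi mP sCP]; exists Psi; rewrite ?inE. Qed.

Lemma flag_max Psi x :
  Psi \in flags P -> {in Psi, forall y, (x >=< y)%O} -> x \in Psi.
Proof.
move=> fP cx; have := fP; rewrite inE => /maxsetP[cP mP].
by rewrite -(mP _ (is_chainU1 cP cx) (subsetU1 _ _)) setU11.
Qed.

Lemma flag_maximal Psi Psi' :
  Psi \in flags P -> is_chain Psi' -> Psi \subset Psi' -> Psi' = Psi.
Proof. by rewrite inE => /maxsetP[_]; apply. Qed.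

(** This is [face_rank] plus one, a natural number: in a polytope the least face has [rk] 0, a face
    of rank i has [rk] i.+1, and the greatest face has [rk] n.+1. *)
Definition rk x : nat :=
  \max_(C : {set P} | is_chain C && [forall y in C, (y < x)%O]) #|C|.

Lemma face_rankE x : face_rank x = ((rk x)%:Z - 1)%R. Proof. by []. Qed.

Lemma face_rank_nat x (j : nat) : (face_rank x == j%:Z)%R = (rk x == j.+1).
Proof.
by rewrite face_rankE GRing.subr_eq -PoszD addn1 eqz_nat.
Qed.

Lemma chain_le_rk C x :
  is_chain C -> {in C, forall y, (y < x)%O} -> #|C| <= rk x.
Proof.
move=> cC cx; apply: (@leq_bigmax_cond _ _ (fun C : {set P} => #|C|)).
by rewrite cC; apply/forall_inP.
Qed.

End Chains.

(** * Transport along order isomorphisms *)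

Section OrderIso.
Context {dA dB : Order.disp_t} {A : finPOrderType dA} {B : finPOrderType dB}.
Context (f : A -> B) (g : B -> A) (fK : cancel f g) (gK : cancel g f).
Context (f_le : {mono f : x y / (x <= y)%O}).
Let f_inj := can_inj fK.

Lemma iso_lt : {mono f : x y / (x < y)%O}.
Proof. by move=> x y; rewrite !lt_neqAle f_le (inj_eq f_inj). Qed.

Lemma iso_inv_le : {mono g : x y / (x <= y)%O}.
Proof. by move=> x y; rewrite -f_le !gK. Qed.

Lemma iso_chain (C : {set A}) : is_chain C -> is_chain (f @: C).
Proof.
move/is_chainP=> cC; apply/is_chainP => _ _ /imsetP[x xC ->] /imsetP[y yC ->].
by rewrite /Order.comparable !f_le; apply: cC.
Qed.

Lemma iso_imsetK (C : {set A}) : g @: (f @: C) = C.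
Proof. by rewrite -imset_comp -[RHS]imset_id; apply: eq_imset => x /=. Qed.

Lemma iso_rk_le x : rk x <= rk (f x).
Proof.
apply/bigmax_leqP => C /andP[cC /forall_inP bC].
rewrite -(card_imset _ f_inj); apply: chain_le_rk; first exact: iso_chain.
by move=> _ /imsetP[y yC ->]; rewrite iso_lt bC.
Qed.

End OrderIso.

Section OrderIsoFlags.
Context {dA dB : Order.disp_t} {A : finPOrderType dA} {B : finPOrderType dB}.
Context (f : A -> B) (g : B -> A) (fK : cancel f g) (gK : cancel g f).
Context (f_le : {mono f : x y / (x <= y)%O}).
Let f_inj := can_inj fK.
Let g_le := iso_inv_le gK f_le.

Lemma iso_rk x : rk (f x) = rk x.
Proof.
apply/eqP; rewrite eqn_leq (iso_rk_le fK f_le) andbT.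
by rewrite -{2}[x]fK (iso_rk_le gK g_le).
Qed.

Lemma iso_flag (Psi : {set A}) : Psi \in flags A -> f @: Psi \in flags B.
Proof.
rewrite !inE => /maxsetP[cP mP]; apply/maxsetP; split.
  exact: (iso_chain f_le cP).
move=> C cC sC; rewrite -[C](iso_imsetK gK); suff -> : g @: C = Psi by [].
apply: mP; first exact: (iso_chain g_le cC).
by rewrite -[Psi](iso_imsetK fK); apply: imsetS.
Qed.

Lemma iso_adjacent (C D : {set A}) : adjacent (f @: C) (f @: D) = adjacent C D.
Proof. by rewrite /adjacent -!imset_setD ?card_imset // => x y _ _; apply: f_inj. Qed.

End OrderIsoFlags.

Section FlagSize.
Context {d : Order.disp_t} {P : finPOrderType d} (n : nat).
Implicit Types (x y : P) (C Psi : {set P}).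
Context (flag_size : forall Psi, Psi \in flags P -> #|Psi| = n.+2).

Lemma chain_card C : is_chain C -> #|C| <= n.+2.
Proof. by case/chain_flag=> Psi fP sCP; rewrite -(flag_size fP) subset_leq_card. Qed.

Lemma chain_full C : is_chain C -> #|C| = n.+2 -> C \in flags P.
Proof.
move=> cC szC; have [Psi fP sCP] := chain_flag cC.
suff -> : C = Psi by [].
by apply/eqP; rewrite eqEcard sCP szC (flag_size fP) leqnn.
Qed.

(** A larger chain below [x] could be spliced with the part of [Psi] not below [x], giving a chain
    longer than a flag. So the maximum that defines the rank is attained along every flag through
    [x]. *)
Lemma rk_flag Psi x :
  Psi \in flags P -> x \in Psi -> rk x = #|[set y in Psi | (y < x)%O]|.
Proof.
move=> fP xP; apply/eqP; rewrite eqn_leq; apply/andP; split; last first.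
  apply: chain_le_rk; last by move=> y; rewrite inE => /andP[].
  by apply: is_chainS (flag_is_chain fP); apply/subsetP=> y; rewrite inE => /andP[].
apply/bigmax_leqP => C /andP[cC /forall_inP bC].
pose U := [set y in Psi | ~~ (y < x)%O].
have geU y : y \in U -> (x <= y)%O.
  rewrite inE => /andP[yP]; have := flag_comparable fP yP xP.
  by case: comparableP.
have cCU : is_chain (C :|: U).
  apply/is_chainP => y z; rewrite !in_setU => /orP[yC|yU] /orP[zC|zU].
  - exact: (is_chainP _ cC).
  - by apply/le_comparable/ltW/(lt_le_trans (bC _ yC))/geU.
  - by apply/ge_comparable/ltW/(lt_le_trans (bC _ zC))/geU.
  - by move: yU zU; rewrite !inE => /andP[yP _] /andP[zP _]; apply: (flag_comparable fP).
have dCU : [disjoint C & U].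
  rewrite -setI_eq0; apply/eqP/setP=> y; rewrite !inE; apply/negP.
  by case/and3P=> /bC ->.
have := chain_card cCU; rewrite cardsU (disjoint_setI0 dCU) cards0 subn0.
rewrite -(flag_size fP) -(cardsID [set y | (y < x)%O] Psi).
have -> : Psi :&: [set y | (y < x)%O] = [set y in Psi | (y < x)%O].
  by apply/setP=> y; rewrite !inE.
have -> : Psi :\: [set y | (y < x)%O] = U.
  by apply/setP=> y; rewrite !inE andbC.
by rewrite leq_add2r.
Qed.

End FlagSize.

(** The polytope axioms without strong connectedness. They suffice for ranks and adjacent flags, and
    for a cover they are available before connectedness is known. *)
Definition ranked (n : nat) {d : Order.disp_t} (P : finPOrderType d) : Prop :=
  [/\ exists F : P, least F, exists F : P, greatest F,
      forall Psi, Psi \in flags P -> #|Psi| = n.+2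
    & diamond_condition P].

Lemma polytope_ranked n (d : Order.disp_t) (P : finPOrderType d) :
  is_polytope n P -> ranked n P.
Proof. by case. Qed.

(** * Adjacent flags and the action of automorphisms on them *)

Section Ranked.
Context {d : Order.disp_t} {P : finPOrderType d} (n : nat) (rP : ranked n P).
Implicit Types (x y z : P) (C D Psi Theta : {set P}) (i j k : nat).
Let has_least : exists F : P, least F. Proof. by case: rP. Qed.
Let has_greatest : exists F : P, greatest F. Proof. by case: rP. Qed.
Let flag_size Psi : Psi \in flags P -> #|Psi| = n.+2.
Proof. by case: rP => _ _ h _; apply: h. Qed.
Let diamondP : diamond_condition P. Proof. by case: rP. Qed.

Lemma flag_lt Psi x y :
  Psi \in flags P -> x \in Psi -> y \in Psi -> (x < y)%O = (rk x < rk y).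
Proof.
move=> fP; suff lt_rk a b : a \in Psi -> b \in Psi -> (a < b)%O -> rk a < rk b.
  move=> xP yP; have := flag_comparable fP xP yP.
  case: (comparableP x y) => // [xy|xy|->] _; last by rewrite ltnn.
    by rewrite lt_rk.
  by apply/esym/negbTE; rewrite -leqNgt ltnW // lt_rk.
move=> aP bP ab; rewrite !(rk_flag flag_size fP) //; apply: proper_card.
apply/properP; split.
  by apply/subsetP=> c; rewrite !inE => /andP[-> /lt_trans->].
by exists a; rewrite !inE ?aP ?ab ?ltxx.
Qed.

Lemma flag_le Psi x y :
  Psi \in flags P -> x \in Psi -> y \in Psi -> (x <= y)%O = (rk x <= rk y).
Proof.
move=> fP xP yP; rewrite leqNgt -(flag_lt fP yP xP) -comparable_leNgt //.
exact: (flag_comparable fP).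
Qed.

Lemma chain2 x y : (x >=< y)%O -> is_chain [set x; y].
Proof.
move=> cxy; apply/is_chainP => a b; rewrite !in_set2.
by case/pred2P=> -> /pred2P[]->; rewrite ?comparablexx // comparable_sym.
Qed.

Lemma flag_through x : exists2 Psi, Psi \in flags P & x \in Psi.
Proof.
have [Psi fP /subsetP sP] := chain_flag (chain2 (comparablexx x)).
by exists Psi => //; apply: sP; rewrite set21.
Qed.

Lemma rk_lt x y : (x < y)%O -> rk x < rk y.
Proof.
move=> xy; have [Psi fP /subsetP sP] := chain_flag (chain2 (lt_comparable xy)).
by rewrite -(flag_lt fP) // sP // ?set21 ?set22.
Qed.

Lemma rk_le x y : (x <= y)%O -> rk x <= rk y.
Proof. by rewrite le_eqVlt => /predU1P[->//|/rk_lt/ltnW]. Qed.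

Lemma flag_rk_inj Psi x y :
  Psi \in flags P -> x \in Psi -> y \in Psi -> rk x = rk y -> x = y.
Proof.
move=> fP xP yP exy; apply/le_anti.
by rewrite !(flag_le fP) // exy leqnn.
Qed.

Lemma rk_max x : rk x < n.+2.
Proof.
have [Psi fP xP] := flag_through x; rewrite (rk_flag flag_size fP xP) -(flag_size fP).
apply: proper_card; apply/properP; split.
  by apply/subsetP=> c; rewrite !inE => /andP[].
by exists x; rewrite // inE ltxx andbF.
Qed.

(** Pigeonhole: a flag has [n.+2] faces, whose ranks are distinct and below [n.+2]. *)
Lemma flag_rk_ex Psi i :
  Psi \in flags P -> i < n.+2 -> exists2 x, x \in Psi & rk x = i.
Proof.
move=> fP lt_i; pose r x := Ordinal (rk_max x).
have r_inj : {in Psi &, injective r}.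
  by move=> x y xP yP /(congr1 val) /=; apply: (flag_rk_inj fP).
have : Ordinal lt_i \in r @: Psi.
  suff -> : r @: Psi = [set: 'I_n.+2] by rewrite inE.
  by apply/eqP; rewrite eqEcard subsetT cardsT card_ord card_in_imset // (flag_size fP) leqnn.
by case/imsetP=> x xP [->]; exists x.
Qed.

Lemma flag_sub_eq Psi Theta :
  Psi \in flags P -> Theta \in flags P -> Psi \subset Theta -> Psi = Theta.
Proof. by move=> fP fT sPT; apply/eqP; rewrite eqEcard sPT (flag_size fP) (flag_size fT) leqnn. Qed.

Lemma rk0_least x : (rk x == 0) = [forall y, x <= y]%O.
Proof.
have [F lF] := has_least; apply/eqP/forallP => [x0 y|lx].
  suff -> : x = F by [].
  have := lF x; rewrite le_eqVlt; case/predU1P=> [->//|/rk_lt].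
  by rewrite x0.
apply/eqP; rewrite -leqn0; apply/bigmax_leqP => C /andP[_ /forall_inP bC].
rewrite leqn0 cards_eq0; apply/set0Pn=> -[y /bC].
by rewrite lt_leAnge lx andbF.
Qed.

Lemma rk_greatest x : (rk x == n.+1) = [forall y, y <= x]%O.
Proof.
apply/eqP/forallP => [rx y|gx].
  have [F gF] := has_greatest; suff -> : x = F by [].
  have := gF x; rewrite le_eqVlt; case/predU1P=> [->//|/rk_lt].
  by rewrite rx ltnNge -ltnS rk_max.
have [Psi fP xP] := flag_through x.
have [y yP ry] := flag_rk_ex fP (ltnSn n.+1).
by apply/eqP; rewrite eqn_leq -ltnS rk_max -ry rk_le.
Qed.

Lemma between_unique x y a b c :
    (x < a < y)%O -> (x < b < y)%O -> (x < c < y)%O ->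
  rk y = (rk x).+2 -> b != a -> c != a -> b = c.
Proof.
move=> ha hb hc rxy ba ca; apply/eqP/negPn/negP => bc.
have /andP[xa ay] := ha; have xy := lt_trans xa ay.
have := diamondP xy; rewrite !face_rankE rxy.
have -> : ((rk x).+2%:Z - 1 = (rk x)%:Z - 1 + 2)%R.
  by rewrite -addn2 PoszD GRing.addrAC.
move/(_ erefl) => c2.
have : #|[set a; b; c]| <= 2.
  rewrite -c2; apply: subset_leq_card; apply/subsetP=> z; rewrite !inE.
  by case/orP=> [/orP[]|] /eqP->.
by rewrite setUC cardsU1 !inE (negbTE ca) eq_sym (negbTE bc) cards2 eq_sym ba.
Qed.

Lemma flag_between Psi x a y :
    Psi \in flags P -> x \in Psi -> a \in Psi -> y \in Psi ->
  rk x < rk a -> rk a < rk y -> (x < a < y)%O.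
Proof. by move=> fP xP aP yP xa ay; rewrite !(flag_lt fP) // xa. Qed.

(** Here [i] is a rank in the sense of [face_rank], whence the shift by one. *)
Definition agree_off i Psi Theta :=
  forall x, rk x != i.+1 -> (x \in Psi) = (x \in Theta).

Lemma agree_off_sym i Psi Theta : agree_off i Psi Theta -> agree_off i Theta Psi.
Proof. by move=> h x rx; rewrite h. Qed.

Lemma agree_off_eq i Psi Theta x :
    Psi \in flags P -> Theta \in flags P -> agree_off i Psi Theta ->
  rk x = i.+1 -> x \in Psi -> x \in Theta -> Psi = Theta.
Proof.
move=> fP fT h rx xP xT; apply: flag_sub_eq => //; apply/subsetP=> y yP.
have [ry|ry] := eqVneq (rk y) i.+1; last by rewrite -h.
by rewrite (flag_rk_inj fP yP xP) // ry rx.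
Qed.

(** The faces at [rk] i and i.+2 are common to all three flags, and between them the diamond
    condition leaves room for only one face besides that of [Psi]. *)
Lemma agree_off_uniq i Psi Theta Theta' :
    i < n -> Psi \in flags P -> Theta \in flags P -> Theta' \in flags P ->
    agree_off i Psi Theta -> agree_off i Psi Theta' ->
  Theta != Psi -> Theta' != Psi -> Theta = Theta'.
Proof.
move=> lt_i fP fT fT' h h' nT nT'.
have ltS1 : i < n.+2 by rewrite ltnW // ltnW.
have ltS2 : i.+1 < n.+2 by rewrite ltnW.
have [l lP rl] := flag_rk_ex fP ltS1.
have [w wP rw] := flag_rk_ex fP (lt_i : i.+2 < n.+2).
have [a aP ra] := flag_rk_ex fP ltS2.
have [b bT rb] := flag_rk_ex fT ltS2.
have [c cT rc] := flag_rk_ex fT' ltS2.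
have ri : i != i.+1 by rewrite -[X in X != _]addn0 -addn1 eqn_add2l.
have ri2 : i.+2 != i.+1 by rewrite eqSS eq_sym.
have lT : l \in Theta by rewrite -h // rl.
have wT : w \in Theta by rewrite -h // rw.
have lT' : l \in Theta' by rewrite -h' // rl.
have wT' : w \in Theta' by rewrite -h' // rw.
have ebc : b = c.
  apply: (@between_unique l w a).
  - by apply: (flag_between fP); rewrite // ?rl ?ra ?rw.
  - by apply: (flag_between fT); rewrite // ?rl ?rb ?rw.
  - by apply: (flag_between fT'); rewrite // ?rl ?rc ?rw.
  - by rewrite rw rl.
  - by apply: contra nT => /eqP ba; rewrite (agree_off_eq fP fT h ra) // -ba.
  - by apply: contra nT' => /eqP ca; rewrite (agree_off_eq fP fT' h' ra) // -ca.
apply: (@agree_off_eq i _ _ b) => //; last by rewrite ebc.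
by move=> x rx; rewrite -h // h'.
Qed.

Definition adj Psi i := adjacent_flag Psi i.

(** The two exchanged faces have the same rank, for otherwise the face of [Theta] at [rk a] would
    lie in [Psi] and be [a]. That rank is not extreme, because the least and greatest faces lie in
    every flag. *)
Lemma adjacent_flagP Psi Theta :
    Psi \in flags P -> Theta \in flags P -> adjacent Psi Theta ->
  exists i, [/\ i < n, agree_off i Psi Theta, Psi != Theta
    & [forall x in Psi :\: Theta, rk x == i.+1]].
Proof.
move=> fP fT /andP[/cards1P[a eA] /cards1P[b eB]].
have [aP aT] : a \in Psi /\ a \notin Theta.
  by have := set11 a; rewrite -eA inE => /andP[].
have [bT bP] : b \in Theta /\ b \notin Psi.
  by have := set11 b; rewrite -eB inE => /andP[].
have sub x : x \in Psi -> x != a -> x \in Theta.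
  move=> xP; apply: contraR => xT; rewrite -in_set1 -eA inE xT //.
have sub' x : x \in Theta -> x != b -> x \in Psi.
  move=> xT; apply: contraR => xP; rewrite -in_set1 -eB inE xP //.
have rab : rk b = rk a.
  have [x xT rx] := flag_rk_ex fT (rk_max a).
  have [->|xb] := eqVneq b x; first by [].
  have xP := sub' _ xT; rewrite eq_sym in xb.
  by move: aT; rewrite (flag_rk_inj fP aP (xP xb)) ?rx // xT.
have ra0 : 0 < rk a.
  rewrite lt0n rk0_least; apply: contra aT => /forallP la.
  by apply: (flag_max fT) => y _; apply/le_comparable/la.
have ran : rk a <= n.
  rewrite -ltnS ltn_neqAle -ltnS rk_max andbT rk_greatest.
  apply: contra aT => /forallP ga.
  by apply: (flag_max fT) => y _; apply/ge_comparable/ga.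
exists (rk a).-1; rewrite prednK //; split=> //.
- move=> x; rewrite prednK // => rx; apply/idP/idP.
    by move/sub; apply; apply: contraNneq rx => ->.
  by move/sub'; apply; apply: contraNneq rx => ->; rewrite rab.
- by apply: contraNneq aT => <-.
- by apply/forall_inP => x; rewrite eA inE => /eqP->.
Qed.

Lemma agree_adjacent i Psi Theta :
    i < n -> Psi \in flags P -> Theta \in flags P -> agree_off i Psi Theta ->
  Psi != Theta ->
  adjacent Psi Theta && [forall x in Psi :\: Theta, face_rank x == Posz i].
Proof.
move=> lt_i fP fT h nPT.
have ltS2 : i.+1 < n.+2 by rewrite ltnW.
have D A B : A \in flags P -> B \in flags P -> agree_off i A B -> A != B ->
    exists2 a, rk a = i.+1 & A :\: B = [set a].
  move=> fA fB hAB nAB; have [a aA ra] := flag_rk_ex fA ltS2; exists a => //.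
  apply/setP=> x; rewrite !inE; apply/andP/eqP => [[xB xA]|->].
    apply: (flag_rk_inj fA) => //; rewrite ra.
    by apply/eqP; apply: contraNT xB => rx; rewrite -hAB.
  split=> //; apply: contra nAB => aB.
  by rewrite (agree_off_eq fA fB hAB ra aA aB).
have [a ra eA] := D _ _ fP fT h nPT.
have [|b rb eB] := D _ _ fT fP (agree_off_sym h); first by rewrite eq_sym.
rewrite /adjacent eA eB !cards1 eqxx /=.
by apply/forall_inP => x; rewrite inE => /eqP->; rewrite face_rank_nat ra.
Qed.

Lemma agree_ex i Psi :
    i < n -> Psi \in flags P ->
  exists Theta, [/\ Theta \in flags P, agree_off i Psi Theta & Psi != Theta].
Proof.
move=> lt_i fP.
have ltS1 : i < n.+2 by rewrite ltnW // ltnW.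
have ltS2 : i.+1 < n.+2 by rewrite ltnW.
have [l lP rl] := flag_rk_ex fP ltS1.
have [w wP rw] := flag_rk_ex fP (lt_i : i.+2 < n.+2).
have [a aP ra] := flag_rk_ex fP ltS2.
have lw : (l < w)%O by rewrite (flag_lt fP) // rl rw ltnW.
have c2 : #|[set H | (l < H < w)%O]| = 2.
  apply: diamondP => //; rewrite !face_rankE rl rw -addn2 PoszD.
  by rewrite GRing.addrAC.
have aS : a \in [set H | (l < H < w)%O].
  by rewrite inE !(flag_lt fP) // rl ra rw !ltnSn.
have [b] : exists b, b \in [set H | (l < H < w)%O] :\ a.
  move: c2; rewrite (cardsD1 a) aS add1n => -[c1].
  by apply/set0Pn; rewrite -cards_eq0 c1.
rewrite !inE => /and3P[ba lb bw].
have rb : rk b = i.+1.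
  apply/eqP; rewrite eqn_leq -ltnS -rw rk_lt //= -rl; exact: rk_lt.
have bP : b \notin Psi.
  by apply: contra ba => bP; rewrite (flag_rk_inj fP bP aP) // ra rb.
pose Theta := b |: (Psi :\ a); exists Theta.
have cT : is_chain Theta.
  apply: is_chainU1; first by apply: is_chainS (flag_is_chain fP); apply: subD1set.
  move=> y; rewrite !inE => /andP[ya yP].
  have [ry|ry] := leqP (rk y) i.
    by apply/ge_comparable/ltW/(le_lt_trans _ lb); rewrite (flag_le fP) // rl.
  have : i.+1 < rk y.
    rewrite ltn_neqAle ry andbT; apply: contra ya => /eqP ry'.
    by rewrite (flag_rk_inj fP yP aP) // ra.
  by move=> ry2; apply/le_comparable/ltW/(lt_le_trans bw); rewrite (flag_le fP) // rw.
have fT : Theta \in flags P.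
  apply: (chain_full flag_size cT); rewrite cardsU1 !inE (negbTE bP) andbF.
  by have := flag_size fP; rewrite (cardsD1 a) aP.
split=> //.
  move=> x rx; rewrite !inE; have [xb|_] := eqVneq x b; first by rewrite xb rb eqxx in rx.
  by have [xa|_] := eqVneq x a; first by rewrite xa ra eqxx in rx.
by apply: contraNneq bP => ->; rewrite setU11.
Qed.

(** The diamond condition supplies the other flag, so for [i < n] the default value in
    [adjacent_flag] is never reached. *)
Lemma adj_spec Psi i :
    Psi \in flags P -> i < n ->
  [/\ adj Psi i \in flags P, agree_off i Psi (adj Psi i) & Psi != adj Psi i].
Proof.
move=> fP lt_i; rewrite /adj /adjacent_flag; case: pickP => [Theta|no] /=.
  case/and3P=> fT aT rT; have [k [lt_k hk nPT /forall_inP rT']] := adjacent_flagP fP fT aT.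
  suff -> : i = k by [].
  have /cards1P[a eA] : #|Psi :\: Theta| == 1%N by case/andP: aT.
  have aD : a \in Psi :\: Theta by rewrite eA set11.
  have := forall_inP rT _ aD; rewrite face_rank_nat.
  by have := rT' _ aD => /eqP-> /eqP[].
have [Theta [fT hT nT]] := agree_ex lt_i fP.
by have := no Theta; rewrite /= fT (agree_adjacent lt_i fP fT hT nT).
Qed.

Lemma adj_flag Psi i : Psi \in flags P -> i < n -> adj Psi i \in flags P.
Proof. by move=> fP /(adj_spec fP)[]. Qed.

Lemma adj_neq Psi i : Psi \in flags P -> i < n -> adj Psi i != Psi.
Proof. by move=> fP /(adj_spec fP)[_ _]; rewrite eq_sym. Qed.

Lemma adj_mem Psi i x :
  Psi \in flags P -> i < n -> rk x != i.+1 -> (x \in adj Psi i) = (x \in Psi).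
Proof. by move=> fP /(adj_spec fP)[_ h _] rx; rewrite -h. Qed.

Lemma adj_uniq Psi Theta i :
    Psi \in flags P -> Theta \in flags P -> i < n -> agree_off i Psi Theta ->
  Theta != Psi -> Theta = adj Psi i.
Proof.
move=> fP fT lt_i h nT; have [fA hA nA] := adj_spec fP lt_i.
by apply: (agree_off_uniq lt_i fP) => //; rewrite eq_sym.
Qed.

Lemma adjK Psi i : Psi \in flags P -> i < n -> adj (adj Psi i) i = Psi.
Proof.
move=> fP lt_i; have [fA hA nA] := adj_spec fP lt_i.
by apply/esym/adj_uniq => //; apply: agree_off_sym.
Qed.

Lemma adjacentP Psi Theta :
    Psi \in flags P -> Theta \in flags P -> adjacent Psi Theta ->
  exists2 i, i < n & Theta = adj Psi i.
Proof.
move=> fP fT /(adjacent_flagP fP fT)[i [lt_i h nT _]].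
by exists i => //; apply: adj_uniq; rewrite // eq_sym.
Qed.

Lemma adj_adjacent Psi i : Psi \in flags P -> i < n -> adjacent Psi (adj Psi i).
Proof.
move=> fP lt_i; have [fA hA nA] := adj_spec fP lt_i.
by case/andP: (agree_adjacent lt_i fP fA hA nA).
Qed.

(** The exchange at [i] is decided between the faces at [rk] i and i.+2, and the exchange at [k]
    leaves both alone because it happens at [rk] k.+1, above i.+2. *)
Lemma adjC Psi i k :
    Psi \in flags P -> i < n -> k < n -> i.+1 < k ->
  adj (adj Psi i) k = adj (adj Psi k) i.
Proof.
move=> fP lt_i lt_k ik.
have fi := adj_flag fP lt_i; have fk := adj_flag fP lt_k.
have fki := adj_flag fk lt_i.
have ltS1 : i < n.+2 by rewrite ltnW // ltnW.
have ltS2 : i.+1 < n.+2 by rewrite ltnW.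
have [l lP rl] := flag_rk_ex fP ltS1.
have [w wP rw] := flag_rk_ex fP (lt_i : i.+2 < n.+2).
have [a aP ra] := flag_rk_ex fP ltS2.
have [b bP rb] := flag_rk_ex fi ltS2.
have [c cP rc] := flag_rk_ex fki ltS2.
have lti1 : i.+1 < k.+1 by rewrite ltnS ltnW.
have lti2 : i.+2 < k.+1 by [].
have neS m : m < k.+1 -> (m == k.+1) = false by move/ltn_eqF.
have ni : (i == i.+1) = false by rewrite ltn_eqF.
have ni2 : (i.+2 == i.+1) = false by rewrite gtn_eqF.
have ab : b != a.
  apply: contraNneq (adj_neq fP lt_i) => ba.
  rewrite (@agree_off_eq i (adj Psi i) Psi b) ?ba //; last by rewrite -ba.
  by move=> x rx; rewrite adj_mem.
have ac : c != a.
  apply: contraNneq (adj_neq fk lt_i) => ca.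
  have ak : a \in adj Psi k by rewrite adj_mem ?ra ?neS.
  rewrite (@agree_off_eq i (adj (adj Psi k) i) (adj Psi k) c) ?ca //; last by rewrite -ca.
  by move=> x rx; rewrite adj_mem.
have li : l \in adj Psi i by rewrite adj_mem ?rl ?ni.
have wi : w \in adj Psi i by rewrite adj_mem ?rw ?ni2.
have lk : l \in adj Psi k by rewrite adj_mem ?rl ?neS // ltnW.
have wk : w \in adj Psi k by rewrite adj_mem ?rw ?neS.
have lki : l \in adj (adj Psi k) i by rewrite adj_mem ?rl ?ni.
have wki : w \in adj (adj Psi k) i by rewrite adj_mem ?rw ?ni2.
have ebc : b = c.
  apply: (@between_unique l w a) => //.
  - by apply: (flag_between fP); rewrite // ?rl ?ra ?rw.
  - by apply: (flag_between fi); rewrite // ?rl ?rb ?rw.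
  - by apply: (flag_between fki); rewrite // ?rl ?rc ?rw.
  - by rewrite rw rl.
apply/esym/adj_uniq => //.
  move=> x rx; have [rxi|rxi] := eqVneq (rk x) i.+1; last by rewrite !adj_mem.
  apply/idP/idP => xP.
    by have -> : x = c by rewrite -ebc; apply: (flag_rk_inj fi); rewrite ?rb.
  by have -> : x = b by rewrite ebc; apply: (flag_rk_inj fki); rewrite ?rc.
have [e ek re] := flag_rk_ex fk (ltnW (lt_k : k.+2 < n.+2)).
have rei : rk e != i.+1 by rewrite re gtn_eqF.
apply: contraNneq (adj_neq fP lt_k) => eki.
have eP : e \in Psi by rewrite -(adj_mem fP lt_i) // -eki adj_mem.
by rewrite (agree_off_eq fk fP _ re) // => x rx; rewrite adj_mem.
Qed.

Section Automorphism.
Context (s : {perm P}) (sG : s \in Gamma P).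

Lemma Gamma_le : {mono s : x y / (x <= y)%O}.
Proof. by move=> x y; move: sG; rewrite inE => /forallP/(_ x)/forallP/(_ y)/eqP. Qed.

Lemma Gamma_rk x : rk (s x) = rk x.
Proof. exact: (iso_rk (permK s) (permKV s) Gamma_le). Qed.

Lemma Gamma_flag Psi : Psi \in flags P -> s @: Psi \in flags P.
Proof. exact: (iso_flag (permK s) (permKV s) Gamma_le). Qed.

Lemma adj_Gamma Psi i : Psi \in flags P -> i < n -> adj (s @: Psi) i = s @: adj Psi i.
Proof.
move=> fP lt_i; have fA := adj_flag fP lt_i.
apply/esym/adj_uniq; rewrite ?Gamma_flag //.
  move=> x; rewrite -[x](permKV s) Gamma_rk => rx.
  by rewrite !mem_imset ?adj_mem //; apply: perm_inj.
by rewrite (inj_eq (imset_inj perm_inj)) adj_neq.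
Qed.

End Automorphism.

Section Connected.
Context (connP : strongly_flag_connected P).

(** Induction along a path of adjacent flags. Each step records that both of its ends contain
    [Phi :&: Psi], which later shows that a common face is never exchanged. *)
Lemma flag_ind (A : {set P} -> Prop) Phi Psi :
    Phi \in flags P -> Psi \in flags P ->
    (forall Theta i, Theta \in flags P -> i < n -> Phi :&: Psi \subset Theta ->
       Phi :&: Psi \subset adj Theta i -> A Theta -> A (adj Theta i)) ->
  A Phi -> A Psi.
Proof.
move=> fP fQ step; case/connectP: (connP fP fQ) => s ps lastE; rewrite {}lastE in fQ step ps *.
move: step ps; move: (Phi :&: _) => I step; elim: s Phi fP {fQ} => //= Theta s IHs Phi fP.
case/andP=> /and5P[_ fT aT sP sT] pT AP; apply: IHs => //.
have [i lt_i eT] := adjacentP fP fT aT.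
by rewrite eT; apply: step; rewrite -?eT.
Qed.

(** Automorphisms commute with [adj], so being fixed spreads from one flag to all of them, and a
    face is the only one of its rank in a flag through it. *)
Lemma Gamma_free s Phi :
  s \in Gamma P -> Phi \in flags P -> s @: Phi = Phi -> s = 1.
Proof.
move=> sG fP sP.
have fixed Psi : Psi \in flags P -> s @: Psi = Psi.
  move=> fQ; apply: (flag_ind fP fQ (A := fun Psi => s @: Psi = Psi)) => //.
  by move=> Theta i fT lt_i _ _ sT; rewrite -adj_Gamma // sT.
apply/permP=> x; rewrite perm1; have [Psi fQ xP] := flag_through x.
apply: (flag_rk_inj fQ); rewrite ?Gamma_rk //.
by rewrite -(fixed _ fQ) imset_f.
Qed.

Lemma Gamma_eq s t Phi :
    s \in Gamma P -> t \in Gamma P -> Phi \in flags P -> s @: Phi = t @: Phi ->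
  s = t.
Proof.
move=> sG tG fP est; apply/eqP; rewrite eq_mulgV1; apply/eqP.
apply: (@Gamma_free _ Phi) => //.
  by rewrite groupM ?groupV.
rewrite -{2}[Phi](iso_imsetK (permK t)) -est -imset_comp.
by apply: eq_imset => x; rewrite /= permM.
Qed.

End Connected.
End Ranked.

Lemma connect_map (T U : finType) (e : rel T) (e' : rel U) (h : T -> U) x y :
  (forall a b, e a b -> e' (h a) (h b)) -> connect e x y -> connect e' (h x) (h y).
Proof.
move=> he /connectP[s + ->]; elim: s x => //= z s IHs x /andP[/he exz /IHs].
by apply: connect_trans; apply: connect1.
Qed.

Lemma surj_bij (T U : finType) (h : T -> U) :
  injective h -> (forall y, exists x, h x = y) -> bijective h.
Proof.
move=> h_inj h_surj; have ex y : exists x, h x == y.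
  by have [x <-] := h_surj y; exists x.
exists (fun y => xchoose (ex y)) => [x|y]; last exact/eqP/(xchooseP (ex y)).
by apply: h_inj; apply/eqP/(xchooseP (ex (h x))).
Qed.

Lemma regularP (d : Order.disp_t) (P : finPOrderType d) :
  regular P <-> (exists Phi, Phi \in flags P) /\
    forall Phi Psi, Phi \in flags P -> Psi \in flags P ->
      exists2 s, s \in Gamma P & s @: Phi = Psi.
Proof.
split=> [tr|[[Phi fP] h]].
  split; first by case/imsetP: tr => Phi; exists Phi.
  by move=> Phi Psi fP fQ; have := fQ; rewrite -(atransP tr _ fP) => /orbitP[s sG <-]; exists s.
apply/imsetP; exists Phi => //; apply/setP=> Psi; apply/idP/orbitP => [fQ|[s sG <-]].
  by have [s sG e] := h _ _ fP fQ; exists s.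
exact: (Gamma_flag sG).
Qed.

(** * Sphericity is invariant under isomorphism *)

Section SphericalIso.
Context {dA dB : Order.disp_t} {A : finPOrderType dA} {B : finPOrderType dB}.
Context (f : A -> B) (g : B -> A) (fK : cancel f g) (gK : cancel g f).
Context (f_le : {mono f : x y / (x <= y)%O}).
Let f_inj := can_inj fK.
Let g_inj := can_inj gK.
Let g_le := iso_inv_le gK f_le.
Let gF := iso_flag gK fK g_le.
Let fF := iso_flag fK gK f_le.

Lemma iso_polytope n : is_polytope n A -> is_polytope n B.
Proof.
case=> [[F lF] [G gG] sz conn diam]; split.
- by exists (f F) => y; rewrite -[y]gK f_le.
- by exists (f G) => y; rewrite -[y]gK f_le.
- by move=> Psi fP; rewrite -(card_imset _ g_inj); apply/sz/gF.
- move=> Phi Psi fP fQ; set R := (X in connect X _ _).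
  have H : connect R (f @: (g @: Phi)) (f @: (g @: Psi)); last first.
    by rewrite !(iso_imsetK gK) in H.
  apply: (connect_map (h := fun C : {set A} => f @: C) _
    (conn _ _ (gF fP) (gF fQ))) => C D /=.
  case/and5P=> fC fD aCD sC sD.
  rewrite /R /= !fF // (iso_adjacent fK) aCD /=.
  have -> : Phi :&: Psi = f @: (g @: Phi :&: g @: Psi).
    by rewrite -(imsetI (in2W g_inj)) (iso_imsetK gK).
  by rewrite !imsetS.
- move=> x y xy; rewrite !face_rankE => rxy.
  have := diam (g x) (g y); rewrite (iso_lt gK g_le) !face_rankE.
  rewrite !(iso_rk gK fK g_le) => /(_ xy rxy) <-.
  rewrite -(card_imset _ g_inj); apply: eq_card => z; rewrite -[z]fK (mem_imset _ _ g_inj).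
  by rewrite !inE !(iso_lt gK g_le).
Qed.

Lemma iso_regular : regular A -> regular B.
Proof.
case/regularP=> [[Phi fP] tr]; apply/regularP; split; first by exists (f @: Phi); apply: fF.
move=> Psi Theta fQ fT; have [s sG e] := tr _ _ (gF fQ) (gF fT).
have h_inj : injective (f \o s \o g) by apply: inj_comp g_inj; apply: inj_comp f_inj perm_inj.
exists (perm h_inj).
  rewrite inE; apply/forallP=> x; apply/forallP=> y; rewrite !permE /= f_le.
  by rewrite (Gamma_le sG) g_le.
rewrite -[Theta](iso_imsetK gK) -e -!imset_comp; apply: eq_imset => x.
by rewrite permE.
Qed.

Lemma iso_spherical : spherical_map A -> spherical_map B.
Proof.
case=> pA rA euler; split; [exact: iso_polytope|exact: iso_regular|rewrite -[RHS]euler].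
have cardE (j : int) : #|[set x : B | face_rank x == j]| = #|[set x : A | face_rank x == j]|.
  rewrite -(card_imset _ g_inj); apply: eq_card => z; rewrite -[z]fK (mem_imset _ _ g_inj).
  by rewrite !inE !face_rankE (iso_rk fK gK f_le) fK.
by rewrite !cardE.
Qed.

End SphericalIso.

(** * Coverings of polytopes *)

Section Covering.
Context {dP dQ : Order.disp_t} {P : finPOrderType dP} {Q : finPOrderType dQ}.
Context (n : nat) (rQ : ranked n Q) (pi : P -> Q).
Implicit Types (x y z : P) (Psi Theta : {set P}) (F G : Q) (i : nat).

(** The hypotheses below say that [pi] is an isomorphism from the faces comparable to [x] onto those
    comparable to [pi x] when [pi x] is proper. An improper face is comparable to everything, so the
    same demand there would make [pi] a global isomorphism; for these faces only extremality is
    assumed. *)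
Definition proper_face F := 0 < rk F < n.+1.

Context (pi_le : {homo pi : x y / (x <= y)%O})
  (pi_lift : forall x G, proper_face (pi x) -> (G >=< pi x)%O ->
     exists2 y, (y >=< x)%O & pi y = G)
  (pi_refl : forall x y z, proper_face (pi x) -> (y >=< x)%O -> (z >=< x)%O ->
     (pi y <= pi z)%O -> (y <= z)%O)
  (pi_least : forall x y, rk (pi x) = 0 -> (x <= y)%O)
  (pi_greatest : forall x y, rk (pi x) = n.+1 -> (y <= x)%O)
  (pi_proper : exists x, proper_face (pi x)).

Lemma properN F : ~~ proper_face F -> rk F = 0 \/ rk F = n.+1.
Proof.
rewrite negb_and lt0n negbK => /orP[/eqP|]; first by left.
rewrite -leqNgt => h; right; apply/eqP; rewrite eqn_leq h andbT -ltnS.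
exact: rk_max rQ F.
Qed.

Lemma pi_comparable x y : (x >=< y)%O -> (pi x >=< pi y)%O.
Proof. by case/orP=> /pi_le; [apply: le_comparable|apply: ge_comparable]. Qed.

Lemma cover_inj x y z :
  proper_face (pi x) -> (y >=< x)%O -> (z >=< x)%O -> pi y = pi z -> y = z.
Proof.
by move=> px cy cz eyz; apply/le_anti; rewrite !(pi_refl px) // eyz.
Qed.

Lemma pi_reflect x y : (x >=< y)%O -> (pi x <= pi y)%O -> (x <= y)%O.
Proof.
move=> cxy le_xy; have [px|/properN[x0|x1]] := boolP (proper_face (pi x)).
- by apply: (pi_refl px) => //; rewrite ?comparablexx // comparable_sym.
- exact: pi_least.
apply: pi_greatest; apply/eqP; rewrite eqn_leq -{2}x1 (rk_le rQ) // andbT.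
by rewrite -ltnS (rk_max rQ).
Qed.

Lemma pi_leE x y : (x >=< y)%O -> (pi x <= pi y)%O = (x <= y)%O.
Proof. by move=> cxy; apply/idP/idP; [apply: pi_reflect|apply: pi_le]. Qed.

Lemma pi_inj x y : (x >=< y)%O -> pi x = pi y -> x = y.
Proof.
by move=> cxy exy; apply/le_anti; rewrite -!pi_leE ?exy ?lexx // comparable_sym.
Qed.

Lemma pi_ltE x y : (x >=< y)%O -> (pi x < pi y)%O = (x < y)%O.
Proof.
move=> cxy; rewrite !lt_leAnge !pi_leE // comparable_sym //.
Qed.

Lemma pi_chain Psi : is_chain Psi -> is_chain (pi @: Psi).
Proof.
move/is_chainP=> cP; apply/is_chainP=> _ _ /imsetP[x xP ->] /imsetP[y yP ->].
by apply: pi_comparable; apply: cP.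
Qed.

Lemma improper_comparable x y : ~~ proper_face (pi x) -> (x >=< y)%O.
Proof.
by case/properN=> h; [apply/le_comparable/pi_least|apply/ge_comparable/pi_greatest].
Qed.

(** Otherwise the flag would consist of improper faces, and any proper face could be added to it. *)
Lemma flag_has_proper Psi :
  Psi \in flags P -> exists2 x, x \in Psi & proper_face (pi x).
Proof.
move=> fP; case: (pickP [pred x in Psi | proper_face (pi x)]) => [x /andP[]|no].
  by exists x.
have [x px] := pi_proper; exists x => //; apply: (flag_max fP) => y yP.
rewrite comparable_sym; apply: improper_comparable.
by have /negbT := no y; rewrite inE yP.
Qed.

Lemma flag_lift_mem Psi x y :
    Psi \in flags P -> x \in Psi -> proper_face (pi x) -> (y >=< x)%O ->
  {in Psi, forall z, (pi y >=< pi z)%O} -> y \in Psi.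
Proof.
move=> fP xP px cyx cy; apply: (flag_max fP) => z zP.
have czx := flag_comparable fP zP xP.
by case/orP: (cy z zP) => /(pi_refl px) h; [apply/le_comparable/h|apply/ge_comparable/h].
Qed.

(** A face extending the image lifts, through a proper face of [Psi], to a face comparable to all of
    [Psi], hence already in [Psi]. *)
Lemma pi_flag Psi : Psi \in flags P -> pi @: Psi \in flags Q.
Proof.
move=> fP; have [x xP px] := flag_has_proper fP.
have cP := flag_is_chain fP; have cQ := pi_chain cP.
rewrite inE; apply/maxsetP; split=> // C cC sPC; apply/eqP; rewrite eqEsubset sPC andbT.
apply/subsetP=> G GC.
have cG z : z \in Psi -> (G >=< pi z)%O.
  by move=> zP; apply: (is_chainP _ cC) => //; apply: (subsetP sPC); apply: imset_f.
have [y cyx eG] := pi_lift px (cG x xP).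
apply/imsetP; exists y => //; apply: (flag_lift_mem fP xP px cyx) => z zP.
by rewrite eG cG.
Qed.

Lemma pi_inj_chain Psi : is_chain Psi -> {in Psi &, injective pi}.
Proof. by move=> /is_chainP cP x y xP yP; apply: pi_inj; apply: cP. Qed.

Lemma cover_flag_size Psi : Psi \in flags P -> #|Psi| = n.+2.
Proof.
move=> fP; rewrite -(card_in_imset (pi_inj_chain (flag_is_chain fP))).
by case: rQ => _ _ h _; apply/h/pi_flag.
Qed.

Lemma cover_rk x : rk x = rk (pi x).
Proof.
have [Psi fP xP] := flag_through x; rewrite (rk_flag cover_flag_size fP xP).
have szQ : forall Psi : {set Q}, Psi \in flags Q -> #|Psi| = n.+2 by case: rQ.
rewrite (rk_flag szQ (pi_flag fP) (imset_f _ xP)).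
rewrite -(card_in_imset (f := pi)); last first.
  move=> y z; rewrite !inE => /andP[yP _] /andP[zP _].
  exact: (pi_inj_chain (flag_is_chain fP)).
apply: eq_card => G; apply/imsetP/idP => [[y]|].
  rewrite inE => /andP[yP yx ->]; rewrite inE imset_f // pi_ltE //.
  exact: lt_comparable.
rewrite inE => /andP[/imsetP[y yP ->]]; rewrite pi_ltE; last exact: (flag_comparable fP).
by move=> yx; exists y; rewrite // inE yP.
Qed.

(** The substitute for injectivity of [pi], which may fail globally: a shared proper face puts both
    flags on the same sheet of the cover. *)
Lemma flag_eq_of_pi Psi Theta x :
    Psi \in flags P -> Theta \in flags P -> x \in Psi -> x \in Theta ->
  proper_face (pi x) -> pi @: Psi = pi @: Theta -> Psi = Theta.
Proof.
move=> fP fT xP xT px e; apply/esym/(flag_maximal fP); first exact: flag_is_chain.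
apply/subsetP=> y yP; apply: (flag_lift_mem fT xT px).
  exact: (flag_comparable fP).
move=> z zT; apply: (flag_comparable (pi_flag fP)); first exact: imset_f.
by rewrite e imset_f.
Qed.

(** The local section of [pi] on the sheet through [x]. *)
Definition lift_flag x (Psi : {set Q}) : {set P} :=
  [set y | (y >=< x)%O && (pi y \in Psi)].

Section Lift.
Context (x : P) (px : proper_face (pi x)).

Lemma pi_lift_flag (C : {set Q}) :
  {in C, forall F, (F >=< pi x)%O} -> pi @: lift_flag x C = C.
Proof.
move=> cC; apply/setP=> F; apply/imsetP/idP => [[y]|FC].
  by rewrite inE => /andP[_ ? ->].
by have [y cy eF] := pi_lift px (cC F FC); exists y; rewrite // inE cy eF.
Qed.

Lemma lift_flag_flag (Psi : {set Q}) :
  Psi \in flags Q -> pi x \in Psi -> lift_flag x Psi \in flags P.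
Proof.
move=> fP xP; have cL : is_chain (lift_flag x Psi).
  apply/is_chainP => y z; rewrite !inE => /andP[cy yP] /andP[cz zP].
  have := flag_comparable fP yP zP.
  by case/orP=> /(pi_refl px) h; [apply/le_comparable/h|apply/ge_comparable/h].
have [Theta fT sT] := chain_flag cL; suff -> : lift_flag x Psi = Theta by [].
apply/eqP; rewrite eqEsubset sT; apply/subsetP=> y yT.
have xL : x \in lift_flag x Psi by rewrite inE comparablexx.
have cyx := flag_comparable fT yT (subsetP sT _ xL).
rewrite inE cyx /=; apply: (flag_max fP) => F FP.
have [|z cz eF] := pi_lift px (G := F); first exact: (flag_comparable fP).
rewrite -eF; apply: pi_comparable; apply: (flag_comparable fT) => //.
by apply: (subsetP sT); rewrite inE cz eF.
Qed.

Lemma lift_flagK Psi : Psi \in flags P -> x \in Psi -> lift_flag x (pi @: Psi) = Psi.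
Proof.
move=> fP xP; have fL := lift_flag_flag (pi_flag fP) (imset_f _ xP).
apply: (flag_eq_of_pi fL fP _ xP px).
  by rewrite inE comparablexx imset_f.
apply: pi_lift_flag => _ /imsetP[y yP ->].
by apply: pi_comparable; apply: (flag_comparable fP).
Qed.

Lemma lift_flagD (C D : {set Q}) :
  {in C, forall F, (F >=< pi x)%O} ->
  #|lift_flag x C :\: lift_flag x D| = #|C :\: D|.
Proof.
move=> cC; have -> : lift_flag x C :\: lift_flag x D = lift_flag x (C :\: D).
  by apply/setP=> y; rewrite !inE; case: (_ >=< _)%O; rewrite ?andbF.
rewrite -(card_in_imset (f := pi)).
  by rewrite pi_lift_flag // => F /setDP[/cC].
by move=> y z; rewrite !inE => /andP[cy _] /andP[cz _]; apply: (cover_inj px).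
Qed.

Lemma lift_flag_adjacent (C D : {set Q}) :
    {in C, forall F, (F >=< pi x)%O} -> {in D, forall F, (F >=< pi x)%O} ->
  adjacent (lift_flag x C) (lift_flag x D) = adjacent C D.
Proof. by move=> cC cD; rewrite /adjacent !lift_flagD. Qed.

End Lift.

Lemma cover_least : exists x : P, least x.
Proof.
have [x px] := pi_proper; have [F lF] : exists F : Q, least F by case: rQ.
have [y _ eF] := pi_lift px (le_comparable (lF (pi x))).
exists y => z; apply: pi_least; rewrite eF; apply/eqP.
by rewrite (rk0_least rQ); apply/forallP.
Qed.

Lemma cover_greatest : exists x : P, greatest x.
Proof.
have [x px] := pi_proper; have [F lF] : exists F : Q, greatest F by case: rQ.
have [y _ eF] := pi_lift px (ge_comparable (lF (pi x))).
exists y => z; apply: pi_greatest; rewrite eF; apply/eqP.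
by rewrite (rk_greatest rQ); apply/forallP.
Qed.

Lemma cover_between x y z :
    proper_face (pi z) -> (x >=< z)%O -> (y >=< z)%O ->
    {in [set w | (pi x < w < pi y)%O], forall F, (F >=< pi z)%O} ->
    {in [set w | (x < w < y)%O], forall w, (w >=< z)%O} ->
  #|[set w | (x < w < y)%O]| = #|[set w | (pi x < w < pi y)%O]|.
Proof.
move=> pz cx cy cF cw; rewrite -(card_in_imset (f := pi)).
  apply: eq_card => F; apply/imsetP/idP => [[w wxy ->]|FC].
    move: wxy; rewrite !inE => /andP[xw wy].
    by rewrite !pi_ltE ?xw //; apply: lt_comparable.
  have [w cw' eF] := pi_lift pz (cF _ FC); exists w => //.
  have lt_refl a b : (a >=< z)%O -> (b >=< z)%O -> (pi a < pi b)%O -> (a < b)%O.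
    move=> ca cb ab; rewrite lt_neqAle (pi_refl pz ca cb (ltW ab)) andbT.
    by apply: contraTneq ab => ->; rewrite ltxx.
  by move: FC; rewrite !inE -eF => /andP[xF Fy]; rewrite !lt_refl.
by move=> w w' /cw cw1 /cw cw2; apply: (cover_inj pz).
Qed.

Lemma cover_diamond : 2 < n.+1 -> diamond_condition P.
Proof.
move=> n2 x y xy; rewrite !face_rankE !cover_rk => rxy.
have pxy : (pi x < pi y)%O by rewrite pi_ltE // lt_comparable.
have diam : diamond_condition Q by case: rQ.
have <- : #|[set w | (pi x < w < pi y)%O]| = 2 by apply: diam.
have [px|npx] := boolP (proper_face (pi x)).
  apply: (cover_between px); rewrite ?comparablexx ?gt_comparable //.
    by move=> F; rewrite inE => /andP[h _]; apply: gt_comparable.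
  by move=> w; rewrite inE => /andP[h _]; apply: gt_comparable.
have [py|npy] := boolP (proper_face (pi y)).
  apply: (cover_between py); rewrite ?comparablexx ?lt_comparable //.
    by move=> F; rewrite inE => /andP[_ h]; apply: lt_comparable.
  by move=> w; rewrite inE => /andP[_ h]; apply: lt_comparable.
(* Two distinct improper faces are [n.+1] ranks apart, which is more than 2. *)
exfalso; move: (rk_lt (P := Q) (n := n) rQ pxy) rxy.
case/properN: npx => ->; case/properN: npy => -> //; rewrite ?ltnn //.
move=> _ /(congr1 (fun a => a + 1)%R); rewrite GRing.subrK GRing.addrAC GRing.subrK.
by move=> [n1]; rewrite n1 in n2.
Qed.

Lemma cover_ranked : 2 < n.+1 -> ranked n P.
Proof.
by move=> n2; split; [exact: cover_least|exact: cover_greatest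
  |exact: cover_flag_size|exact: cover_diamond].
Qed.

Lemma cover_adj Psi i :
    2 < n.+1 -> Psi \in flags P -> i < n ->
  pi @: adj Psi i = adj (pi @: Psi) i.
Proof.
move=> n2 fP lt_i; have rP := cover_ranked n2.
have fA := adj_flag rP fP lt_i.
have agr : forall x, rk x != i.+1 -> (x \in Psi) = (x \in adj Psi i).
  by move=> x rx; rewrite (adj_mem rP fP lt_i rx).
apply: (adj_uniq rQ (pi_flag fP) (pi_flag fA) lt_i).
  by move=> F rF; apply/imsetP/imsetP => -[x xP eF]; exists x => //;
    move: xP; rewrite agr // cover_rk -eF.
(* A proper rank that the exchange leaves alone, so that [flag_eq_of_pi] applies; there are at least
   two proper ranks, and 1 or 2 will do. *)
have [j [lt_j j0 ji]] : exists j, [/\ j < n.+1, 0 < j & j != i.+1].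
  have [->|i0] := eqVneq i 0; first by exists 2.
  by exists 1%N; rewrite eqSS eq_sym i0; split=> //; apply: ltnW.
have [z zP rz] := flag_rk_ex rP fP (ltnW lt_j : j < n.+2).
have pz : proper_face (pi z) by rewrite /proper_face -cover_rk rz lt_j andbT.
apply: contraNneq (adj_neq rP fP lt_i) => e.
by rewrite (flag_eq_of_pi fA fP _ zP pz e) // (adj_mem rP fP lt_i) // rz.
Qed.

(** The path in [Q] is lifted on the sheet of [x], which is why the flags must share a proper face.
    Passing from sheet to sheet requires more knowledge of the cover. *)
Lemma cover_connected Phi Psi x :
    strongly_flag_connected Q ->
    Phi \in flags P -> Psi \in flags P -> x \in Phi -> x \in Psi ->
    proper_face (pi x) ->
  connect [rel A B : {set P} |
    [&& A \in flags P, B \in flags P, adjacent A B,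
        Phi :&: Psi \subset A & Phi :&: Psi \subset B]] Phi Psi.
Proof.
move=> connQ fP fQ xP xQ px.
set R := (X in connect X _ _).
have subI (A : {set Q}) : pi @: Phi :&: pi @: Psi \subset A ->
    Phi :&: Psi \subset lift_flag x A.
  move=> /subsetP sA; apply/subsetP=> z /setIP[zP zQ].
  by rewrite !inE (flag_comparable fP) // sA // inE !imset_f.
have xI (A : {set Q}) : pi @: Phi :&: pi @: Psi \subset A -> pi x \in A.
  by move=> /subsetP; apply; rewrite inE !imset_f.
have H : connect R (lift_flag x (pi @: Phi)) (lift_flag x (pi @: Psi)); last first.
  by rewrite !(lift_flagK px) in H.
apply: (connect_map (h := lift_flag x) _
  (connQ _ _ (pi_flag fP) (pi_flag fQ))) => A B /=.
case/and5P=> fA fB aAB sA sB; rewrite /R /= !lift_flag_flag ?xI // !subI //= andbT.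
by rewrite (lift_flag_adjacent px) // => F FA;
  [apply: (flag_comparable fA FA (xI _ sA))|apply: (flag_comparable fB FA (xI _ sB))].
Qed.

Section FaceSections.
Context (x F G : P) (px : proper_face (pi x)).
Context (cF : (F >=< x)%O) (cG : (G >=< x)%O).
Context (cz : forall z, (F <= z <= G)%O -> (z >=< x)%O).
Context (cw : forall w, (pi F <= w <= pi G)%O -> (w >=< pi x)%O).

Lemma pi_section_subproof (z : face_section F G) :
  (pi F <= pi (underlying_face z) <= pi G)%O.
Proof. by case: z => z /= /andP[Fz zG]; rewrite !pi_le. Qed.

Definition pi_section (z : face_section F G) : face_section (pi F) (pi G) :=
  FaceSection (pi_section_subproof z).

Lemma section_spherical :
  spherical_map (face_section (pi F) (pi G)) -> spherical_map (face_section F G).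
Proof.
have h_le : {mono pi_section : z w / (z <= w)%O}.
  move=> [z Fz] [w Fw]; rewrite !leEsub /=; apply/idP/idP; last exact: pi_le.
  by apply: (pi_refl px); apply: cz.
have h_inj : injective pi_section.
  by move=> z w e; apply/le_anti; rewrite -!h_le e lexx.
have [|k hK kK] := surj_bij h_inj.
  move=> [w Fw]; have [z czx ez] := pi_lift px (cw Fw).
  have Fz : (F <= z <= G)%O.
    by case/andP: Fw => Fw wG; rewrite !(pi_refl px) // ez.
  by exists (FaceSection Fz); apply: val_inj.
exact: (iso_spherical kK hK (iso_inv_le kK h_le)).
Qed.

End FaceSections.

(** All faces of a facet, or of a vertex-figure, are comparable to one proper face, so [pi] maps the
    section isomorphically to a section of [Q]. *)
Lemma cover_locally_spherical :
  n = 4 -> locally_spherical Q -> locally_spherical P.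
Proof.
move=> n4 [facets vfigs]; split=> F G.
  move=> lF /eqP; rewrite (face_rank_nat G 3) => /eqP rG.
  have pG : proper_face (pi G) by rewrite /proper_face -cover_rk rG n4.
  have lpF : least (pi F).
    have rF : rk F = 0 by apply/eqP; rewrite (rk0_least (cover_ranked _)) ?n4 //; apply/forallP.
    by apply/forallP; rewrite -(rk0_least rQ) -cover_rk rF.
  apply: (section_spherical pG); rewrite ?comparablexx ?(le_comparable (lF G)) //.
  - by move=> z /andP[_ zG]; apply: le_comparable.
  - by move=> z /andP[_ zG]; apply: le_comparable.
  apply: facets => //; apply/eqP; rewrite (face_rank_nat _ 3) -cover_rk; exact/eqP.
move=> /eqP + gG; rewrite (face_rank_nat F 0) => /eqP rF.
have pF : proper_face (pi F) by rewrite /proper_face -cover_rk rF n4.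
have gpG : greatest (pi G).
  have rG : rk G = n.+1 by apply/eqP; rewrite (rk_greatest (cover_ranked _)) ?n4 //; apply/forallP.
  by apply/forallP; rewrite -(rk_greatest rQ) -cover_rk rG.
apply: (section_spherical pF); rewrite ?comparablexx ?(ge_comparable (gG F)) //.
- by move=> z /andP[zF _]; apply: ge_comparable.
- by move=> z /andP[zF _]; apply: ge_comparable.
apply: vfigs => //; apply/eqP; rewrite (face_rank_nat _ 0) -cover_rk; exact/eqP.
Qed.

End Covering.

(** * Presentations of spherical rotation groups *)

Lemma coprime_exp_eq1 (gT : finGroupType) (x : gT) m n :
  coprime m n -> x ^+ m = 1 -> x ^+ n = 1 -> x = 1.
Proof.
move=> co_mn /eqP xm /eqP xn; apply/eqP; rewrite -order_eq1 -dvdn1.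
by rewrite -(eqP co_mn) dvdn_gcd !order_dvdn xm xn.
Qed.

Lemma prime_expg_eq1 (gT hT : finGroupType) (x : gT) (y : hT) q k :
    prime q -> x ^+ q = 1 -> x != 1 -> y ^+ q = 1 -> x ^+ k = 1 ->
  y ^+ k = 1.
Proof.
move=> pr_q xq x1 yq xk; have [/dvdnP[m ->]|] := boolP (q %| k).
  by rewrite mulnC expgM yq expg1n.
by rewrite -prime_coprime // => /coprime_exp_eq1/(_ xq xk) xE; rewrite xE eqxx in x1.
Qed.

Lemma gen_ind (gT : finGroupType) (A : {set gT}) (Pr : gT -> Prop) :
    Pr 1 -> (forall x a, a \in A -> Pr x -> Pr (x * a)) ->
  forall x, x \in <<A>> -> Pr x.
Proof.
move=> P1 PM x /gen_prodgP[n [c cA ->]].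
elim: n c cA => [|n IHn] c cA; first by rewrite big_ord0.
by rewrite big_ord_recr /=; apply: PM; first exact: cA; apply: IHn => i; apply: cA.
Qed.

Lemma gen_indl (gT : finGroupType) (A : {set gT}) (Pr : gT -> Prop) :
    Pr 1 -> (forall x a, a \in A -> Pr x -> Pr (a * x)) ->
  forall x, x \in <<A>> -> Pr x.
Proof.
move=> P1 PM x /gen_prodgP[n [c cA ->]].
elim: n c cA => [|n IHn] c cA; first by rewrite big_ord0.
by rewrite big_ord_recl /=; apply: PM; first exact: cA; apply: IHn => i; apply: cA.
Qed.

(** The two equations are what [zx] and [zyx] below become if [z] is sent to a power of [v]. They
    show that [u] conjugates v^2 to v, hence v to v^3; then u^3 = 1 gives v = v^27, and v^5 = 1
    leaves only v = 1. *)
Lemma ico_exp_eq1 (gT : finGroupType) (u v : gT) k :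
    u ^+ 3 = 1 -> v ^+ 5 = 1 -> v ^+ k * u = v * u * v ^+ 2 ->
  v ^+ k * v * u = u * v ^+ 3 -> v = 1.
Proof.
move=> u3 v5 e1 e2.
have e3 : v * v * u = u * v.
  apply: (mulIg (v ^+ 2)); rewrite -[RHS]mulgA -(expgS v 2) -e2 -(expgSr v k) (expgS v k).
  by rewrite -(mulgA v (v ^+ k)) e1 !mulgA.
have e4 : (v ^+ 2) ^ u = v by rewrite conjgE expgS expg1 e3 mulKg.
have e5 : v ^ u = v ^+ 3.
  by rewrite -{2}e4 -conjXg -expgM (expgS v 5) v5 mulg1.
have e6 : v ^ (u ^+ 3) = v ^+ 27.
  have -> : u ^+ 3 = u * u * u by rewrite !expgS expg0 mulg1 mulgA.
  by rewrite !conjgM e5 conjXg e5 -expgM conjXg e5 -expgM.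
move: e6; rewrite u3 conjg1 (expgS v 26) => e6.
apply: (@coprime_exp_eq1 _ _ 5 26) => //.
by apply: (mulgI v); rewrite mulg1 -e6.
Qed.

Section Icosahedral.
Context (gT : finGroupType) (x y : gT).
Context (x3 : x ^+ 3 = 1) (y5 : y ^+ 5 = 1) (xy2 : (x * y) ^+ 2 = 1).

Let xxx : x * x * x = 1. Proof. by rewrite -[RHS]x3 !expgS expg0 mulg1 mulgA. Qed.
Let xyxy : x * y * x * y = 1.
Proof. by rewrite -[RHS]xy2 !expgS expg0 mulg1 ?mulgA. Qed.

Let xyx : x * y * x = y^-1.
Proof. by apply: (mulIg y); rewrite xyxy mulVg. Qed.
Let xV : x^-1 = x * x.
Proof. by apply: (mulIg x); rewrite xxx mulVg. Qed.
Let xVV : x = x^-1 * x^-1.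
Proof. by rewrite -invMg -xV invgK. Qed.
Let YX : y^-1 * x^-1 = x * y.
Proof. by rewrite -xyx mulgK. Qed.
Let XY : x^-1 * y^-1 = y * x.
Proof. by rewrite -xyx -!mulgA mulKg. Qed.
Let xx : x * x = y * x * y.
Proof. by apply: (mulgI x); rewrite ?mulgA xyxy; exact: xxx. Qed.
Let yV : y^-1 = y ^+ 4.
Proof. by apply: (mulIg y); rewrite mulVg -expgSr. Qed.
Let y2V : y^-1 * y^-1 = y ^+ 3.
Proof. by rewrite -invMg; apply: (mulIg (y * y)); rewrite mulVg mulgA -!expgSr. Qed.
Let y2E : y ^+ 2 = y * y. Proof. by rewrite expgS expg1. Qed.
Let y4V : y ^+ 4 = y^-1. Proof. by rewrite yV. Qed.

(** In A5 the subgroup H generated by [y] has four double cosets, H, HxH, HzH and Ht, of sizes 5,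
    25, 25 and 5; the element [t] inverts [y]. The identities below rewrite a representative times a
    power of [y] times [x]. *)
Let z := x * y^-1 * x.
Let t := y ^+ 2 * z * y ^+ 3 * x.

Let xy2x : x * y ^+ 2 * x = y^-1 * x * y^-1.
Proof.
have -> : x * y ^+ 2 * x = (x * y) * (y * x) by rewrite ?y2E ?mulgA.
by rewrite -YX -XY {3}xVV ?mulgA.
Qed.

Let xy3x : x * y ^+ 3 * x = y^-1 * z * y^-1.
Proof.
have -> : y^-1 * z * y^-1 = (y^-1 * x^-1) * (x^-1 * y^-1) * x^-1 * (x^-1 * y^-1).
  by rewrite /z {1 2}xVV ?mulgA.
by rewrite YX XY !expgS expg0 mulg1 ?mulgA mulgK.
Qed.

Let zx : z * x = y * x * y ^+ 2.
Proof.
by rewrite /z -!mulgA -xV YX ?mulgA xx ?y2E ?mulgA.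
Qed.

Let zyx : z * y * x = x * y ^+ 3.
Proof. by rewrite /z -!mulgA (mulgA x y) xyx y2V. Qed.

Let zy2x : z * y ^+ 2 * x = y^-1 * z * y ^+ 3.
Proof.
have -> : z * y ^+ 2 * x = x * y^-1 * (x * y ^+ 2 * x) by rewrite /z ?mulgA.
rewrite xy2x.
have -> : x * y^-1 * (y^-1 * x * y^-1) = x * (y^-1 * y^-1) * x * y^-1.
  by rewrite ?mulgA.
by rewrite y2V xy3x -mulgA y2V.
Qed.

Let zy4x : z * y ^+ 4 * x = y * z * y.
Proof.
have e1 : y * z * y = x^-1 * y ^+ 2 * x^-1.
  have -> : y * z * y = (y * x) * y^-1 * (x * y) by rewrite /z ?mulgA.
  rewrite -XY -YX; have -> : x^-1 * y^-1 * y^-1 * (y^-1 * x^-1)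
    = x^-1 * (y^-1 * (y^-1 * y^-1)) * x^-1 by rewrite ?mulgA.
  by rewrite y2V yV -expgD (_ : 4 + 3 = 5 + 2)%N // expgD y5 mul1g.
rewrite e1 y4V; have -> : z * y^-1 * x = x * (y^-1 * z * y^-1) * y.
  by rewrite /z ?mulgA mulgKV.
rewrite -xy3x; have -> : x * (x * y ^+ 3 * x) * y = (x * x) * y ^+ 3 * (x * y).
  by rewrite ?mulgA.
by rewrite -xV -YX [y ^+ 3]expgSr ?mulgA mulgK.
Qed.

Let tx : t * x = y ^+ 3 * z * y ^+ 2.
Proof.
have -> : t * x = y ^+ 2 * (z * y ^+ 3 * (x * x)) by rewrite /t ?mulgA.
rewrite xx; have -> : z * y ^+ 3 * (y * x * y) = z * y ^+ 4 * x * y.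
  by rewrite [y ^+ 4]expgSr ?mulgA.
by rewrite zy4x [y ^+ 3]expgSr ?y2E ?mulgA.
Qed.

Let ty : t * y = y^-1 * t.
Proof.
have h : y * z * y ^+ 2 = z * y ^+ 3 * (x * x).
  rewrite xx; have -> : z * y ^+ 3 * (y * x * y) = z * y ^+ 4 * x * y.
    by rewrite [y ^+ 4]expgSr ?mulgA.
  by rewrite zy4x ?y2E ?mulgA.
have h2 : y * z * y ^+ 2 * x^-1 = z * y ^+ 3 * x by rewrite h ?mulgA mulgK.
have e : y ^+ 3 * (x * y) = y ^+ 2 * x^-1 by rewrite -YX mulgA expgSr mulgK.
have -> : t * y = y * (y * z * y ^+ 2 * x^-1).
  have -> : t * y = y ^+ 2 * z * (y ^+ 3 * (x * y)) by rewrite /t ?mulgA.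
  by rewrite e y2E ?mulgA.
rewrite h2; apply: (mulgI y); rewrite mulVKg.
by rewrite /t y2E ?mulgA.
Qed.

Inductive ico_form (h : gT) : Prop :=
  | IcoH i of h = y ^+ i
  | IcoX i j of h = y ^+ i * x * y ^+ j
  | IcoZ i j of h = y ^+ i * z * y ^+ j
  | IcoT i of h = y ^+ i * t.

Let mod5 j : exists2 k, k < 5 & y ^+ j = y ^+ k.
Proof. by exists (j %% 5); rewrite ?ltn_pmod // -(expg_mod _ y5). Qed.

(** Coset enumeration for the presentation of A5: the four forms are stable under right
    multiplication by [x] and by [y], exponents of [y] being reduced modulo 5. *)
Lemma ico_formP h : h \in <<[set x; y]>> -> ico_form h.
Proof.
move: h; apply: gen_ind => [|h a]; first by apply: (@IcoH _ 0); rewrite expg0.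
case/set2P=> -> [i|i j|i j|i] ->.
- by apply: (@IcoX _ i 0); rewrite mulg1.
- have [k lt_k ->] := mod5 j; rewrite -!mulgA [x * (_ * x)]mulgA.
  case: k lt_k => [|[|[|[|[|]]]]] // _.
  + by apply: (@IcoX _ i.+1 1); rewrite mulg1 xx (expgSr y i) expg1 ?mulgA.
  + by apply: (@IcoH _ (i + 4)); rewrite expg1 xyx yV expgD.
  + by apply: (@IcoX _ (i + 4) 4); rewrite xy2x yV (expgD y i 4) ?mulgA.
  + by apply: (@IcoZ _ (i + 4) 4); rewrite xy3x (expgD y i 4) -yV ?mulgA.
  + by rewrite y4V; apply: (@IcoZ _ i 0); rewrite mulg1.
- have [k lt_k ->] := mod5 j.
  have -> : y ^+ i * z * y ^+ k * x = y ^+ i * (z * y ^+ k * x) by rewrite ?mulgA.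
  case: k lt_k => [|[|[|[|[|]]]]] // _.
  + by apply: (@IcoX _ i.+1 2); rewrite mulg1 zx (expgSr y i) ?mulgA.
  + by apply: (@IcoX _ i 3); rewrite expg1 zyx ?mulgA.
  + by apply: (@IcoZ _ (i + 4) 3); rewrite zy2x (expgD y i 4) -yV ?mulgA.
  + apply: (@IcoT _ (i + 3)).
    have -> : t = y ^+ 2 * (z * y ^+ 3 * x) by rewrite /t ?mulgA.
    by rewrite (expgD y i 3) -(mulgA (y ^+ i)) (mulgA (y ^+ 3) (y ^+ 2))
      -(expgD y 3 2) y5 mul1g.
  + by apply: (@IcoZ _ i.+1 1); rewrite zy4x (expgSr y i) expg1 ?mulgA.
- by apply: (@IcoZ _ (i + 3) 2); rewrite -mulgA tx (expgD y i 3) ?mulgA.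
- by rewrite -expgSr; apply: IcoH erefl.
- by apply: (@IcoX _ i j.+1); rewrite (expgSr y j); apply/esym/mulgA.
- by apply: (@IcoZ _ i j.+1); rewrite (expgSr y j); apply/esym/mulgA.
- by apply: (@IcoT _ (i + 4)); rewrite -mulgA ty yV (expgD y i 4) mulgA.
Qed.

Context (rT : finGroupType) (f : gT -> rT) (fM : {morph f : a b / a * b}).
Context (fx : f x != 1) (fy : f y != 1).

Let f1 : f 1 = 1.
Proof. by apply: (mulgI (f 1)); rewrite -fM !mulg1. Qed.
Let fX a k : f (a ^+ k) = f a ^+ k.
Proof. by elim: k => [|k IHk]; rewrite ?expg0 ?f1 // !expgS fM IHk. Qed.
Let u3 : f x ^+ 3 = 1. Proof. by rewrite -fX x3 f1. Qed.
Let v5 : f y ^+ 5 = 1. Proof. by rewrite -fX y5 f1. Qed.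
Let v4 : (f y)^-1 = f y ^+ 4.
Proof. by apply: (mulIg (f y)); rewrite mulVg -expgSr. Qed.
Let fV a : f a^-1 = (f a)^-1.
Proof. by apply: (mulIg (f a)); rewrite -fM !mulVg f1. Qed.

Let fy_pow a i j : f (y ^+ i * a * y ^+ j) = 1 -> exists k, f a = f y ^+ k.
Proof.
rewrite !fM !fX => e; exists (4 * i + 4 * j)%N.
have {}e : f a = (f y ^+ i)^-1 * (f y ^+ j)^-1.
  by apply: (mulgI (f y ^+ i)); apply: (mulIg (f y ^+ j)); rewrite e mulVKg mulVg.
by rewrite e -!expVgn v4 -!expgM -expgD.
Qed.

(** Simplicity of A5 in explicit form. If an element outside the first form had trivial image, the
    image of [x], [z] or [t] would be a power of [f y], and each of these is contradictory. *)
Lemma ico_kernel h : h \in <<[set x; y]>> -> f h = 1 -> h = 1.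
Proof.
have fy_prime k : f y ^+ k = 1 -> y ^+ k = 1.
  by move/(prime_expg_eq1 (isT : prime 5) v5 fy y5).
have fy2 : f y ^+ 2 != 1.
  by apply: contra fy => /eqP /(coprime_exp_eq1 (isT : coprime 5 2) v5)->.
case/ico_formP=> [i|i j|i j|i] ->.
- by rewrite fX => /fy_prime.
(* The image of [x] would have order dividing both 3 and 5. *)
- case/fy_pow=> k fxk; case/eqP: fx.
  apply: (@coprime_exp_eq1 _ _ 3 5) => //.
  by rewrite fxk -expgM mulnC expgM v5 expg1n.
- case/fy_pow=> k fzk; case/eqP: fy.
  have e1 : f y ^+ k * f x = f y * f x * f y ^+ 2.
    by rewrite -fzk -(fM z x) zx (fM (y * x)) (fM y x) fX.
  have e2 : f y ^+ k * f y * f x = f x * f y ^+ 3.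
    by rewrite -fzk -(fM z y) -(fM (z * y) x) zyx (fM x) fX.
  exact: (ico_exp_eq1 u3 v5 e1 e2).
(* The image of [t] would commute with [f y] and also invert it, but [f y] has order 5. *)
- rewrite -[y ^+ i * t]mulg1 -(expg0 y) => /fy_pow[k ftk]; case/eqP: fy2.
  have := congr1 f ty; rewrite (fM t y) (fM y^-1 t) ftk fV => e.
  rewrite expgS expg1; apply: (mulgI (f y)^-1); rewrite mulKg mulg1.
  by apply: (mulIg (f y ^+ k)); rewrite -e -expgSr expgS.
Qed.

End Icosahedral.

Section Dihedral.
Context (gT : finGroupType) (x y : gT) (q : nat) (q_odd : odd q) (pr_q : prime q).
Context (x2 : x ^+ 2 = 1) (yq : y ^+ q = 1) (xy2 : (x * y) ^+ 2 = 1).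
Context (rT : finGroupType) (f : gT -> rT) (fM : {morph f : a b / a * b}).
Context (fx : f x != 1) (fy : f y != 1).

Let f1 : f 1 = 1.
Proof. by apply: (mulgI (f 1)); rewrite -fM !mulg1. Qed.
Let fX a k : f (a ^+ k) = f a ^+ k.
Proof. by elim: k => [|k IHk]; rewrite ?expg0 ?f1 // !expgS fM IHk. Qed.

(** Every element is [y ^+ k] or [y ^+ k * x]. A trivial image of the latter would make the
    involution [f x] a power of [f y], which has odd order. *)
Lemma dihedral_kernel h : h \in <<[set x; y]>> -> f h = 1 -> h = 1.
Proof.
have xx : x * x = 1 by rewrite -[RHS]x2 expgS expg1.
have yx : x * y = y^-1 * x.
  apply: (mulIg (x * y)); rewrite -(mulgA y^-1 x) (mulgA x x) xx mul1g mulVg.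
  by rewrite -[RHS]xy2 expgS expg1.
have yV : y^-1 = y ^+ q.-1.
  by apply: (mulIg y); rewrite mulVg -expgSr prednK ?prime_gt0.
move=> hD; have [k []->] : exists k, h = y ^+ k \/ h = y ^+ k * x.
- move: h hD; apply: gen_ind => [|h a]; first by exists 0; left.
  case/set2P=> -> [k [->|->]].
  + by exists k; right.
  + by exists k; left; rewrite -mulgA xx mulg1.
  + by exists k.+1; left; rewrite expgSr.
  + by exists (k + q.-1)%N; right; rewrite -mulgA yx yV mulgA expgD.
- by rewrite fX; apply: (prime_expg_eq1 pr_q) => //; rewrite -fX yq f1.
rewrite fM fX => e; case/eqP: fx; apply: (@coprime_exp_eq1 _ _ 2 q).
- by rewrite coprime2n.
- by rewrite -fX x2 f1.
have -> : f x = (f y ^+ k)^-1 by apply: (mulgI (f y ^+ k)); rewrite e mulgV.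
by rewrite -expVgn -expgM mulnC expgM expVgn -fX yq f1 invg1 expg1n.
Qed.

End Dihedral.

(** * Polytopes from rotation groups *)

Lemma imset_permM (T : finType) (s t : {perm T}) (A : {set T}) :
  (s * t) @: A = t @: (s @: A).
Proof. by rewrite -imset_comp; apply: eq_imset => x /=; rewrite permM. Qed.

Lemma imset_perm1 (T : finType) (A : {set T}) : (1 : {perm T}) @: A = A.
Proof. by rewrite -[RHS]imset_id; apply: eq_imset => x; rewrite perm1. Qed.

(* [w i] plays the role of the product of the reflections [0] and [i], and [fl g] is the image
   of the base flag under [g]. *)
Section Rotary.
Context {d : Order.disp_t} {P : finPOrderType d} (n : nat).
Context (rP : ranked n.+1 P) (connP : strongly_flag_connected P).
Context (gT : finGroupType) (E : {group gT}) (w : nat -> gT).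
Context (fl : gT -> {set P}) (mact : gT -> {perm P}).
Let tg i k := (w i)^-1 * w k.
Context (w0 : w 0 = 1) (wE : forall i, i < n.+1 -> w i \in E)
  (E_ind : forall Pr : gT -> Prop, Pr 1 ->
     (forall g i k, i < n.+1 -> k < n.+1 -> g \in E -> Pr g -> Pr (g * ((w i)^-1 * w k))) ->
     forall g, g \in E -> Pr g)
  (fl_flag : forall g, g \in E -> fl g \in flags P)
  (mactG : forall g, g \in E -> mact g \in Gamma P)
  (mactM : {in E &, {morph mact : g h / g * h}})
  (mact_inj : {in E &, injective mact})
  (mact_fl : forall g h, g \in E -> h \in E -> mact h @: fl g = fl (g * h))
  (fl_cases : forall Psi, Psi \in flags P ->
     exists2 g, g \in E & Psi = fl g \/ Psi = adj (fl g) 0)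
  (fl_tgen : forall i k g, i < n.+1 -> k < n.+1 -> g \in E ->
     fl ((w i)^-1 * w k * g) = adj (adj (fl g) k) i)
  (fl_odd : forall i g h, i < n.+1 -> g \in E -> h \in E -> fl g <> adj (fl h) i).

Let tgE i k : i < n.+1 -> k < n.+1 -> tg i k \in E.
Proof. by move=> lt_i lt_k; rewrite groupM ?groupV ?wE. Qed.
Let tgV i k : (tg i k)^-1 = tg k i. Proof. by rewrite /tg invMg invgK. Qed.
Let tg0 k : tg 0 k = w k. Proof. by rewrite /tg w0 invg1 mul1g. Qed.
Let f1 := fl_flag (group1 E).

Lemma rotary_eq s t : s \in Gamma P -> t \in Gamma P -> s @: fl 1 = t @: fl 1 -> s = t.
Proof. by move=> sG tG; apply: (Gamma_eq rP connP). Qed.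

Lemma mact1 : mact 1 = 1.
Proof.
have e := mactM (group1 E) (group1 E); rewrite mulg1 in e.
by apply: (mulgI (mact 1)); rewrite mulg1 -e.
Qed.

Lemma mactV g : g \in E -> mact g^-1 = (mact g)^-1.
Proof.
move=> gE; apply: (mulIg (mact g)); have gV : g^-1 \in E by rewrite groupV.
by rewrite -(mactM gV gE) !mulVg mact1.
Qed.

Lemma mact_fl1 (g : gT) : g \in E -> mact g @: fl 1 = fl g.
Proof. by move=> gE; rewrite (mact_fl (group1 E) gE) mul1g. Qed.

Lemma mact_flV (g : gT) : g \in E -> (mact g)^-1 @: fl g = fl 1.
Proof.
move=> gE; have gV : g^-1 \in E by rewrite groupV.
by rewrite -mactV // (mact_fl gE gV) mulgV.
Qed.

(** What conjugation by the missing reflection 0 would do to [E]: it inverts each product of the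
    reflections 0 and i. *)
Definition inverting_endo (f : gT -> gT) : Prop :=
  [/\ {in E &, {morph f : u v / u * v}}, {in E, forall u, f u \in E},
      {in E &, injective f} & forall i, i < n.+1 -> f (w i) = (w i)^-1].

Section Reflection.
Context (tau : {perm P}) (tG : tau \in Gamma P).
Context (te : tau @: fl 1 = adj (fl 1) 0).

(** By freeness it is enough to compare the images of the base flag, and these are computed from
    exchanges at 0 and [i] because automorphisms commute with [adj]. *)
Lemma tau_conj i : i < n.+1 -> tau * mact (w i) * tau^-1 = mact (w i)^-1.
Proof.
move=> lt_i; have wiE := wE lt_i; have wV : (w i)^-1 \in E by rewrite groupV.
apply: (mulIg tau); rewrite mulgKV; have [m1 m2] := (mactG wiE, mactG wV).
apply: rotary_eq; [by rewrite groupM|by rewrite groupM|].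
rewrite !imset_permM te -(adj_Gamma rP m1 f1) // mact_fl1 // mact_fl1 //.
have -> : fl (w i) = adj (adj (fl 1) i) 0.
  by rewrite -fl_tgen ?group1 // mulg1 -/(tg 0 i) tg0.
have -> : fl (w i)^-1 = adj (adj (fl 1) 0) i.
  by rewrite -fl_tgen ?group1 // mulg1 -/(tg i 0) -tgV tg0.
have f0 := adj_flag rP f1 (isT : 0 < n.+1); have fi := adj_flag rP f1 lt_i.
rewrite (adjK rP fi) // -(adj_Gamma rP tG f0) // -(adj_Gamma rP tG f1) // te.
by rewrite (adjK rP f1).
Qed.

Lemma tau_normal g : g \in E -> exists2 u, u \in E & tau * mact g * tau^-1 = mact u.
Proof.
suff : g \in E -> g \in E /\ exists2 u, u \in E & tau * mact g * tau^-1 = mact u.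
  by move=> h /h[].
move: g; apply: E_ind => [|g i k lt_i lt_k gE [_ [u uE eu]]]; rewrite -?/(tg i k).
  by split; [exact: group1|exists 1; rewrite ?group1 // mact1 mulg1 mulgV].
have tE := tgE lt_i lt_k.
have wi := wE lt_i; have wk := wE lt_k.
have wiV : (w i)^-1 \in E by rewrite groupV.
have wkV : (w k)^-1 \in E by rewrite groupV.
split; first exact: groupM.
exists (u * (w i * (w k)^-1)); first by rewrite !groupM.
rewrite (mactM gE tE) /tg (mactM wiV wk) (mactM uE (groupM wi wkV)) (mactM wi wkV).
rewrite -eu -(tau_conj lt_k).
have <- : tau * mact (w i)^-1 * tau^-1 = mact (w i).
  by move/(congr1 invg): (tau_conj lt_i); rewrite (mactV wi) !invMg !invgK mulgA.
by rewrite !mulgA !mulgKV.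
Qed.

Lemma tau_inverting : exists f, inverting_endo f.
Proof.
pose f g := odflt 1 [pick u in E | mact u == tau * mact g * tau^-1].
have fP g : g \in E -> f g \in E /\ mact (f g) = tau * mact g * tau^-1.
  move=> gE; rewrite /f; case: pickP => [u /andP[uE /eqP]|no] //=.
  by have [u uE eu] := tau_normal gE; have := no u; rewrite eu uE eqxx.
exists f; split=> [x y xE yE|x xE|x y xE yE e|i lt_i].
- have [fx ex] := fP x xE; have [fy ey] := fP y yE.
  have [fxy exy] := fP _ (groupM xE yE).
  apply: mact_inj => //; first exact: groupM.
  by rewrite exy (mactM fx fy) ex ey (mactM xE yE) !mulgA mulgKV.
- by have [] := fP x xE.
- have [_ ex] := fP x xE; have [_ ey] := fP y yE.
  apply: mact_inj => //; apply: (mulgI tau); apply: (mulIg tau^-1).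
  by rewrite -ex -ey e.
have wiE := wE lt_i; have wV : (w i)^-1 \in E by rewrite groupV.
have [fx ex] := fP _ wiE; apply: mact_inj => //.
by rewrite ex tau_conj.
Qed.

End Reflection.

Section Chiral.
Context (no_endo : forall f, ~ inverting_endo f).

(** An automorphism taking the base flag to one of the other parity can be corrected by an element
    of [E] so as to take it to its 0-adjacent flag, and conjugation by the result is an excluded
    inverting map. *)
Lemma Gamma_mact s : s \in Gamma P -> exists2 g, g \in E & s = mact g.
Proof.
move=> sG; have [g gE [e|e]] := fl_cases (Gamma_flag sG f1); have mG := mactG gE.
  by exists g => //; apply: rotary_eq => //; rewrite e mact_fl1.
have mV : (mact g)^-1 \in Gamma P by rewrite groupV.
have [||f /no_endo//] := @tau_inverting (s * (mact g)^-1).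
  by rewrite groupM.
rewrite imset_permM e -(adj_Gamma rP mV (fl_flag gE)) //.
by congr (adj _ _); exact: mact_flV.
Qed.

Lemma rotary_isog : Gamma P \isog E.
Proof.
rewrite isog_sym; apply/isogP; exists (Morphism mactM).
  by apply/injmP => x y xE yE; apply: mact_inj.
rewrite morphimEdom /=; apply/setP=> s; apply/imsetP/idP => [[g gE ->]|sG].
  exact: mactG.
by have [g gE ->] := Gamma_mact sG; exists g.
Qed.

Lemma fl_orbit Psi s : Psi \in flags P -> s \in Gamma P ->
  forall i, i < n.+1 -> s @: Psi <> adj Psi i.
Proof.
move=> fP sG i lt_i; have [g gE ->] := Gamma_mact sG; have mG := mactG gE.
have [h hE [->|->]] := fl_cases fP; have fh := fl_flag hE; have ghE := groupM hE gE.
  by rewrite mact_fl //; apply: fl_odd.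
rewrite -(adj_Gamma rP mG fh) // mact_fl // => /(congr1 (fun A => adj A 0)).
rewrite (adjK rP (fl_flag ghE)) // -fl_tgen //.
by apply: fl_odd => //; rewrite groupM // tgE.
Qed.

Lemma rotary_chiral : chiral P.
Proof.
have f0 := adj_flag rP f1 (isT : 0 < n.+1).
have sep Psi i : Psi \in flags P -> i < n.+1 ->
    orbit 'P^* (Gamma P) Psi <> orbit 'P^* (Gamma P) (adj Psi i).
  move=> fP lt_i e.
  have : adj Psi i \in orbit 'P^* (Gamma P) Psi by rewrite e orbit_refl.
  by case/orbitP=> s sG es; apply: (fl_orbit fP sG lt_i es).
split; last by move=> A B fA fB /(adjacentP rP fA fB)[i lt_i ->]; apply: sep.
have -> : [set orbit 'P^* (Gamma P) A | A in flags P] =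
    [set orbit 'P^* (Gamma P) (fl 1); orbit 'P^* (Gamma P) (adj (fl 1) 0)].
  apply/setP=> X; rewrite !inE; apply/imsetP/orP => [[A fA ->]|].
    have [g gE eA] := fl_cases fA; have mG := mactG gE.
    case: eA => ->; [left|right]; apply/eqP.
      by rewrite -mact_fl1 //; apply: (orbit_act 'P^* (fl 1) mG).
    rewrite -mact_fl1 // (adj_Gamma rP mG f1) //.
    exact: (orbit_act 'P^* (adj (fl 1) 0) mG).
  by case=> /eqP->; [exists (fl 1)|exists (adj (fl 1) 0)].
by rewrite cards2; case: eqP => // /(sep _ _ f1 (isT : 0 < n.+1)).
Qed.

(** The type of a chiral polytope is tested at every flag, so rotations are also needed at flags of
    the parity opposite to the base flag. *)
Lemma two_step_ex i k Psi : i < n.+1 -> k < n.+1 -> Psi \in flags P ->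
  exists2 s, s \in Gamma P & s @: Psi = adj (adj Psi k) i.
Proof.
move=> lt_i lt_k fP; have [g gE eP] := fl_cases fP; have fg := fl_flag gE.
have mV : mact g^-1 \in Gamma P by apply: mactG; rewrite groupV.
have toP u : u \in E -> exists2 s, s \in Gamma P & s @: fl g = fl u.
  move=> uE; exists ((mact g)^-1 * mact u); first by rewrite groupM ?groupV ?mactG.
  by rewrite imset_permM mact_flV // mact_fl1.
case: eP => ->.
  have tE : tg i k * g \in E by rewrite groupM // tgE.
  by have [s sG es] := toP _ tE; exists s => //; rewrite es fl_tgen.
(* For a flag 0-adjacent to [fl g], the two exchanges are enclosed between two exchanges at 0, which
   makes a word of even length starting at [fl g]. *)
have tE : tg k 0 * g \in E by rewrite groupM // tgE.
have t2E : tg 0 i * (tg k 0 * g) \in E by rewrite groupM // tgE.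
have [s sG es] := toP _ t2E; exists s => //.
rewrite -(adj_Gamma rP sG fg) // es fl_tgen // fl_tgen //.
have f0 := adj_flag rP fg (isT : 0 < n.+1); have fk := adj_flag rP f0 lt_k.
by rewrite (adjK rP) // (adj_flag rP fk).
Qed.

End Chiral.

End Rotary.

(** * The mix with a directly regular polytope *)

Lemma sndM (gT hT : finGroupType) (x y : gT * hT) : (x * y).2 = x.2 * y.2.
Proof. by []. Qed.

Lemma sndV (gT hT : finGroupType) (x : gT * hT) : (x^-1).2 = x.2^-1.
Proof. by []. Qed.

Lemma expg_pair (gT hT : finGroupType) (x : gT * hT) m :
  x ^+ m = (x.1 ^+ m, x.2 ^+ m).
Proof. by elim: m => // m IHm; rewrite !expgS IHm. Qed.

Lemma pair_expg_eq1 (gT hT : finGroupType) (x : gT * hT) m :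
  x.1 ^+ m = 1 -> x.2 ^+ m = 1 -> x ^+ m = 1.
Proof. by rewrite expg_pair => -> ->. Qed.

(** There are four proper ranks, so three faces leave one free; a reflection at the free rank
    corrects parity without moving those faces. *)
Lemma avoid_rank j l m : exists2 i, i < 4 & i.+1 \notin [:: j; l; m].
Proof.
have : ~~ all (mem [:: j; l; m]) [:: 1%N; 2; 3; 4].
  apply/negP=> /allP h.
  by have := @uniq_leq_size _ [:: 1%N; 2; 3; 4] [:: j; l; m] isT h.
case/allPn=> -[|i]; rewrite !inE //= => i4 ni; exists i; rewrite ?inE //.
by move: i4; rewrite !eqSS; case/or4P => /eqP->.
Qed.

Section AlternatingOrder.
Context {d : Order.disp_t} {P : finPOrderType d} (n : nat) (rP : ranked n P).
Context (connP : strongly_flag_connected P) (i k : nat) (lt_i : i < n) (lt_k : k < n).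

Definition two_step (Psi : {set P}) := adj (adj Psi k) i.

Lemma two_step_flag Psi : Psi \in flags P -> two_step Psi \in flags P.
Proof. by move=> fP; do 2!apply: (adj_flag rP) => //. Qed.

Lemma iter_two_step_flag m Psi : Psi \in flags P -> iter m two_step Psi \in flags P.
Proof. by move=> fP; elim: m => //= m; apply: two_step_flag. Qed.

(** The order of a rotation is read off from flags alone, so orders in a cover and in [Q] can be
    compared without any map between their automorphism groups. *)
Lemma two_step_expg s Psi m :
    s \in Gamma P -> Psi \in flags P -> s @: Psi = two_step Psi ->
  (s ^+ m == 1) = (iter m two_step Psi == Psi).
Proof.
move=> sG fP sP.
have comm t Theta : t \in Gamma P -> Theta \in flags P ->
    t @: two_step Theta = two_step (t @: Theta).
  by move=> tG fT; rewrite /two_step !(adj_Gamma rP tG) //; apply: (adj_flag rP).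
have sm : (s ^+ m) @: Psi = iter m two_step Psi.
  elim: m => [|m IHm]; first by rewrite imset_perm1.
  rewrite expgS imset_permM sP comm ?IHm //.
  by rewrite groupX.
rewrite -sm; apply/eqP/eqP => [->|]; first by rewrite imset_perm1.
by apply: (Gamma_free rP connP) => //; rewrite groupX.
Qed.

End AlternatingOrder.

Lemma movingP (d : Order.disp_t) (P : finPOrderType d) (Psi Theta : {set P}) s :
    s \in Gamma P -> s @: Psi = Theta ->
  moving Psi Theta \in Gamma P /\ moving Psi Theta @: Psi = Theta.
Proof.
move=> sG es; rewrite /moving.
case: pickP => [t /andP[tG /eqP et]|/(_ s)] /=; first by [].
by rewrite sG es eqxx.
Qed.

Lemma regular_rho (d : Order.disp_t) (P : finPOrderType d) n Psi i :
    ranked n P -> regular P -> Psi \in flags P -> i < n ->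
  rho Psi i \in Gamma P /\ rho Psi i @: Psi = adj Psi i.
Proof.
move=> rP /regularP[_ tr] fP lt_i.
by have [s sG es] := tr _ _ fP (adj_flag rP fP lt_i); apply: movingP sG es.
Qed.

Section Mix.
Context {d : Order.disp_t} {Q : finPOrderType d} (Qpoly : is_polytope 4 Q).
Context (Qdr : directly_regular 4 Q) (Qtype : regular_type Q [:: 3; 5; 3]).
Context (Phi : {set Q}) (fPhi : Phi \in flags Q).
Context (kT : finGroupType) (a b c : kT).
Context (a3 : a ^+ 3 = 1) (b2 : b ^+ 2 = 1) (c2 : c ^+ 2 = 1).
Context (ab5 : (a^-1 * b) ^+ 5 = 1) (bc3 : (b^-1 * c) ^+ 3 = 1).
Context (ac2 : (a^-1 * c) ^+ 2 = 1).
Implicit Types (F G H : Q) (i j k l : nat).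

Let rQ : ranked 4 Q := polytope_ranked Qpoly.
Let connQ : strongly_flag_connected Q. Proof. by case: Qpoly. Qed.
Let rot := rotation_subgroup 4 Phi.
Notation r i := (rho Phi i).
Notation DT := (kT * {perm Q})%type.

Lemma rho_spec i : i < 4 -> r i \in Gamma Q /\ r i @: Phi = adj Phi i.
Proof.
by move=> lt_i; apply: (regular_rho rQ); case: Qdr.
Qed.

Lemma rhoG i : i < 4 -> r i \in Gamma Q. Proof. by case/rho_spec. Qed.

Lemma rho_flag i s : i < 4 -> s \in Gamma Q -> (r i * s) @: Phi = adj (s @: Phi) i.
Proof.
by move=> lt_i sG; rewrite imset_permM; have [_ ->] := rho_spec lt_i;
  rewrite (adj_Gamma rQ sG).
Qed.

Lemma rho_inj s t : s \in Gamma Q -> t \in Gamma Q -> s @: Phi = t @: Phi -> s = t.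
Proof. by move=> sG tG; apply: (Gamma_eq rQ connQ). Qed.

Lemma rhoK i : i < 4 -> r i * r i = 1.
Proof.
move=> lt_i; apply: rho_inj; rewrite ?group1 ?groupM ?rhoG //.
have [_ e] := rho_spec lt_i.
by rewrite rho_flag ?rhoG // e imset_perm1 (adjK rQ).
Qed.

Lemma rhoV i : i < 4 -> (r i)^-1 = r i.
Proof. by move=> lt_i; apply: (mulIg (r i)); rewrite mulVg rhoK. Qed.

Lemma rhoC i k : i.+1 < k -> k < 4 -> r i * r k = r k * r i.
Proof.
move=> ik lt_k; have lt_i : i < 4 by apply: ltn_trans lt_k; apply: ltnW.
apply: rho_inj; rewrite ?groupM ?rhoG //.
have [_ ei] := rho_spec lt_i; have [_ ek] := rho_spec lt_k.
by rewrite !rho_flag ?rhoG // ei ek (adjC rQ fPhi lt_i lt_k ik).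
Qed.

Lemma rhoM2 i k : i.+1 < k -> k < 4 -> (r i * r k) ^+ 2 = 1.
Proof.
move=> ik lt_k; have lt_i : i < 4 by apply: ltn_trans lt_k; apply: ltnW.
by rewrite expgS expg1 {1}rhoC // mulgA -(mulgA (r k)) rhoK // mulg1 rhoK.
Qed.

Lemma rhoM_neq1 i k : i < k -> k < 4 -> r i * r k != 1.
Proof.
move=> ik lt_k; have lt_i := ltn_trans ik lt_k.
apply/eqP=> /(congr1 (fun s : {perm Q} => s @: Phi)).
have [_ ek] := rho_spec lt_k.
rewrite rho_flag ?rhoG // ek imset_perm1 => e.
have [x xP rx] := flag_rk_ex rQ fPhi (leq_trans (lt_k : k.+2 <= 5) (isT : 5 <= 6)).
have fk := adj_flag rQ fPhi lt_k.
have ne : i.+1 != k.+1 by rewrite eqSS ltn_eqF.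
have xk : x \in adj Phi k by rewrite -(adj_mem rQ fk lt_i) ?e // rx eq_sym.
case/eqP: (adj_neq rQ fPhi lt_k); apply: (agree_off_eq rQ fk fPhi _ rx) => //.
by move=> y ry; rewrite (adj_mem rQ fPhi lt_k).
Qed.

(** * Generators of the mix and stabilizers of base faces *)

Definition wgen i : DT := (nth 1 [:: 1; a; b; c] i, r 0 * r i).
Definition tgen i k : DT := (wgen i)^-1 * wgen k.

Lemma wgen0 : wgen 0 = 1.
Proof. by rewrite /wgen rhoK. Qed.

Lemma tgen0 k : tgen 0 k = wgen k.
Proof. by rewrite /tgen wgen0 invg1 mul1g. Qed.

Lemma tgenM i k l : tgen i k * tgen k l = tgen i l.
Proof. by rewrite /tgen mulgA mulgK. Qed.

Lemma tgenii i : tgen i i = 1. Proof. by rewrite /tgen mulVg. Qed.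

Lemma tgenV i k : (tgen i k)^-1 = tgen k i.
Proof. by rewrite /tgen invMg invgK. Qed.

Lemma tgen2 i k : i < 4 -> (tgen i k).2 = r i * r k.
Proof.
by move=> lt_i; rewrite /tgen sndM sndV /= invMg !rhoV // -mulgA (mulgA (r 0)) rhoK // mul1g.
Qed.

(** [tgen i k] plays the product of reflections i and k, and it fixes the base face at [rk] [j] when
    neither reflection has rank [j] - 1. The values 0 and 5 exclude nothing, so [Dg 0] and [Dg 5]
    are the whole group. *)
Definition stab_gens j : {set DT} :=
  [set tgen x.1 x.2 | x : 'I_4 * 'I_4 & (x.1.+1 != j) && (x.2.+1 != j)].

Definition Dg j : {group DT} := <<stab_gens j>>%G.

Notation E := (Dg 0).

Lemma stab_gensP j x :
  x \in stab_gens j -> exists i k, [/\ i < 4, k < 4, i.+1 != j, k.+1 != j & x = tgen i k].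
Proof. by case/imsetP=> -[i k]; rewrite inE /= => /andP[? ?] ->; exists i, k. Qed.

Lemma mem_tgen i k j :
  i < 4 -> k < 4 -> i.+1 != j -> k.+1 != j -> tgen i k \in Dg j.
Proof.
move=> lt_i lt_k ij kj; apply: mem_gen; apply/imsetP.
by exists (Ordinal lt_i, Ordinal lt_k); rewrite ?inE ?ij.
Qed.

Lemma Dg_sub j : Dg j \subset E.
Proof.
rewrite gen_subG; apply/subsetP=> _ /stab_gensP[i [k [lt_i lt_k _ _ ->]]].
exact: mem_tgen.
Qed.

Lemma Dg5 : Dg 5 = E.
Proof.
apply/eqP; rewrite -val_eqE eqEsubset Dg_sub /= gen_subG.
apply/subsetP=> _ /stab_gensP[i [k [lt_i lt_k _ _ ->]]].
by apply: mem_tgen; rewrite // eqSS ltn_eqF.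
Qed.

Lemma rhoM_rot i k : i < 4 -> k < 4 -> r i * r k \in rot.
Proof.
have sg m : m < 3 -> r m * r m.+1 \in rot.
  by move=> lt_m; apply: mem_gen; apply/imsetP; exists (Ordinal lt_m).
have w m : m < 4 -> r 0 * r m \in rot.
  elim: m => [|m IHm] lt_m; first by rewrite rhoK // group1.
  have lt_m' := ltnW lt_m.
  have -> : r 0 * r m.+1 = (r 0 * r m) * (r m * r m.+1).
    by rewrite -mulgA (mulgA (r m)) rhoK // mul1g.
  by rewrite groupM ?IHm ?sg.
move=> lt_i lt_k.
have -> : r i * r k = (r 0 * r i)^-1 * (r 0 * r k).
  by rewrite invMg !rhoV // -mulgA (mulgA (r 0)) rhoK // mul1g.
by rewrite groupM ?groupV ?w.
Qed.

Lemma rot_sub : rot \subset Gamma Q.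
Proof.
rewrite gen_subG; apply/subsetP=> _ /imsetP[i _ ->].
have lt_i := ltn_ord i; rewrite /= in lt_i.
by rewrite /sigma groupM // rhoG //; apply: leq_trans lt_i _.
Qed.

Lemma E_rot h : h \in E -> h.2 \in rot.
Proof.
move: h; apply: gen_ind => [|x _ /stab_gensP[i [k [lt_i lt_k _ _ ->]]] xr].
  exact: group1.
by rewrite sndM groupM // tgen2 // rhoM_rot.
Qed.

Lemma E_Gamma h : h \in E -> h.2 \in Gamma Q.
Proof. by move/E_rot/(subsetP rot_sub). Qed.

(** [J] marks the base faces to be kept. A path through flags containing them never exchanges a
    marked rank, so each step can be completed by [r i0], itself at an unmarked rank, to a generator
    of every marked stabilizer; after an odd number of steps one [r i0] is left over. *)
Lemma reach (J : pred nat) i0 Psi :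
    i0 < 4 -> ~~ J i0.+1 -> Psi \in flags Q ->
    (forall x, x \in Phi -> J (rk x) -> x \in Psi) ->
  exists2 h, h \in E /\ (forall j, J j -> h \in Dg j)
    & h.2 @: Phi = Psi \/ (r i0 * h.2) @: Phi = Psi.
Proof.
move=> lt0 J0 fP sJ; apply: (flag_ind rQ connQ fPhi fP (A := fun Psi => exists2 h,
    h \in E /\ (forall j, J j -> h \in Dg j)
    & h.2 @: Phi = Psi \/ (r i0 * h.2) @: Phi = Psi)); last first.
  by exists 1; [split=> *; rewrite group1|left; rewrite imset_perm1].
move=> Theta i fT lt_i sT sA [h [hE hJ] eT].
have Ji : ~~ J i.+1.
  apply/negP=> Ji.
  have [x xP rx] := flag_rk_ex rQ fPhi (leq_trans (lt_i : i.+2 <= 5) (isT : 5 <= 6)).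
  have xI : x \in Phi :&: Psi by rewrite inE xP sJ // rx.
  case/eqP: (adj_neq rQ fT lt_i).
  apply: (agree_off_eq rQ (adj_flag rQ fT lt_i) fT _ rx);
    rewrite ?(subsetP sT) ?(subsetP sA) //.
  by move=> y ry; rewrite (adj_mem rQ fT lt_i).
have TJ k l : k < 4 -> l < 4 -> ~~ J k.+1 -> ~~ J l.+1 ->
    tgen k l * h \in E /\ (forall j, J j -> tgen k l * h \in Dg j).
  move=> lt_k lt_l Jk Jl; split=> [|j Jj]; first by rewrite groupM ?mem_tgen.
  rewrite groupM ?hJ // mem_tgen //.
    by apply: contraNneq Jk => ->.
  by apply: contraNneq Jl => ->.
have hG := E_Gamma hE; have rhG k : k < 4 -> r k * h.2 \in Gamma Q.
  by move=> lt_k; rewrite groupM ?rhoG.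
case: eT => <-.
  exists (tgen i0 i * h); first exact: TJ.
  by right; rewrite sndM tgen2 // !mulgA rhoK // mul1g rho_flag.
exists (tgen i i0 * h); first exact: TJ.
by left; rewrite sndM tgen2 // -mulgA (rho_flag lt_i (rhG _ lt0)).
Qed.

Lemma reach_all i0 Psi :
    i0 < 4 -> Psi \in flags Q ->
  exists2 h, h \in E & h.2 @: Phi = Psi \/ (r i0 * h.2) @: Phi = Psi.
Proof.
move=> lt0 fP; have [||h [hE _] eh] := @reach pred0 i0 Psi lt0 _ fP.
- by [].
- by [].
by exists h.
Qed.

(** Direct regularity enters here: one reflection among the rotations would bring in all of them and
    make the index 1. *)
Lemma rho_notin_rot i : i < 4 -> r i \notin rot.
Proof.
move=> lt_i; apply/negP=> ri.
have all_r k : k < 4 -> r k \in rot.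
  move=> lt_k; rewrite -[r k]mul1g -(rhoK lt_i) -mulgA groupM // rhoM_rot //.
suff eG : Gamma Q = rot.
  by case: Qdr => _ /(_ _ fPhi); rewrite -/rot eG indexgg.
apply/eqP; rewrite eqEsubset rot_sub andbT; apply/subsetP=> s sG.
have [h hE] := reach_all lt_i (Gamma_flag sG fPhi).
have hG := E_Gamma hE.
by case=> /rho_inj <- //; rewrite ?groupM ?rhoG ?E_rot ?all_r.
Qed.

Lemma rot_E s : s \in rot -> exists2 h, h \in E & h.2 = s.
Proof.
move=> sr; have sG := subsetP rot_sub _ sr.
have [h hE] := reach_all (isT : 0 < 4) (Gamma_flag sG fPhi).
have hG := E_Gamma hE.
case=> /rho_inj e; first by exists h => //; apply: e.
case/negP: (rho_notin_rot (isT : 0 < 4)).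
by rewrite -(groupMr _ (E_rot hE)) e // groupM // rhoG.
Qed.

(** The intersection property, lifted to [E]: a rotation fixing two base faces comes from a single
    element of both stabilizers. The odd outcome of [reach] is impossible by [rho_notin_rot]. *)
Lemma rot_stab s x y :
    s \in rot -> x \in Phi -> y \in Phi -> s x = x -> s y = y ->
  exists2 h, [/\ h \in E, h \in Dg (rk x) & h \in Dg (rk y)] & h.2 = s.
Proof.
move=> sr xP yP sx sy; have sG := subsetP rot_sub _ sr.
have [i lt_i] := avoid_rank (rk x) (rk y) (rk y); rewrite !inE orbb => ni.
have [||h [hE hJ]] := @reach [pred j | (j == rk x) || (j == rk y)] i (s @: Phi) lt_i ni.
- exact: (Gamma_flag sG fPhi).
- move=> z zP /= /orP[/eqP rz|/eqP rz].
    by rewrite (flag_rk_inj rQ fPhi zP xP rz) -sx imset_f.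
  by rewrite (flag_rk_inj rQ fPhi zP yP rz) -sy imset_f.
have hG := E_Gamma hE; case=> /rho_inj e.
  exists h; last exact: e.
  by split=> //; apply: hJ; rewrite /= eqxx ?orbT.
case/negP: (rho_notin_rot lt_i).
by rewrite -(groupMr _ (E_rot hE)) e // groupM // rhoG.
Qed.

Lemma Dg_fix x h : x \in Phi -> h \in Dg (rk x) -> h.2 x = x.
Proof.
move=> xP; move: h; apply: gen_ind => [|h _ /stab_gensP[i [k [lt_i lt_k ij kj ->]]] hx].
  by rewrite perm1.
have rx m : m < 4 -> m.+1 != rk x -> r m x = x.
  move=> lt_m mj; have [rG re] := rho_spec lt_m.
  apply: (flag_rk_inj rQ (adj_flag rQ fPhi lt_m)); rewrite ?(Gamma_rk rG) //.
    by rewrite -re imset_f.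
  by rewrite (adj_mem rQ fPhi lt_m) // eq_sym.
by rewrite sndM permM hx tgen2 // permM !rx.
Qed.

Lemma Dg_gen2 j l1 l2 l3 :
    (forall i, i < 4 -> i.+1 != j -> i \in [:: l1; l2; l3]) ->
  Dg j \subset <<[set tgen l1 l2; tgen l2 l3]>>.
Proof.
move=> h; rewrite gen_subG; apply/subsetP=> _ /stab_gensP[i [k [lt_i lt_k ij kj ->]]].
have t1 : tgen l1 l2 \in <<[set tgen l1 l2; tgen l2 l3]>> by rewrite mem_gen ?set21.
have t2 : tgen l2 l3 \in <<[set tgen l1 l2; tgen l2 l3]>> by rewrite mem_gen ?set22.
suff hi m : m \in [:: l1; l2; l3] -> tgen l2 m \in <<[set tgen l1 l2; tgen l2 l3]>>.
  by rewrite -(tgenM i l2 k) groupM ?hi ?h // -tgenV groupV hi // h.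
by rewrite !inE => /or3P[]/eqP->; rewrite ?tgenii ?group1 // -tgenV groupV.
Qed.

Let sig m : m < 3 -> (r m * r m.+1) ^+ nth 0 [:: 3; 5; 3] m = 1.
Proof. by move=> lt_m; rewrite -(Qtype fPhi lt_m) expg_order. Qed.

Let exp_rV m i k : i < 4 -> k < 4 -> (r i * r k) ^+ m = 1 -> (r k * r i) ^+ m = 1.
Proof.
by move=> lt_i lt_k e; rewrite -(invgK (r k * r i)) invMg !rhoV // expVgn e invg1.
Qed.

Let neq_rV i k : i < k -> k < 4 -> r k * r i != 1.
Proof.
move=> ik lt_k; have lt_i := ltn_trans ik lt_k.
by rewrite -(inj_eq invg_inj) invMg !rhoV // invg1 rhoM_neq1.
Qed.

Let expV (x : kT) m : x ^+ m = 1 -> x^-1 ^+ m = 1.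
Proof. by move=> e; rewrite expVgn e invg1. Qed.

(** The vertex and facet stabilizers satisfy the relations of A5, the edge and 2-face stabilizers
    those of the dihedral group of order 6, and the second projection kills none of the chosen
    generators. The generators are ordered so that their exponents come as 3, 5 or as 2, 3. *)
Lemma Dg_inj j h : 0 < j < 5 -> h \in Dg j -> h.2 = 1 -> h = 1.
Proof.
have sM : {morph (fun x : DT => x.2) : x y / x * y} by [].
case: j => [|[|[|[|[|]]]]] // _.
- move=> hD; have {}hD : h \in <<[set tgen 3 2; tgen 2 1]>>.
    by apply: subsetP hD; apply: Dg_gen2; case=> [|[|[|[|]]]].
  apply: (ico_kernel _ _ _ sM _ _ hD); rewrite ?tgenM ?tgen2 //.
  + apply: pair_expg_eq1; last by rewrite tgen2 //; apply: exp_rV => //; exact: (@sig 2).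
    rewrite /=.
    by rewrite -(invgK (c^-1 * b)) invMg invgK expV.
  + apply: pair_expg_eq1; last by rewrite tgen2 //; apply: exp_rV => //; exact: (@sig 1%N).
    rewrite /=.
    by rewrite -(invgK (b^-1 * a)) invMg invgK expV.
  + apply: pair_expg_eq1; last by rewrite tgen2 //; apply: exp_rV => //; exact: rhoM2.
    rewrite /=.
    by rewrite -(invgK (c^-1 * a)) invMg invgK expV.
  + exact: neq_rV.
  + exact: neq_rV.
- move=> hD; have {}hD : h \in <<[set tgen 0 2; tgen 2 3]>>.
    by apply: subsetP hD; apply: Dg_gen2; case=> [|[|[|[|]]]].
  apply: (dihedral_kernel (isT : odd 3) isT _ _ _ sM _ _ hD); rewrite ?tgenM ?tgen2 //.
  + apply: pair_expg_eq1; last by rewrite tgen2 //; exact: rhoM2.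
    by rewrite /= invg1 mul1g.
  + apply: pair_expg_eq1; first exact: bc3.
    by rewrite tgen2 //; exact: (@sig 2).
  + apply: pair_expg_eq1; last by rewrite tgen2 //; exact: rhoM2.
    by rewrite /= invg1 mul1g.
  + exact: rhoM_neq1.
  + exact: rhoM_neq1.
- move=> hD; have {}hD : h \in <<[set tgen 3 1; tgen 1 0]>>.
    by apply: subsetP hD; apply: Dg_gen2; case=> [|[|[|[|]]]].
  apply: (dihedral_kernel (isT : odd 3) isT _ _ _ sM _ _ hD); rewrite ?tgenM ?tgen2 //.
  + apply: pair_expg_eq1; last by rewrite tgen2 //; apply: exp_rV => //; exact: rhoM2.
    rewrite /=.
    by rewrite -(invgK (c^-1 * a)) invMg invgK expV.
  + apply: pair_expg_eq1; last by rewrite tgen2 //; apply: exp_rV => //; exact: (@sig 0).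
    rewrite /=.
    by rewrite mulg1 expV.
  + apply: pair_expg_eq1; last by rewrite tgen2 //; apply: exp_rV => //; exact: rhoM2.
    rewrite /=.
    by rewrite mulg1 expV.
  + exact: neq_rV.
  + exact: neq_rV.
move=> hD; have {}hD : h \in <<[set tgen 0 1; tgen 1 2]>>.
  by apply: subsetP hD; apply: Dg_gen2; case=> [|[|[|[|]]]].
apply: (ico_kernel _ _ _ sM _ _ hD); rewrite ?tgenM ?tgen2 //.
- apply: pair_expg_eq1; last by rewrite tgen2 //; exact: (@sig 0).
  by rewrite /= invg1 mul1g.
- apply: pair_expg_eq1; first exact: ab5.
  by rewrite tgen2 //; exact: (@sig 1%N).
- apply: pair_expg_eq1; last by rewrite tgen2 //; exact: rhoM2.
    by rewrite /= invg1 mul1g.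
- exact: rhoM_neq1.
- exact: rhoM_neq1.
Qed.

Definition base_face F : Q := odflt F [pick x in Phi | rk x == rk F].

Lemma base_faceP F : base_face F \in Phi /\ rk (base_face F) = rk F.
Proof.
rewrite /base_face; case: pickP => [x /andP[xP /eqP]|no] /=; first by [].
have [x xP rx] := flag_rk_ex rQ fPhi (rk_max rQ F).
by have := no x; rewrite xP rx eqxx.
Qed.

Lemma base_face_eq F x : x \in Phi -> rk x = rk F -> base_face F = x.
Proof.
move=> xP rx; have [bP rb] := base_faceP F.
by apply: (flag_rk_inj rQ fPhi) => //; rewrite rb.
Qed.

(** A flag through the chain may have the wrong parity; exchanging its face at the free rank [i]
    repairs this and keeps the chain. *)
Lemma chain_rot (C : {set Q}) i :
    is_chain C -> i < 4 -> (forall F, F \in C -> rk F != i.+1) ->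
  exists2 s, s \in rot & forall F, F \in C -> s (base_face F) = F.
Proof.
move=> cC lt_i ri; have [Psi fP sCP] := chain_flag cC.
have [h hE eh] := reach_all lt_i fP; have hG := E_Gamma hE.
exists h.2 => [|F FC]; first exact: E_rot.
have /imsetP[x xP eF] : F \in h.2 @: Phi.
  have FP := subsetP sCP _ FC.
  case: eh => [->//|e]; have fh := Gamma_flag hG fPhi.
  by rewrite -(adj_mem rQ fh lt_i) ?ri // -rho_flag // e.
by rewrite eF; congr (h.2 _); apply: base_face_eq; rewrite // (Gamma_rk hG).
Qed.

Lemma chain3_rot F G H :
    (F >=< G)%O -> (F >=< H)%O -> (G >=< H)%O ->
  exists2 s, s \in rot & [/\ s (base_face F) = F, s (base_face G) = G & s (base_face H) = H].
Proof.
move=> FG FH GH; have [i lt_i ni] := avoid_rank (rk F) (rk G) (rk H).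
have cC : is_chain (F |: [set G; H]).
  apply: is_chainU1; first exact: chain2.
  by move=> K /set2P[]->.
have [|s sr hs] := chain_rot cC lt_i.
  move: ni; rewrite !inE => /norP[n1 /norP[n2 n3]] K.
  by rewrite !inE => /or3P[]/eqP->; rewrite eq_sym.
by exists s => //; split; apply: hs; rewrite !inE eqxx ?orbT.
Qed.

(** A right coset of a stabilizer together with its face of [Q]. The latter also separates the least
    from the greatest face, as both carry the coset [E]. *)
Definition is_mix_face (x : Q * {set DT}) : bool :=
  [exists h in E, (x.1 == h.2 (base_face x.1)) && (x.2 == Dg (rk x.1) :* h)].

Definition mix_face : Type := {x : Q * {set DT} | is_mix_face x}.
HB.instance Definition _ := Finite.on mix_face.
Implicit Types x y z : mix_face.

Definition mpi x : Q := (val x).1.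
Definition mset x : {set DT} := (val x).2.

Lemma mem_mset x g : g \in mset x ->
  [/\ g \in E, mpi x = g.2 (base_face (mpi x)) & mset x = Dg (rk (mpi x)) :* g].
Proof.
case: x => -[F X] /=; rewrite /mset /mpi /= => Fx.
case/exists_inP: (Fx) => h hE /= /andP[/eqP eF /eqP eX] gX.
have [k kD eg] : exists2 k, k \in Dg (rk F) & g = k * h.
  by move: gX; rewrite eX => /rcosetP[k kD ->]; exists k.
have [bP rb] := base_faceP F.
split; first by rewrite eg groupM // (subsetP (Dg_sub _) _ kD).
  have kb : k.2 (base_face F) = base_face F by apply: Dg_fix; rewrite ?rb.
  by rewrite eg sndM permM kb.
by apply/esym; rewrite eX; apply/rcoset_eqP; rewrite -eX.
Qed.

Lemma mset_ex x : exists g, g \in mset x.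
Proof.
case: x => -[F X] Fx; case/exists_inP: (Fx) => h hE /= /andP[_ /eqP eX].
by exists h; rewrite /mset /= eX rcoset_refl.
Qed.

Lemma mk_face_subproof (F : Q) h : F \in Phi -> h \in E ->
  is_mix_face (h.2 F, Dg (rk F) :* h).
Proof.
move=> FP hE; apply/exists_inP; exists h => //=; have hG := E_Gamma hE.
by rewrite (@base_face_eq _ F) ?(Gamma_rk hG) ?eqxx.
Qed.

Lemma mk_face (F : Q) h : F \in Phi -> h \in E ->
  exists2 x, mpi x = h.2 F & mset x = Dg (rk F) :* h.
Proof. by move=> FP hE; exists (exist is_mix_face _ (mk_face_subproof FP hE)). Qed.

Lemma mset_eq x y g : g \in mset x -> g \in mset y -> mpi x = mpi y -> x = y.
Proof.
move=> /mem_mset[_ _ eX] /mem_mset[_ _ eY] e; apply: val_inj.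
rewrite [val x]surjective_pairing [val y]surjective_pairing.
by rewrite -/(mpi x) -/(mpi y) -/(mset x) -/(mset y) eX eY e.
Qed.

Lemma mset_lift x s :
  s \in rot -> s (base_face (mpi x)) = mpi x -> exists2 h, h \in mset x & h.2 = s.
Proof.
move=> sr sx; have [g gX] := mset_ex x; have [gE eg eX] := mem_mset gX.
have [bP rb] := base_faceP (mpi x).
have gs : (s * g.2^-1) (base_face (mpi x)) = base_face (mpi x).
  by rewrite permM sx {1}eg permK.
have [|k [kE kD _] ek] := rot_stab _ bP bP gs gs.
  by rewrite groupM // groupV E_rot.
exists (k * g); first by rewrite eX; apply/rcosetP; exists k; rewrite -?rb.
by rewrite sndM ek mulgKV.
Qed.

(** For [g] in both cosets, [h * g^-1] lies in the stabilizer at [x] and its second component fixes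
    both base faces. By [rot_stab] that component is also realized by an element of both
    stabilizers, and [Dg_inj] at the proper face [x] identifies the two elements. *)
Lemma mset_lift_mem x y h :
    0 < rk (mpi x) < 5 -> h \in mset x -> h.2 (base_face (mpi y)) = mpi y ->
  mset x :&: mset y != set0 -> h \in mset y.
Proof.
move=> px hX hy /set0Pn[g /setIP[gX gY]].
have [gE egx eX] := mem_mset gX; have [_ egy eY] := mem_mset gY.
have [hE ehx eX'] := mem_mset hX.
have [bxP rbx] := base_faceP (mpi x); have [byP rby] := base_faceP (mpi y).
have sx : (h * g^-1).2 (base_face (mpi x)) = base_face (mpi x).
  by rewrite sndM permM -ehx {1}egx permK.
have sy : (h * g^-1).2 (base_face (mpi y)) = base_face (mpi y).
  by rewrite sndM permM hy {1}egy permK.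
have hgE : h * g^-1 \in E by rewrite groupM ?groupV.
have [k [kE kx ky] ek] := rot_stab (E_rot hgE) bxP byP sx sy.
rewrite rbx in kx; rewrite rby in ky.
have hgD : h * g^-1 \in Dg (rk (mpi x)) by rewrite -mem_rcoset -eX.
suff ekh : k = h * g^-1 by rewrite eY mem_rcoset -ekh.
apply/eqP; rewrite eq_mulgV1; apply/eqP; apply: (Dg_inj px).
  by rewrite groupM ?groupV.
by rewrite sndM sndV ek mulgV.
Qed.

Definition mle x y := (mpi x <= mpi y)%O && (mset x :&: mset y != set0).

Lemma mset0 x : rk (mpi x) = 0 \/ rk (mpi x) = 5 -> mset x = E.
Proof.
move=> rx; have [g gX] := mset_ex x; have [gE _ ->] := mem_mset gX.
by case: rx => ->; rewrite ?Dg5 rcoset_id.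
Qed.

Lemma mset_meetE x y : rk (mpi x) = 0 \/ rk (mpi x) = 5 -> mset x :&: mset y != set0.
Proof.
move=> /mset0->; have [g gY] := mset_ex y; have [gE _ _] := mem_mset gY.
by apply/set0Pn; exists g; rewrite inE gE.
Qed.

Lemma mle_refl : reflexive mle.
Proof.
move=> x; rewrite /mle lexx setIid; have [g gX] := mset_ex x.
by apply/set0Pn; exists g.
Qed.

Lemma mle_anti : antisymmetric mle.
Proof.
move=> x y /andP[/andP[xy /set0Pn[g /setIP[gx gy]]] /andP[yx _]].
by apply: (mset_eq gx gy); apply/le_anti; rewrite xy.
Qed.

(** The three faces of [Q] form a chain, the image of base faces under one rotation; a lift of it in
    the coset of [x] then lies in all three cosets. Both transitivity of the order and the covering
    property come from this. *)
Lemma meet_refl x y z :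
    0 < rk (mpi x) < 5 -> (mpi y >=< mpi x)%O -> (mpi z >=< mpi x)%O ->
    (mpi y <= mpi z)%O -> mset x :&: mset y != set0 -> mset x :&: mset z != set0 ->
  mle y z.
Proof.
move=> px cyx czx yz my mz; rewrite /mle yz /=.
rewrite comparable_sym in cyx; rewrite comparable_sym in czx.
have [s sr [sx sy sz]] := chain3_rot cyx czx (le_comparable yz).
have [h hX hs] := mset_lift sr sx.
apply/set0Pn; exists h; rewrite inE (mset_lift_mem px hX) ?hs //=.
by rewrite (mset_lift_mem px hX) ?hs.
Qed.

Let ranks F : 0 < rk F < 5 \/ (rk F = 0 \/ rk F = 5).
Proof.
have := rk_max rQ F; case: (rk F) => [|[|[|[|[|[|]]]]]] //; by [left|right; left|right; right].
Qed.

Lemma mle_trans : transitive mle.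
Proof.
move=> y x z /andP[xy mxy] /andP[yz myz].
have [py|[y0|y5]] := ranks (mpi y).
- rewrite setIC in mxy.
  exact: (meet_refl py (le_comparable xy) (ge_comparable yz) (le_trans xy yz) mxy myz).
- rewrite /mle (le_trans xy yz) mset_meetE //; left.
  by apply/eqP; rewrite -leqn0 -y0 (rk_le rQ).
rewrite /mle (le_trans xy yz) setIC mset_meetE //; right.
have := rk_le rQ yz; rewrite y5 => z5.
by apply/eqP; rewrite eqn_leq z5 andbT -ltnS (rk_max rQ).
Qed.

Definition mixP : finPOrderType d :=
  HB.pack mix_face (Order.Le_isPOrder.Build d mix_face mle_refl mle_anti mle_trans).

Lemma mleE (x y : mixP) : (x <= y)%O = mle x y. Proof. by []. Qed.

(** * The projection to the polytope Q is a covering *)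

Lemma mcomparableE (x y : mixP) :
  (x >=< y)%O = (mpi x >=< mpi y)%O && (mset x :&: mset y != set0).
Proof.
by rewrite /Order.comparable !mleE /mle (setIC (mset y)); case: (_ != set0); rewrite ?andbT ?andbF.
Qed.

Let pi : mixP -> Q := mpi.

Lemma mix_pi_le : {homo pi : x y / (x <= y)%O}.
Proof. by move=> x y; rewrite mleE => /andP[]. Qed.

Lemma mix_pi_lift (x : mixP) G : proper_face 4 (pi x) -> (G >=< pi x)%O ->
  exists2 y : mixP, (y >=< x)%O & pi y = G.
Proof.
move=> px cGx.
have [s sr [sG _ sx]] := chain3_rot (comparablexx G) cGx cGx.
have [h hX hs] := mset_lift sr sx; have [hE _ _] := mem_mset hX.
have [bP rb] := base_faceP G; have [y ey eY] := mk_face bP hE.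
exists (y : mixP); last by rewrite /pi ey hs.
rewrite mcomparableE ey hs sG cGx; apply/set0Pn; exists h.
by rewrite inE hX eY rcoset_refl.
Qed.

Lemma mix_pi_refl (x y z : mixP) :
    proper_face 4 (pi x) -> (y >=< x)%O -> (z >=< x)%O -> (pi y <= pi z)%O ->
  (y <= z)%O.
Proof.
move=> px; rewrite !mcomparableE => /andP[cy my] /andP[cz mz] yz.
by rewrite mleE; apply: (meet_refl px) => //; rewrite setIC.
Qed.

Lemma mix_pi_least (x y : mixP) : rk (pi x) = 0 -> (x <= y)%O.
Proof.
move=> x0; rewrite mleE /mle mset_meetE ?andbT; last by left.
by move/eqP: x0; rewrite (rk0_least rQ) => /forallP.
Qed.

Lemma mix_pi_greatest (x y : mixP) : rk (pi x) = 5 -> (y <= x)%O.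
Proof.
move=> x0; rewrite mleE /mle setIC mset_meetE ?andbT; last by right.
by move/eqP: x0; rewrite (rk_greatest rQ) => /forallP.
Qed.

Lemma mix_pi_proper : exists x : mixP, proper_face 4 (pi x).
Proof.
have [F FP rF] := flag_rk_ex rQ fPhi (isT : 1 < 6).
have [x ex _] := mk_face FP (group1 E); exists (x : mixP).
by rewrite /pi ex perm1 /proper_face rF.
Qed.

Let n2 : 2 < 5. Proof. by []. Qed.
Let rP : ranked 4 mixP :=
  cover_ranked rQ mix_pi_le mix_pi_lift mix_pi_refl mix_pi_least mix_pi_greatest
    mix_pi_proper n2.
Let pi_adj (Psi : {set mixP}) i : Psi \in flags mixP -> i < 4 ->
    pi @: adj Psi i = adj (pi @: Psi) i.
Proof.
exact: (cover_adj rQ mix_pi_le mix_pi_lift mix_pi_refl mix_pi_least mix_pi_greatest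
  mix_pi_proper n2).
Qed.
Let pi_flagP (Psi : {set mixP}) : Psi \in flags mixP -> pi @: Psi \in flags Q.
Proof.
exact: (pi_flag rQ mix_pi_le mix_pi_lift mix_pi_refl mix_pi_least mix_pi_greatest
  mix_pi_proper).
Qed.
Let pi_rk (x : mixP) : rk x = rk (pi x).
Proof.
exact: (cover_rk rQ mix_pi_le mix_pi_lift mix_pi_refl mix_pi_least mix_pi_greatest
  mix_pi_proper).
Qed.
Let pi_eq (Psi Theta : {set mixP}) x :
    Psi \in flags mixP -> Theta \in flags mixP -> x \in Psi -> x \in Theta ->
  proper_face 4 (pi x) -> pi @: Psi = pi @: Theta -> Psi = Theta.
Proof.
exact: (flag_eq_of_pi rQ mix_pi_le mix_pi_lift mix_pi_refl mix_pi_least mix_pi_greatest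
  mix_pi_proper).
Qed.

(** * Flags of the mix and the action of E *)

Definition fl (g : DT) : {set mixP} := [set x : mixP | g \in mset x].

Lemma fl_pi g : g \in E -> pi @: fl g = g.2 @: Phi.
Proof.
move=> gE; apply/setP=> F; apply/imsetP/imsetP => [[x xg ->]|[x xP ->]].
  move: xg; rewrite inE => /mem_mset[_ e _].
  by exists (base_face (mpi x)); [case: (base_faceP (mpi x))|].
have [y ey eY] := mk_face xP gE; exists (y : mixP) => //.
by rewrite inE eY rcoset_refl.
Qed.

Lemma fl_flag g : g \in E -> fl g \in flags mixP.
Proof.
move=> gE; have sz : forall Psi : {set mixP}, Psi \in flags mixP -> #|Psi| = 6 by case: rP.
have fg := Gamma_flag (E_Gamma gE) fPhi.
apply: (chain_full sz).
  apply/is_chainP => x y xg yg; rewrite mcomparableE; apply/andP; split.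
    by apply: (flag_comparable fg); rewrite -fl_pi // (imset_f pi).
  by move: xg yg; rewrite !inE => xg yg; apply/set0Pn; exists g; rewrite inE xg.
rewrite -(card_in_imset (f := pi)); last first.
  by move=> x y; rewrite !inE => xg yg; apply: mset_eq xg yg.
by rewrite fl_pi //; case: rQ => _ _ h _; apply: h.
Qed.

Lemma fl_proper g j : g \in E -> 0 < j < 5 ->
  exists2 x, x \in fl g & rk (pi x) = j.
Proof.
move=> gE /andP[j0 j5].
by have [x xg rx] := flag_rk_ex rP (fl_flag gE) (ltnW j5 : j < 6); exists x; rewrite -?pi_rk.
Qed.

Lemma fl_inj g h : g \in E -> h \in E -> fl g = fl h -> g = h.
Proof.
move=> gE hE e; have [x xg rx] := fl_proper gE (isT : 0 < 1 < 5).
have xh : x \in fl h by rewrite -e.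
move: xg xh; rewrite !inE => xg xh; have [_ _ eX] := mem_mset xh.
apply/eqP; rewrite eq_mulgV1; apply/eqP; apply: (@Dg_inj 1%N) => //.
  by rewrite -rx -mem_rcoset -eX.
rewrite sndM sndV (@rho_inj g.2 h.2) ?E_Gamma ?mulgV //.
by rewrite -!fl_pi // e.
Qed.

Definition shift (g : DT) (x : mixP) : mixP :=
  insubd (x : mix_face) (g.2 (mpi x), mset x :* g).

Lemma shiftE g x : g \in E ->
  mpi (shift g x) = g.2 (mpi x) /\ mset (shift g x) = mset x :* g.
Proof.
move=> gE; have gG := E_Gamma gE.
suff h : is_mix_face (g.2 (mpi x), mset x :* g).
  by rewrite /mpi /mset /shift insubdK.
have [h hX] := mset_ex x; have [hE eF eX] := mem_mset hX.
have [bP rb] := base_faceP (mpi x).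
apply/exists_inP; exists (h * g); first by rewrite groupM.
rewrite /= (@base_face_eq _ (base_face (mpi x))) ?(Gamma_rk gG) //.
by rewrite permM -eF eqxx eX rcosetM eqxx.
Qed.

Lemma mface_eq x y : mpi x = mpi y -> mset x = mset y -> x = y.
Proof.
move=> e1 e2; apply: val_inj.
rewrite [val x]surjective_pairing [val y]surjective_pairing.
by rewrite -/(mpi x) -/(mpi y) -/(mset x) -/(mset y) e1 e2.
Qed.

Lemma shift_inj g : g \in E -> injective (shift g).
Proof.
move=> gE x y e; have [x1 x2] := shiftE x gE; have [y1 y2] := shiftE y gE.
apply: mface_eq; first by apply: (@perm_inj _ g.2); rewrite -x1 -y1 e.
by rewrite -[mset x](rcosetK g) -[mset y](rcosetK g) -x2 -y2 e.
Qed.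

(** Shifting cosets is known to be a permutation only for elements of [E]; the default value makes
    the map total. *)
Definition mact (g : DT) : {perm mixP} :=
  odflt 1 [pick s : {perm mixP} | [forall x : mixP, s x == shift g x]].

Lemma mactE g (x : mixP) : g \in E -> mact g x = shift g x.
Proof.
move=> gE; rewrite /mact; case: pickP => [s /forallP/(_ x)/eqP //|no].
have := no (perm (shift_inj gE)).
by move/negbT/forallPn=> [y]; rewrite permE eqxx.
Qed.

Opaque mact.

Lemma mactG g : g \in E -> mact g \in Gamma mixP.
Proof.
move=> gE; have gG := E_Gamma gE; rewrite inE; apply/forallP=> x; apply/forallP=> y.
have [x1 x2] := shiftE x gE; have [y1 y2] := shiftE y gE.
apply/eqP; rewrite !mactE // !mleE /mle x1 x2 y1 y2 (Gamma_le gG); congr (_ && _).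
apply/set0Pn/set0Pn => -[k /setIP[kx ky]].
  by exists (k * g^-1); rewrite inE -!mem_rcoset kx.
by exists (k * g); rewrite inE !mem_rcoset mulgK kx.
Qed.

Lemma mactM : {in E &, {morph mact : g h / g * h}}.
Proof.
move=> g h gE hE; have ghE := groupM gE hE.
apply/permP=> x; have e1 := mactE x ghE; have e2 := mactE x gE.
have e3 := mactE (mact g x) hE; rewrite e1 [RHS]permM e3 e2 {e1 e2 e3}.
have [x1 x2] := shiftE x ghE.
have [y1 y2] := shiftE x gE; have [z1 z2] := shiftE (shift g x) hE.
apply: mface_eq; first by rewrite x1 z1 y1 sndM permM.
by rewrite x2 z2 y2 rcosetM.
Qed.

Lemma mact_fl g h : g \in E -> h \in E -> mact h @: fl g = fl (g * h).
Proof.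
move=> gE hE; apply: (flag_sub_eq rP (Gamma_flag (mactG hE) (fl_flag gE))
  (fl_flag (groupM gE hE))).
apply/subsetP=> _ /imsetP[x xg ->]; rewrite inE mactE //.
have [_ ->] := shiftE x hE; rewrite mem_rcoset mulgK.
by move: xg; rewrite inE.
Qed.

Lemma mact_inj : {in E &, injective mact}.
Proof.
move=> g h gE hE e; apply: (fl_inj gE hE).
have m1 (u : DT) : u \in E -> mact u @: fl 1 = fl u.
  by move=> uE; rewrite (mact_fl (group1 E) uE) mul1g.
by rewrite -(m1 g gE) -(m1 h hE) e.
Qed.

Lemma fl_even (Psi : {set mixP}) h :
    Psi \in flags mixP -> h \in E -> pi @: Psi = h.2 @: Phi ->
  exists2 g, g \in E & Psi = fl g.
Proof.
move=> fP hE ePi; have hG := E_Gamma hE.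
have [x xP rx] := flag_rk_ex rP fP (isT : 1 < 6).
have /imsetP[F FP ex] : pi x \in h.2 @: Phi by rewrite -ePi imset_f.
have [|g gX gs] := @mset_lift x _ (E_rot hE).
  by rewrite -/(pi x) (@base_face_eq _ F) ?ex // (Gamma_rk hG).
have [gE _ _] := mem_mset gX; exists g => //.
apply: (pi_eq fP (fl_flag gE) xP); rewrite ?inE //.
  by rewrite /proper_face -pi_rk rx.
by rewrite fl_pi // gs ePi.
Qed.

Lemma fl_cases (Psi : {set mixP}) :
  Psi \in flags mixP -> exists2 g, g \in E & Psi = fl g \/ Psi = adj (fl g) 0.
Proof.
move=> fP; have [h hE []] := reach_all (isT : 0 < 4) (pi_flagP fP) => e.
  by have [g gE eg] := fl_even fP hE (esym e); exists g; [|left].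
have fA := adj_flag rP fP (isT : 0 < 4).
have [|g gE eg] := fl_even fA hE.
  rewrite pi_adj // -e rho_flag ?E_Gamma // (adjK rQ) //.
  exact: (Gamma_flag (E_Gamma hE)).
by exists g => //; right; rewrite -eg (adjK rP).
Qed.

Lemma fl_tgen i k g : i < 4 -> k < 4 -> g \in E ->
  fl (tgen i k * g) = adj (adj (fl g) k) i.
Proof.
move=> lt_i lt_k gE; have gG := E_Gamma gE; have fg := fl_flag gE.
have tE : tgen i k \in E by exact: mem_tgen.
have tgE := groupM tE gE.
have fk := adj_flag rP fg lt_k; have fki := adj_flag rP fk lt_i.
have [m lt_m] := avoid_rank i.+1 k.+1 k.+1; rewrite !inE orbb => /norP[mi mk].
have pm : 0 < m.+1 < 5 by [].
have [x xg rx] := fl_proper gE pm.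
have xk : x \in adj (adj (fl g) k) i.
  by rewrite !(adj_mem rP) // pi_rk rx.
apply: (pi_eq (fl_flag tgE) fki _ xk).
- move: xg; rewrite !inE => xg; have [_ _ ->] := mem_mset xg.
  by rewrite mem_rcoset mulgK rx mem_tgen // eq_sym.
- by rewrite /proper_face rx.
rewrite (pi_adj fk lt_i) (pi_adj fg lt_k) (fl_pi tgE) (fl_pi gE) sndM tgen2 // -mulgA.
have rG : r k * g.2 \in Gamma Q by rewrite groupM ?rhoG.
by rewrite (rho_flag lt_i rG) (rho_flag lt_k gG).
Qed.

(** Projected to [Q], the equality would express a reflection as a quotient of two rotations. *)
Lemma fl_odd i g h : i < 4 -> g \in E -> h \in E -> fl g <> adj (fl h) i.
Proof.
move=> lt_i gE hE /(congr1 (fun A : {set mixP} => pi @: A)).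
have hG := E_Gamma hE; rewrite pi_adj ?fl_flag // !fl_pi // -rho_flag // => /rho_inj e.
case/negP: (rho_notin_rot lt_i); rewrite -(groupMr _ (E_rot hE)) -e ?E_rot ?E_Gamma //.
by rewrite groupM ?rhoG.
Qed.

Lemma improper_in_flag (Psi : {set mixP}) x :
  Psi \in flags mixP -> ~~ proper_face 4 (pi x) -> x \in Psi.
Proof.
move=> fP px; apply: (flag_max fP) => y _.
exact: (improper_comparable rQ mix_pi_least mix_pi_greatest).
Qed.

(** Flags sharing a proper face are joined on one sheet. Others share only improper faces, which lie
    in every flag, so for them plain connectedness is enough; it holds because a generator of [E]
    moves flags by two exchanges. *)
Lemma mix_connected : strongly_flag_connected mixP.
Proof.
pose R0 : rel {set mixP} := [rel A B | [&& A \in flags mixP, B \in flags mixP & adjacent A B]].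
have R0_sym : connect_sym R0.
  apply: sym_connect_sym => A B; rewrite /R0 /= andbCA.
  by congr [&& _, _ & _]; rewrite /adjacent andbC.
have step A i : A \in flags mixP -> i < 4 -> connect R0 A (adj A i).
  by move=> fA lt_i; apply: connect1; rewrite /R0 /= fA (adj_flag rP) // (adj_adjacent rP).
have c1 g : g \in E -> connect R0 (fl 1) (fl g).
  suff : g \in E -> g \in E /\ connect R0 (fl 1) (fl g) by move=> h /h[].
  move: g; apply: gen_indl => [|g _ /stab_gensP[i [k [lt_i lt_k _ _ ->]]] [gE cg]].
    by split; [exact: group1|exact: connect0].
  split; first by rewrite groupM ?mem_tgen.
  have fk := adj_flag rP (fl_flag gE) lt_k.
  rewrite fl_tgen //; apply: connect_trans cg _.
  by apply: connect_trans (step _ _ fk lt_i); apply: step; rewrite ?fl_flag.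
have conn A B : A \in flags mixP -> B \in flags mixP -> connect R0 A B.
  suff c0 A' : A' \in flags mixP -> connect R0 (fl 1) A'.
    by move=> fA fB; apply: connect_trans (c0 B fB); rewrite R0_sym c0.
  move=> fA; have [g gE [->|->]] := fl_cases fA; first exact: c1.
  by apply: connect_trans (c1 _ gE) _; apply: step; rewrite ?fl_flag.
move=> A B fA fB.
case: (pickP [pred x in A :&: B | proper_face 4 (pi x)]) => [x /andP[/setIP[xA xB] px]|no].
  exact: (cover_connected rQ mix_pi_le mix_pi_lift mix_pi_refl mix_pi_least
    mix_pi_greatest mix_pi_proper connQ fA fB xA xB px).
have sI C : C \in flags mixP -> A :&: B \subset C.
  move=> fC; apply/subsetP=> x xI; apply: improper_in_flag => //.
  by have /negbT := no x; rewrite /= xI.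
apply: connect_sub (conn _ _ fA fB) => C D /and3P[fC fD aCD].
by apply: connect1; rewrite /= fC fD aCD !sI.
Qed.

Lemma mix_polytope : is_polytope 4 mixP.
Proof. by case: rP => *; split=> //; exact: mix_connected. Qed.

Lemma mix_spherical : locally_spherical Q -> locally_spherical mixP.
Proof.
exact: (cover_locally_spherical rQ mix_pi_le mix_pi_lift mix_pi_refl mix_pi_least
  mix_pi_greatest mix_pi_proper erefl).
Qed.

Lemma wgenE i : i < 4 -> wgen i \in E.
Proof. by move=> lt_i; rewrite -tgen0 mem_tgen. Qed.

Lemma E_ind (Pr : DT -> Prop) :
    Pr 1 ->
    (forall g i k, i < 4 -> k < 4 -> g \in E -> Pr g -> Pr (g * ((wgen i)^-1 * wgen k))) ->
  forall g, g \in E -> Pr g.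
Proof.
move=> P1 PM; suff h g : g \in E -> g \in E /\ Pr g by move=> g /h[].
move: g; apply: gen_ind; first by split; first exact: group1.
move=> g _ /stab_gensP[i [k [lt_i lt_k _ _ ->]]] [gE Pg].
by split; [exact: (groupM gE (mem_tgen lt_i lt_k _ _))|exact: PM].
Qed.

Lemma mix_two_step i k (Psi : {set mixP}) : i < 4 -> k < 4 -> Psi \in flags mixP ->
  exists2 s, s \in Gamma mixP & s @: Psi = adj (adj Psi k) i.
Proof.
move=> lt_i lt_k fP.
exact: (two_step_ex rP wgenE fl_flag mactG mactM mact_fl fl_cases fl_tgen lt_i lt_k fP).
Qed.

(** The iterated exchanges close up in the mix exactly when they do in [Q]: a proper face of a rank
    that they avoid stays in all these flags and pins down the sheet. *)
Lemma mix_type : chiral_type mixP [:: 3; 5; 3].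
Proof.
move=> Psi fP i lt_i; have fQ := pi_flagP fP.
have lt_k : i.+1 < 4 by []; have lt_i4 : i < 4 := ltnW lt_k.
have [s sG es] := mix_two_step lt_i4 lt_k fP.
have [cG ce] := movingP sG es; rewrite -[RHS](Qtype fQ lt_i).
have rho_Q m : m < 4 ->
    rho (pi @: Psi) m \in Gamma Q /\ rho (pi @: Psi) m @: (pi @: Psi) = adj (pi @: Psi) m.
  by move=> lt_m; apply: (regular_rho rQ) => //; case: Qdr.
have [r1G r1e] := rho_Q _ lt_i4; have [r2G r2e] := rho_Q _ lt_k.
have sgG : sigma (pi @: Psi) i.+1 \in Gamma Q by rewrite groupM.
have sge : sigma (pi @: Psi) i.+1 @: (pi @: Psi) = two_step i i.+1 (pi @: Psi).
  by rewrite imset_permM /= r1e -(adj_Gamma rQ r2G) // r2e.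
have pi_iter m : pi @: iter m (two_step i i.+1) Psi = iter m (two_step i i.+1) (pi @: Psi).
  elim: m => //= m <-; have fm := iter_two_step_flag rP lt_i4 lt_k m fP.
  by rewrite /two_step !pi_adj // (adj_flag rP).
have [m lt_m] := avoid_rank i.+1 i.+2 i.+2; rewrite !inE orbb => /norP[mi mk].
have [x xP rx] := flag_rk_ex rP fP (leq_trans (lt_m : m.+2 <= 5) (isT : 5 <= 6)).
have x_iter l : x \in iter l (two_step i i.+1) Psi.
  elim: l => //= l IHl; have fl' := iter_two_step_flag rP lt_i4 lt_k l fP.
  by rewrite /two_step !(adj_mem rP) ?(adj_flag rP) // rx.
have eq_exp l : (chiral_sigma Psi i.+1 ^+ l == 1) = (sigma (pi @: Psi) i.+1 ^+ l == 1).
  rewrite (two_step_expg rP mix_connected lt_i4 lt_k l cG fP ce).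
  rewrite (two_step_expg rQ connQ lt_i4 lt_k l sgG fQ sge) -pi_iter.
  apply/eqP/eqP => [->//|e].
  apply: (pi_eq (iter_two_step_flag rP lt_i4 lt_k l fP) fP (x_iter l) xP _ e).
  by rewrite /proper_face -pi_rk rx.
apply/eqP; rewrite eqn_dvd; apply/andP; split; rewrite order_dvdn.
  by rewrite eq_exp expg_order.
by rewrite -eq_exp expg_order.
Qed.

Section NoEndo.
Context (no_endo : forall f, ~ inverting_endo 3 E wgen f).

Lemma mix_chiral : chiral mixP.
Proof.
exact: (rotary_chiral rP mix_connected wgen0 wgenE E_ind fl_flag mactG mactM mact_inj
  mact_fl fl_cases fl_tgen fl_odd no_endo).
Qed.

Lemma mix_isog : Gamma mixP \isog E.
Proof.
exact: (rotary_isog rP mix_connected wgen0 wgenE E_ind fl_flag mactG mactM mact_inj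
  mact_fl fl_cases fl_tgen no_endo).
Qed.

Lemma mix_chiral_polytope :
    locally_spherical Q ->
  [/\ is_polytope 4 mixP, locally_spherical mixP, chiral mixP,
      chiral_type mixP [:: 3; 5; 3] & Gamma mixP \isog E].
Proof.
move=> sQ; split; [exact: mix_polytope|exact: mix_spherical|exact: mix_chiral
  |exact: mix_type|exact: mix_isog].
Qed.

End NoEndo.

End Mix.

(** * Direct products with a simple factor *)

Section SimpleFactor.
Context (kT hT : finGroupType) (K : {group kT}) (R : {group hT}).
Context (simpK : forall N : {group kT}, N \subset K -> K \subset 'N(N) ->
  N :=: 1 \/ N :=: K).
Context (KR : ~~ (#|K| %| #|R|)).

Lemma pairM (k k' : kT) (s s' : hT) : (k, s) * (k', s') = (k * k', s * s').
Proof. by []. Qed.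

Lemma pairV (k : kT) (s : hT) : (k, s)^-1 = (k^-1, s^-1).
Proof. by []. Qed.

(** The elements of [K] paired with 1 form a normal subgroup. If it is trivial, [E] has the order of
    [R] and maps onto [K], against the assumption on orders; if it is [K], then [E] is the whole
    product. *)
Lemma goursat_simple (E : {group kT * hT}) :
    E \subset setX K R ->
    (forall k, k \in K -> exists s, (k, s) \in E) ->
    (forall s, s \in R -> exists k, (k, s) \in E) ->
  E :=: setX K R.
Proof.
move=> sE ontoK ontoR.
have memE k s : (k, s) \in E -> k \in K /\ s \in R.
  by move/(subsetP sE); rewrite inE /= => /andP.
pose N0 : {set kT} := [set k | (k, 1) \in E].
have gN : group_set N0.
  apply/group_setP; split=> [|x y]; first by rewrite inE (group1 E).
  by rewrite !inE => xE yE; have := groupM xE yE; rewrite pairM mulg1.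
pose N : {group kT} := Group gN.
have sNK : N \subset K by apply/subsetP=> x; rewrite inE => /memE[].
have nN : K \subset 'N(N).
  apply/subsetP=> k /ontoK[s ksE]; rewrite inE; apply/subsetP=> _ /imsetP[x xN ->].
  rewrite !inE in xN *; have := groupJ xN ksE.
  by rewrite conjgE pairV !pairM mul1g mulVg -conjgE.
case: (simpK sNK nN) => eN.
  case/negP: KR.
  have inj : {in E &, injective snd}.
    move=> [x s] [y t] xE yE /= est; rewrite -est in yE *.
    have : (x, s) * (y, s)^-1 \in E by rewrite groupM ?groupV.
    rewrite pairV pairM mulgV => h; have : x * y^-1 \in N by rewrite inE.
    rewrite eN => /set1P e1; congr pair.
    by rewrite -[x](mulgKV y) e1 mul1g.
  have eR : snd @: E = R.
    apply/setP=> s; apply/imsetP/idP => [[[k t] kE ->]|/ontoR[k kE]].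
      by have [] := memE _ _ kE.
    by exists (k, s).
  have eK : [morphism of @fst kT hT] @* E = K.
    rewrite morphimEsub ?subsetT //; apply/setP=> k; apply/imsetP/idP => [[[k' t] kE ->]|/ontoK[s kE]].
      by have [] := memE _ _ kE.
    by exists (k, s).
  by rewrite -eR (card_in_imset inj) -{1}eK; apply: dvdn_morphim.
apply/eqP; rewrite eqEsubset sE; apply/subsetP=> -[k s]; rewrite inE /= => /andP[kK /ontoR[k' kE]].
have [kK' _] := memE _ _ kE.
have : k * k'^-1 \in N by rewrite eN groupM ?groupV.
by rewrite inE => h; have := groupM h kE; rewrite pairM mulgKV mul1g.
Qed.

Context (cK : forall u, u \in K -> (forall k, k \in K -> u * k = k * u) -> u = 1).

(** By simplicity and the orders, the [R]-component of [f] on [K] is trivial, so [f] maps [K] onto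
    itself. The image of [R] then commutes with [K], whose centre is trivial. *)
Lemma setX_endo (f : kT * hT -> kT * hT) :
    {in setX K R &, {morph f : u v / u * v}} -> {in setX K R, forall u, f u \in setX K R} ->
    {in setX K R &, injective f} ->
  exists phi : kT -> kT,
    [/\ {in K &, {morph phi : x y / x * y}}, {in K, forall x, phi x \in K},
        {in K &, injective phi}
      & forall k s, k \in K -> s \in R -> (f (k, s)).1 = phi k].
Proof.
move=> fM fX f_inj.
have kX k : k \in K -> (k, 1) \in setX K R by move=> kK; rewrite inE /= kK group1.
have f1 : f 1 = 1.
  have X1 : (1 : kT * hT) \in setX K R by apply: kX.
  by apply: (mulgI (f 1)); rewrite -fM // !mulg1.
pose psi k := (f (k, 1)).2.
have psiM : {in K &, {morph psi : x y / x * y}}.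
  move=> x y xK yK; rewrite /psi; have -> : (x * y, 1) = (x, 1) * (y, 1) :> kT * hT.
    by rewrite pairM mulg1.
  by rewrite fM ?kX.
have psi1 : psi 1 = 1 by rewrite /psi f1.
pose psim := Morphism psiM.
have psi_triv k : k \in K -> psi k = 1.
  have sN : 'ker psim \subset K by apply: subsetIl.
  case: (simpK sN (ker_norm psim)) => [eN|eN kK].
    case/negP: KR; have inj : 'injm psim by rewrite /= eN.
    rewrite -(card_injm inj (subxx K)); apply: cardSg; apply/subsetP=> _ /morphimP[x _ xK ->].
    by have := fX _ (kX _ xK); rewrite inE => /andP[].
  have : k \in 'ker psim by rewrite eN.
  by move/mker.
have fk k : k \in K -> f (k, 1) = ((f (k, 1)).1, 1).
  by move=> kK; have := psi_triv k kK; rewrite /psi; case: (f _) => u v /= ->.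
pose phi k := (f (k, 1)).1.
have phiM : {in K &, {morph phi : x y / x * y}}.
  move=> x y xK yK; rewrite /phi; have -> : (x * y, 1) = (x, 1) * (y, 1) :> kT * hT.
    by rewrite pairM mulg1.
  by rewrite fM ?kX.
have phiK k : k \in K -> phi k \in K.
  by move=> kK; have := fX _ (kX _ kK); rewrite inE => /andP[].
have phi_inj : {in K &, injective phi}.
  move=> x y xK yK e; have [] // : (x, 1) = (y, 1) :> kT * hT.
  by apply: f_inj; rewrite ?kX // fk // [RHS]fk //; congr pair.
have phi_onto : phi @: K = K.
  apply/eqP; rewrite eqEcard (card_in_imset phi_inj) leqnn andbT.
  by apply/subsetP=> _ /imsetP[k kK ->]; apply: phiK.
exists phi; split=> // k s kK sR.
have sX : (1, s) \in setX K R by rewrite inE /= group1.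
have -> : (k, s) = (k, 1) * (1, s) by rewrite pairM mulg1 mul1g.
rewrite fM ?kX //.
suff e1 : (f (1, s)).1 = 1 by rewrite -[LHS]/((f (k, 1)).1 * (f (1, s)).1) e1 mulg1.
apply: cK; first by have := fX _ sX; rewrite inE => /andP[].
move=> k'; have -> : (k' \in K) = (k' \in phi @: K) by rewrite phi_onto.
case/imsetP=> x xK ->.
have e : f (1, s) * f (x, 1) = f (x, 1) * f (1, s).
  by rewrite -!fM ?kX // !pairM !mulg1 !mul1g.
exact: (congr1 fst e).
Qed.

End SimpleFactor.

Import GRing.Theory Num.Theory.

(** * Two-by-two matrices *)

Section Matrix2.
Context (F : fieldType).
Local Open Scope ring_scope.
Implicit Types (a b c d : F) (A B : 'M[F]_2).

Definition mx2 a b c d : 'M[F]_2 :=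
  \matrix_(i, j) (if i == 0 then if j == 0 then a else b
                  else if j == 0 then c else d).

Lemma mx2P A : A = mx2 (A 0 0) (A 0 1) (A 1 0) (A 1 1).
Proof.
apply/matrixP=> i j; rewrite mxE.
by case: i => -[|[|//]] hi; case: j => -[|[|//]] hj /=; congr (A _ _); apply: val_inj.
Qed.

Lemma mx2_inj a b c d a' b' c' d' :
  mx2 a b c d = mx2 a' b' c' d' -> [/\ a = a', b = b', c = c' & d = d'].
Proof.
by move/matrixP=> h; have := (h 0 0, h 0 1, h 1 0, h 1 1);
  rewrite !mxE /= => -[[[-> ->] ->] ->].
Qed.

Lemma mx2M a b c d a' b' c' d' :
  mx2 a b c d *m mx2 a' b' c' d' =
  mx2 (a * a' + b * c') (a * b' + b * d') (c * a' + d * c') (c * b' + d * d').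
Proof.
apply/matrixP=> i j; rewrite !mxE big_ord_recl big_ord1 !mxE /=.
by case: i => -[|[|//]] hi; case: j => -[|[|//]] hj.
Qed.

Lemma mx2_det a b c d : \det (mx2 a b c d) = a * d - b * c.
Proof.
by rewrite (expand_det_row _ 0) big_ord_recl big_ord1 /cofactor !det_mx11 !mxE /=
  /= expr0 expr1 mul1r mulN1r mulrN.
Qed.

Lemma mx2_tr a b c d : \tr (mx2 a b c d) = a + d.
Proof. by rewrite /mxtrace big_ord_recl big_ord1 !mxE. Qed.

Lemma mx2_1 : 1%:M = mx2 1 0 0 1.
Proof.
apply/matrixP=> i j; rewrite !mxE.
by case: i => -[|[|//]] hi; case: j => -[|[|//]] hj.
Qed.

Lemma mx2Z k a b c d : k *: mx2 a b c d = mx2 (k * a) (k * b) (k * c) (k * d).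
Proof. by apply/matrixP=> i j; rewrite !mxE; case: ifP => _; case: ifP. Qed.

End Matrix2.

(* Naming the finite group keeps its operations keyed on one canonical structure. *)
Definition GL2 (F : finFieldType) : finGroupType := {'GL_2[F]}.

Section GL2.
Context (F : finFieldType).
Local Notation GL := (GL2 F).
Implicit Types (a b c d t : F) (g h u v : GL).

(** Singular entries give the identity as a default, hence the determinant hypotheses in what
    follows. *)
Definition gl a b c d : GL := insubd (1 : {'GL_2[F]}) (mx2 a b c d).

Arguments gl (a b c d)%_ring_scope.

Lemma gl_val a b c d : (a * d - b * c != 0)%R -> GLval (gl a b c d) = mx2 a b c d.
Proof. by move=> h; rewrite /gl insubdK // unitmxE mx2_det unitfE. Qed.

Lemma GLval_inj : injective (@GLval 2 F). Proof. exact: val_inj. Qed.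

Lemma GLvalM g h : GLval (g * h) = (GLval g *m GLval h)%R. Proof. by []. Qed.

Variant gl_spec : GL -> Type :=
  GlSpec a b c d of (a * d - b * c != 0)%R : gl_spec (gl a b c d).

Lemma glP g : gl_spec g.
Proof.
pose A := GLval g; have gU : (A 0 0 * A 1 1 - A 0 1 * A 1 0 != 0)%R.
  by rewrite -mx2_det -mx2P; have := GL_unitmx g; rewrite unitmxE unitfE.
suff -> : g = gl (A 0%R 0%R) (A 0%R 1%R) (A 1%R 0%R) (A 1%R 1%R) by [].
by apply: GLval_inj; rewrite gl_val // -mx2P.
Qed.

Lemma gl_inj a b c d a' b' c' d' :
    (a * d - b * c != 0)%R -> (a' * d' - b' * c' != 0)%R ->
  gl a b c d = gl a' b' c' d' -> [/\ a = a', b = b', c = c' & d = d'].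
Proof.
by move=> h h' /(congr1 (@GLval 2 F)); rewrite !gl_val // => /mx2_inj.
Qed.

Lemma glM a b c d a' b' c' d' :
    (a * d - b * c != 0)%R -> (a' * d' - b' * c' != 0)%R ->
  gl a b c d * gl a' b' c' d' =
  gl (a * a' + b * c')%R (a * b' + b * d')%R (c * a' + d * c')%R (c * b' + d * d')%R.
Proof.
move=> h h'; apply: GLval_inj; rewrite [RHS]gl_val.
  by rewrite GLvalM !gl_val // mx2M.
have -> : ((a * a' + b * c') * (c * b' + d * d') - (a * b' + b * d') * (c * a' + d * c')
  = (a * d - b * c) * (a' * d' - b' * c'))%R by ring.
by rewrite mulf_neq0.
Qed.

Lemma gl1 : 1 = gl 1 0 0 1 :> GL.
Proof.
by apply: GLval_inj; rewrite gl_val ?mulr1 ?mulr0 ?subr0 ?oner_eq0 // -mx2_1.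
Qed.

Definition SL : {set GL} := [set g | (\det (GLval g) == 1)%R].

Lemma SL_group_set : group_set SL.
Proof.
apply/group_setP; split=> [|g h]; first by rewrite inE det1.
by rewrite !inE det_mulmx => /eqP-> /eqP->; rewrite mulr1.
Qed.

Canonical SL_group : {group GL} := Group SL_group_set.

Lemma sl_nz a b c d : (a * d - b * c = 1 -> a * d - b * c != 0)%R.
Proof. by move=> ->; apply: oner_neq0. Qed.

Lemma mem_SL a b c d : (a * d - b * c != 0)%R ->
  (gl a b c d \in SL) = (a * d - b * c == 1)%R.
Proof. by move=> h; rewrite inE gl_val // mx2_det. Qed.

Variant sl_spec : GL -> Type :=
  SlSpec a b c d of (a * d - b * c = 1)%R : sl_spec (gl a b c d).

Lemma slP g : g \in SL -> sl_spec g.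
Proof. by case: (glP g) => a b c d h; rewrite mem_SL // => /eqP; constructor. Qed.

Lemma slM a b c d a' b' c' d' :
    (a * d - b * c = 1)%R -> (a' * d' - b' * c' = 1)%R ->
  gl a b c d * gl a' b' c' d' =
  gl (a * a' + b * c')%R (a * b' + b * d')%R (c * a' + d * c')%R (c * b' + d * d')%R.
Proof. by move=> h h'; apply: glM; apply: sl_nz. Qed.

Lemma slV a b c d : (a * d - b * c = 1)%R -> (gl a b c d)^-1 = gl d (- b)%R (- c)%R a.
Proof.
move=> h; have h' : (d * a - - b * - c = 1)%R by rewrite -h; ring.
apply: (mulIg (gl a b c d)); rewrite mulVg slM // gl1.
congr gl; rewrite -?h; ring.
Qed.

Lemma sl_mem a b c d : (a * d - b * c = 1)%R -> gl a b c d \in SL.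
Proof. by move=> h; rewrite mem_SL ?h ?oner_neq0. Qed.

Definition gtr g : F := (\tr (GLval g))%R.

Lemma gtr_sl a b c d : (a * d - b * c = 1)%R -> gtr (gl a b c d) = (a + d)%R.
Proof. by move=> h; rewrite /gtr gl_val ?h ?oner_neq0 // mx2_tr. Qed.

Lemma gtrC g h : gtr (g * h) = gtr (h * g).
Proof. exact: mxtrace_mulC. Qed.

Lemma gtrJ g h : gtr (g ^ h) = gtr g.
Proof. by rewrite conjgE gtrC -mulgA mulgV mulg1. Qed.

Definition upper t := gl 1 t 0 1.
Definition lower t := gl 1 0 t 1.

Arguments upper t%_ring_scope.
Arguments lower t%_ring_scope.

Let det_u t : (1 * 1 - t * 0 = 1 :> F)%R. Proof. by ring. Qed.
Let det_l t : (1 * 1 - 0 * t = 1 :> F)%R. Proof. by ring. Qed.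

Lemma upperM s t : upper s * upper t = upper (s + t)%R.
Proof. by rewrite /upper slM //; congr gl; ring. Qed.

Lemma lowerM s t : lower s * lower t = lower (s + t)%R.
Proof. by rewrite /lower slM //; congr gl; ring. Qed.

Lemma upperX t n : upper t ^+ n = upper (t *+ n)%R.
Proof.
elim: n => [|n IHn]; first by rewrite expg0 mulr0n gl1.
by rewrite expgS IHn upperM mulrS.
Qed.

Lemma lowerX t n : lower t ^+ n = lower (t *+ n)%R.
Proof.
elim: n => [|n IHn]; first by rewrite expg0 mulr0n gl1.
by rewrite expgS IHn lowerM mulrS.
Qed.

Context (F_cyc : forall s t : F, (s != 0)%R -> exists n, t = (s *+ n)%R).

(** By [F_cyc] the powers of one nontrivial transvection run through its whole root subgroup. A
    matrix with c nonzero is a product of an upper, a lower and an upper transvection, and a factor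
    [lower (-1)] reduces the case c = 0 to this one. *)
Lemma SL_sub_gen (G : {group GL}) s t :
  (s != 0)%R -> (t != 0)%R -> upper s \in G -> lower t \in G -> SL \subset G.
Proof.
move=> s0 t0 sG tG.
have uG x : upper x \in G by have [n ->] := F_cyc x s0; rewrite -upperX groupX.
have lG x : lower x \in G by have [n ->] := F_cyc x t0; rewrite -lowerX groupX.
have main a b c d : (a * d - b * c = 1)%R -> (c != 0)%R -> gl a b c d \in G.
  move=> h c0; have eb : b = ((a * d - 1) / c)%R.
    by apply: (mulIf c0); rewrite mulfVK // -h; ring.
  have -> : gl a b c d = upper ((a - 1) / c)%R * lower c * upper ((d - 1) / c)%R.
    have -> : upper ((a - 1) / c)%R * lower c = gl a ((a - 1) / c)%R c 1.
      by rewrite /upper /lower slM //; congr gl; field.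
    have h2 : (a * 1 - (a - 1) / c * c = 1)%R by field.
    by rewrite /upper slM //; congr gl; rewrite ?eb; field.
  by rewrite !groupM.
apply/subsetP=> g /slP[a b c d h].
have [c0|c0] := eqVneq c 0%R; last exact: main.
have d0 : (d != 0)%R.
  by apply: contra_eqN h => /eqP->; rewrite c0 !mulr0 subr0 eq_sym oner_eq0.
have -> : gl a b c d = gl (a + b) b d d * lower (-1)%R.
  have h2 : ((a + b) * d - b * d = 1)%R by rewrite -h c0; ring.
  by rewrite /lower slM //; congr gl; rewrite ?c0; ring.
by rewrite groupM // main // -h c0; ring.
Qed.

End GL2.

Arguments gl {F} (a b c d)%_ring_scope.
Arguments upper {F} t%_ring_scope.
Arguments lower {F} t%_ring_scope.

Section Unipotent.
Context (F : finFieldType).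
Local Notation GL := (GL2 F).
Local Notation SL := (SL F).
Implicit Types (a b c d t : F) (g h u v : GL).

Let det_u t : (1 * 1 - t * 0 = 1 :> F)%R. Proof. by ring. Qed.
Let det_l t : (1 * 1 - 0 * t = 1 :> F)%R. Proof. by ring. Qed.

Lemma conjg_eq g h u : u * g = g * h -> u ^ g = h.
Proof. by move=> e; rewrite conjgE e mulKg. Qed.

Lemma lower0 : lower 0 = 1 :> GL. Proof. by rewrite gl1. Qed.

(* With [N = u - 1] and [M = v - 1] of square zero and [f] in the image of [M] such that
   [N f != 0], the basis [(N f, f)] makes [N] strictly upper and [M] strictly lower triangular. *)
Lemma unipotent_pair u v :
    u \in SL -> v \in SL -> gtr u = 2%:R%R -> gtr v = 2%:R%R -> u * v <> v * u ->
  exists g t, [/\ (t != 0)%R, u ^ g = upper 1 & v ^ g = lower t].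
Proof.
case/slP=> a b c d h; case/slP=> a' b' c' d' h'; rewrite !gtr_sl // => tr tr'.
have {tr}ed : d = (2%:R - a)%R by rewrite -tr; ring.
have {tr'}ed' : d' = (2%:R - a')%R by rewrite -tr'; ring.
subst d d'.
pose x := (a - 1)%R; pose x' := (a' - 1)%R.
have ea : a = (1 + x)%R by rewrite /x; ring.
have ea' : a' = (1 + x')%R by rewrite /x'; ring.
have hx : (x * x = - (b * c))%R.
  have -> : (x * x = 1 - (a * (2%:R - a) - b * c) - b * c)%R by rewrite /x; ring.
  by rewrite h subrr sub0r.
have hx' : (x' * x' = - (b' * c'))%R.
  have -> : (x' * x' = 1 - (a' * (2%:R - a') - b' * c') - b' * c')%R by rewrite /x'; ring.
  by rewrite h' subrr sub0r.
clearbody x x'; subst a a' => ncomm.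
pose t := (2%:R * x * x' + b * c' + c * b')%R.
suff main f1 f2 : (x' * f1 + b' * f2 = 0)%R -> (c' * f1 - x' * f2 = 0)%R ->
    (x' * (x * f1 + b * f2) + b' * (c * f1 - x * f2) = t * f1)%R ->
    (c' * (x * f1 + b * f2) - x' * (c * f1 - x * f2) = t * f2)%R ->
    (x * f1 + b * f2 != 0)%R || (c * f1 - x * f2 != 0)%R ->
    exists g t, [/\ (t != 0)%R, gl (1 + x) b c (2%:R - (1 + x)) ^ g = upper 1
      & gl (1 + x') b' c' (2%:R - (1 + x')) ^ g = lower t].
  (* The candidates for f are the columns of M. If N kills both of them then N M = 0; taking
     adjugates of these traceless matrices gives M N = 0, so [u] and [v] commute. *)
  have [n1|] := boolP ((x * x' + b * c' != 0) || (c * x' - x * c' != 0))%R.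
    apply: (main x' c') n1; rewrite /t.
    - by rewrite hx'; ring.
    - by ring.
    - transitivity ((2%:R * x * x' + b * c' + c * b') * x' - x * (x' * x' + b' * c'))%R.
        by ring.
      by rewrite hx' addNr mulr0 subr0.
    transitivity (2%:R * x * x' * c' + b * c' * c' - c * (x' * x'))%R; first by ring.
    by rewrite hx'; ring.
  rewrite negb_or !negbK => /andP[/eqP z1 /eqP z2].
  have [n1|] := boolP ((x * b' + b * (- x') != 0) || (c * b' - x * (- x') != 0))%R.
    apply: (main b' (- x')%R) n1; rewrite /t.
    - by ring.
    - (have -> : (c' * b' - x' * - x' = c' * b' + x' * x')%R by ring); by rewrite hx'; ring.
    - (have -> : (x' * (x * b' + b * - x') + b' * (c * b' - x * - x') = 2%:R * x * x' * b' - b * (x' * x') + c * b' * b')%R by ring); by rewrite hx'; ring.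
    transitivity (x * (c' * b' - x' * x') - b * c' * x' - c * b' * x')%R; first by ring.
    have -> : (c' * b' = - (x' * x'))%R by rewrite hx' opprK mulrC.
    by ring.
  rewrite negb_or !negbK => /andP[/eqP z3 /eqP z4]; case: ncomm.
  rewrite !slM //; congr gl; apply/eqP; rewrite -subr_eq0; apply/eqP.
  + by transitivity (x * x' + b * c' - (c * b' - x * - x'))%R; [ring|rewrite z1 z4 subrr].
  + by transitivity (2%:R * (x * b' + b * (- x')))%R; [ring|rewrite z3 mulr0].
  + by transitivity (2%:R * (c * x' - x * c'))%R; [ring|rewrite z2 mulr0].
  + by transitivity (c * b' - x * - x' - (x * x' + b * c'))%R; [ring|rewrite z1 z4 subrr].
move=> m1 m2 m3 m4; set n1 := (x * f1 + b * f2)%R; set n2 := (c * f1 - x * f2)%R => n0.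
pose D := (n1 * f2 - f1 * n2)%R.
(* As N has square zero, the squares of both entries of N f are multiples of the determinant [D] of
   (N f, f). *)
have D0 : (D != 0)%R.
  have e1 : (n1 * n1 = b * D)%R.
    have -> : (n1 * n1 = (x * x) * (f1 * f1) + 2%:R * x * b * f1 * f2 + b * b * f2 * f2)%R.
      by rewrite /n1; ring.
    by rewrite hx /D /n1 /n2; ring.
  have e2 : (n2 * n2 = - c * D)%R.
    have -> : (n2 * n2 = c * c * f1 * f1 - 2%:R * x * c * f1 * f2 + (x * x) * f2 * f2)%R.
      by rewrite /n2; ring.
    by rewrite hx /D /n1 /n2; ring.
  apply: contraTneq n0 => D0; rewrite negb_or !negbK.
  move: e1 e2; rewrite D0 !mulr0 => /eqP; rewrite mulf_eq0 orbb => -> /eqP.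
  by rewrite mulf_eq0 orbb.
have nn1 : (x * n1 + b * n2 = 0)%R.
  have -> : (x * n1 + b * n2 = (x * x) * f1 + b * c * f1)%R by rewrite /n1 /n2; ring.
  by rewrite hx; ring.
have nn2 : (c * n1 - x * n2 = 0)%R.
  have -> : (c * n1 - x * n2 = (x * x) * f2 + b * c * f2)%R by rewrite /n1 /n2; ring.
  by rewrite hx; ring.
pose g := gl n1 f1 n2 f2; have gv : (n1 * f2 - f1 * n2 != 0)%R by [].
have eu : gl (1 + x) b c (2%:R - (1 + x)) * g = g * upper 1.
  rewrite /g /upper !glM ?det_u ?h ?oner_neq0 //; congr gl.
  - by transitivity (n1 + (x * n1 + b * n2))%R; [ring|rewrite nn1; ring].
  - by rewrite /n1; ring.
  - by transitivity (n2 + (c * n1 - x * n2))%R; [ring|rewrite nn2; ring].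
  - by rewrite /n2; ring.
have ev : gl (1 + x') b' c' (2%:R - (1 + x')) * g = g * lower t.
  rewrite /g /lower !glM ?det_l ?h' ?oner_neq0 //; congr gl.
  - by transitivity (n1 + (x' * n1 + b' * n2))%R; [ring|rewrite m3; ring].
  - by transitivity (f1 + (x' * f1 + b' * f2))%R; [ring|rewrite m1; ring].
  - by transitivity (n2 + (c' * n1 - x' * n2))%R; [ring|rewrite m4; ring].
  - by transitivity (f2 + (c' * f1 - x' * f2))%R; [ring|rewrite m2; ring].
exists g, t; split; [|exact: conjg_eq|exact: conjg_eq].
apply: contra_not_neq ncomm => t0.
have -> : gl (1 + x') b' c' (2%:R - (1 + x')) = 1.
  by apply: (mulIg g); rewrite ev t0 lower0 mulg1 mul1g.
by rewrite mulg1 mul1g.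
Qed.

Lemma SL_conj g : g \in 'N(SL).
Proof.
rewrite inE; apply/subsetP=> _ /imsetP[h hS ->]; move: hS; rewrite !inE.
by rewrite conjgE !GLvalM !det_mulmx mulrCA -det_mulmx -GLvalM mulVg det1 mulr1.
Qed.

Context (F_cyc : forall s t : F, (s != 0)%R -> exists n, t = (s *+ n)%R).

Lemma unipotents_gen (G : {group GL}) u v :
    u \in SL -> v \in SL -> gtr u = 2%:R%R -> gtr v = 2%:R%R -> u * v <> v * u ->
  u \in G -> v \in G -> SL \subset G.
Proof.
move=> uS vS tu tv ncomm uG vG.
have [g [t [t0 eu ev]]] := unipotent_pair uS vS tu tv ncomm.
have : SL \subset (G :^ g)%G.
  by apply: (SL_sub_gen F_cyc (oner_neq0 F) t0); rewrite -?eu -?ev memJ_conjg.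
by rewrite -{1}(normP (SL_conj g)) conjSg.
Qed.

End Unipotent.

(** * Structure of the projective special linear group *)

Section SL2Structure.
Context (F : finFieldType) (p : nat) (pF : p \in [pchar F]%R).
Local Notation GL := (GL2 F).
Local Notation SL := (SL F).
Local Notation SLg := (SL_group F).
Implicit Types (a b c d t : F) (g h u v : GL).

Context (F_cyc : forall s t : F, (s != 0)%R -> exists n, t = (s *+ n)%R).
Context (n2 : (2%:R != 0 :> F)%R) (n3 : (3%:R != 0 :> F)%R) (n5 : (5%:R != 0 :> F)%R).

Let det_u t : (1 * 1 - t * 0 = 1 :> F)%R. Proof. by ring. Qed.
Let det_l t : (1 * 1 - 0 * t = 1 :> F)%R. Proof. by ring. Qed.

Lemma upper_SL t : upper t \in SL. Proof. by apply: sl_mem. Qed.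
Lemma lower_SL t : lower t \in SL. Proof. by apply: sl_mem. Qed.

Lemma upperXp t : upper t ^+ p = 1.
Proof. by rewrite upperX -mulr_natr (pcharf0 pF) mulr0 gl1. Qed.

Lemma lowerXp t : lower t ^+ p = 1.
Proof. by rewrite lowerX -mulr_natr (pcharf0 pF) mulr0 gl1. Qed.

Lemma GLvalX g n : GLval (g ^+ n) = (GLval g ^+ n)%R.
Proof. by elim: n => // n IHn; rewrite expgS exprS -IHn. Qed.

(** In characteristic [p] one has (g - 1)^p = g^p - 1 = 0, so g - 1 is singular; for determinant one
    this means trace 2. *)
Lemma p_elt_tr g : g \in SL -> g ^+ p = 1 -> gtr g = 2%:R%R.
Proof.
case/slP=> a b c d h gp; have pM : p \in [pchar 'M[F]_2]%R.
  by rewrite pchar_lalg.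
have := pFrobenius_autB_comm pM (commr1 (mx2 a b c d)).
rewrite !pFrobenius_autE expr1n -gl_val ?sl_nz // -GLvalX gp /= subrr.
move/(congr1 (fun A : 'M[F]_2 => (\det A)%R)); rewrite det0.
have detX (A : 'M[F]_2) n : (\det (A ^+ n) = \det A ^+ n)%R.
  by elim: n => [|n IHn]; rewrite ?det1 // !exprS det_mulmx IHn.
rewrite detX gl_val ?sl_nz // => /eqP; rewrite expf_eq0 => /andP[_ /eqP].
have -> : (mx2 a b c d - 1 = mx2 (a - 1) b c (d - 1))%R.
  apply/matrixP=> i j; rewrite -[1%R]/(1%:M)%R mx2_1 !mxE.
  by case: i => -[|[|//]] hi; case: j => -[|[|//]] hj //=; rewrite subr0.
rewrite mx2_det gtr_sl // => e.
have -> : (a + d = 1 + (a * d - b * c) - ((a - 1) * (d - 1) - b * c))%R by ring.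
by rewrite e h; ring.
Qed.

Definition mone : GL := gl (-1) 0 0 (-1).

Let det_m : ((-1) * (-1) - 0 * 0 = 1 :> F)%R. Proof. by ring. Qed.

Lemma mone_SL : mone \in SL. Proof. exact: sl_mem. Qed.

Lemma mul_mone a b c d : (a * d - b * c = 1)%R ->
  mone * gl a b c d = gl (- a) (- b) (- c) (- d).
Proof. by move=> h; rewrite /mone slM //; congr gl; ring. Qed.

Lemma moneK : mone * mone = 1.
Proof. by rewrite {2}/mone mul_mone // gl1; congr gl; ring. Qed.

Lemma gtr_mone g : g \in SL -> gtr (mone * g) = (- gtr g)%R.
Proof.
case/slP=> a b c d h; rewrite mul_mone // !gtr_sl ?opprD //.
by rewrite -h; ring.
Qed.

Lemma mone_comm g : g \in SL -> mone * g = g * mone.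
Proof.
case/slP=> a b c d h; rewrite mul_mone // /mone slM //; congr gl; ring.
Qed.

Lemma SL_centralP g : g \in SL ->
  g * upper 1 = upper 1 * g -> g * lower 1 = lower 1 * g -> g = 1 \/ g = mone.
Proof.
case/slP=> a b c d h; rewrite /upper /lower !slM // => e1 e2.
have k1 : ((a * 1 + b * 0) * (c * 1 + d * 1) - (a * 1 + b * 1) * (c * 1 + d * 0) != 0)%R.
  by apply: sl_nz; transitivity (a * d - b * c)%R; [ring|exact: h].
have k2 : ((1 * a + 1 * c) * (0 * b + 1 * d) - (1 * b + 1 * d) * (0 * a + 1 * c) != 0)%R.
  by apply: sl_nz; transitivity (a * d - b * c)%R; [ring|exact: h].
have k3 : ((a * 1 + b * 1) * (c * 0 + d * 1) - (a * 0 + b * 1) * (c * 1 + d * 1) != 0)%R.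
  by apply: sl_nz; transitivity (a * d - b * c)%R; [ring|exact: h].
have k4 : ((1 * a + 0 * c) * (1 * b + 1 * d) - (1 * b + 0 * d) * (1 * a + 1 * c) != 0)%R.
  by apply: sl_nz; transitivity (a * d - b * c)%R; [ring|exact: h].
have [e3 e4 _ _] := gl_inj k1 k2 e1; have [e5 _ _ _] := gl_inj k3 k4 e2.
have c0 : c = 0%R.
  by transitivity ((1 * a + 1 * c) - (a * 1 + b * 0))%R; [ring|rewrite -e3 subrr].
have b0 : b = 0%R.
  by transitivity ((a * 1 + b * 1) - (1 * a + 0 * c))%R; [ring|rewrite e5 subrr].
have ad : a = d by move: e4; rewrite b0 !mulr1 !mul1r addr0 add0r.
move: h; rewrite c0 b0 -ad mul0r subr0 => /eqP; rewrite -expr2 sqrf_eq1.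
by case/orP=> /eqP->; [left; rewrite gl1|right].
Qed.

Lemma center_SL : 'Z(SLg) = [set 1; mone].
Proof.
apply/setP=> g; rewrite in_set2; apply/idP/idP => [|/orP[]/eqP->].
- case/(centerP SLg g) => gS gC.
  have := SL_centralP gS (gC (upper 1) (upper_SL 1%R)) (gC (lower 1) (lower_SL 1%R)).
  by case=> ->; rewrite eqxx ?orbT.
- exact: group1.
by apply/centerP; split; [exact: mone_SL|move=> h hS; apply: mone_comm].
Qed.

(** A noncentral [x] has a vector v independent of x v, and in the basis (v, x v) it is a companion
    matrix. Its commutator with diag(2, 1/2) is triangular with diagonal 4, 1/4, and a commutator of
    that with [upper 1] is the transvection with entry 1 - 1/16 = 15/16, nonzero because 3 and 5
    are. *)
Lemma SL_normal_full (N : {group GL}) x :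
    SL \subset 'N(N) -> x \in N -> x \in SL -> x \notin 'Z(SLg) -> SL \subset N.
Proof.
move=> nN xN xS; rewrite center_SL !inE => /norP[x1 xm].
suff [g [t [N' eN xg]]] : exists g t, exists2 N' : {group GL}, N' :=: N :^ g
    & gl 0 (-1) 1 t \in N'.
  have nN' : SL \subset 'N(N').
    by rewrite eN -(normP (SL_conj g)) normJ conjSg.
  suff : SL \subset N' by rewrite eN -{1}(normP (SL_conj g)) conjSg.
  have nJ h k : h \in SL -> k \in N' -> k ^ h \in N'.
    by move=> hS kN; rewrite memJ_norm // (subsetP nN').
  have dt : (0 * t - (-1) * 1 = 1)%R by ring.
  have dd : (2%:R * 2%:R^-1 - 0 * 0 = 1 :> F)%R by rewrite mulfV //; ring.
  have e1 : gl 0 (-1) 1 t ^ gl 2%:R 0 0 2%:R^-1 = gl 0 (- 4%:R^-1) 4%:R t.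
    have n4 : (4%:R != 0 :> F)%R by rewrite (natrM _ 2 2) mulf_neq0.
    have d4 : (0 * t - (- 4%:R^-1) * 4%:R = 1)%R by field.
    by apply: conjg_eq; rewrite !slM //; congr gl; field; rewrite ?n2 ?n4.
  have n4 : (4%:R != 0 :> F)%R by rewrite (natrM _ 2 2) mulf_neq0.
  have d4 : (0 * t - (- 4%:R^-1) * 4%:R = 1)%R by field.
  have w1 := nJ _ _ (sl_mem dd) xg; rewrite e1 in w1.
  have xgV := groupVr xg.
  have := groupM xgV w1; rewrite slV // slM //; last by ring.
  have -> : gl (t * 0 + - -1 * 4%:R) (t * - 4%:R^-1 + - -1 * t) (-1 * 0 + 0 * 4%:R)
     (-1 * - 4%:R^-1 + 0 * t) = gl 4%:R (3%:R * t / 4%:R) 0 4%:R^-1.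
    by congr gl; field.
  have dw : (4%:R * 4%:R^-1 - 3%:R * t / 4%:R * 0 = 1)%R by field.
  set w := gl 4%:R _ _ _ => wN.
  have wV := groupVr wN.
  have wU := nJ _ _ (upper_SL 1%R) wN.
  have := groupM wV wU.
  have -> : w^-1 * w ^ upper 1 = upper (15%:R / 16%:R).
    have n16 : (16%:R != 0 :> F)%R by rewrite (natrM _ 4 4) mulf_neq0.
    rewrite conjgE mulgA; have -> : (upper 1)^-1 = upper (-1) :> GL.
      by rewrite /upper slV //; congr gl; ring.
    apply: (mulgI w); rewrite !mulgA mulgV mul1g /w /upper !slM //; try by field.
    by congr gl; field; rewrite ?n4 ?n16.
  move=> uN; have n15 : (15%:R / 16%:R != 0 :> F)%R.
    by rewrite mulf_neq0 ?invr_eq0 ?(natrM _ 3 5) ?(natrM _ 4 4) ?mulf_neq0.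
  have dJ : (0 * 0 - (-1) * 1 = 1 :> F)%R by ring.
  have lN := nJ _ _ (sl_mem dJ) uN.
  have eL s : upper s ^ gl 0 (-1) 1 0 = lower (- s) :> GL.
    by apply: conjg_eq; rewrite /upper /lower !slM //; congr gl; ring.
  rewrite eL in lN; apply: (SL_sub_gen F_cyc n15 _ uN lN).
  by rewrite oppr_eq0.
have [v1 [v2 D0]] : exists v1 v2 : F,
    (v1 * (GLval x 1 0 * v1 + GLval x 1 1 * v2)
     - (GLval x 0 0 * v1 + GLval x 0 1 * v2) * v2 != 0)%R.
  have [c0|c0] := eqVneq (GLval x 1%R 0%R) 0%R; last first.
    by exists 1%R, 0%R; rewrite !mulr1 !mulr0 !addr0 subr0 mul1r.
  have [b0|b0] := eqVneq (GLval x 0%R 1%R) 0%R; last first.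
    exists 0%R, 1%R; by rewrite mul0r mulr1 !mulr0 !add0r mulr1 oppr_eq0.
  exists 1%R, 1%R; rewrite c0 b0 !mulr1 !mul1r add0r addr0 subr_eq0.
  apply: contraNneq x1 => ad.
  have : x * upper 1 = upper 1 * x /\ x * lower 1 = lower 1 * x.
    case/slP: (xS) c0 b0 ad => a b c d h; rewrite gl_val ?sl_nz // !mxE /= => c0 b0 ad.
    subst c b; subst d || subst a.
    by rewrite /upper /lower !slM //; split; congr gl; ring.
  by case=> /(SL_centralP xS) k /k[->//|xe]; rewrite xe eqxx in xm.
case/slP: xS xN D0 {x1 xm} => a b c d h xN; rewrite (gl_val (sl_nz h)) !mxE /= => D0.
exists (gl v1 (a * v1 + b * v2) v2 (c * v1 + d * v2)), (a + d)%R.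
exists (N :^ gl v1 (a * v1 + b * v2) v2 (c * v1 + d * v2))%G => //.
have dt : (0 * (a + d) - (-1) * 1 = 1)%R by ring.
suff <- : gl a b c d ^ gl v1 (a * v1 + b * v2) v2 (c * v1 + d * v2) = gl 0 (-1) 1 (a + d).
  by rewrite memJ_conjg.
apply: conjg_eq; rewrite (glM (sl_nz h) D0) (glM D0 (sl_nz dt)); congr gl.
- by ring.
- transitivity (- v1 * (a * d - b * c) + (a * v1 + b * v2) * (a + d))%R; last by rewrite h; ring.
  by ring.
- by ring.
transitivity (- v2 * (a * d - b * c) + (c * v1 + d * v2) * (a + d))%R; last by rewrite h; ring.
by ring.
Qed.

Lemma noncentral_pair : upper 1 * lower 1 <> lower 1 * upper 1 :> GL.
Proof.
rewrite /upper /lower !slM // => e.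
have [||e1 _ _ _] := gl_inj _ _ e.
- by apply: sl_nz; ring.
- by apply: sl_nz; ring.
have : (1 * 1 + 1 * 1 - (1 * 1 + 0 * 0) = 0 :> F)%R by rewrite e1 subrr.
have -> : (1 * 1 + 1 * 1 - (1 * 1 + 0 * 0) = 1 :> F)%R by ring.
by move/eqP; rewrite oner_eq0.
Qed.

Local Notation Zg := 'Z(SLg).
Local Notation pr := (coset Zg).
Local Notation K := (SLg / Zg).

Let sN : SL \subset 'N(Zg). Proof. exact: (normal_norm (center_normal SLg)). Qed.

Lemma prM : {in SL &, {morph pr : g h / g * h}}.
Proof. by move=> g h gS hS; rewrite morphM // (subsetP sN). Qed.

Lemma prV g : g \in SL -> pr g^-1 = (pr g)^-1.
Proof. by move=> gS; rewrite morphV // (subsetP sN). Qed.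

Lemma prX g n : g \in SL -> pr (g ^+ n) = pr g ^+ n.
Proof. by move=> gS; rewrite morphX // (subsetP sN). Qed.

Lemma pr_K g : g \in SL -> pr g \in K.
Proof. by move=> gS; apply: mem_quotient. Qed.

Lemma pr_surj x : x \in K -> exists2 g, g \in SL & x = pr g.
Proof. by case/morphimP=> g _ gS ->; exists g. Qed.

Lemma pr_eq1 g : g \in SL -> pr g = 1 -> g = 1 \/ g = mone.
Proof.
move=> gS e; have : g \in Zg by apply: coset_idr e; apply: (subsetP sN).
by rewrite center_SL => /set2P.
Qed.

Lemma pr_mone : pr mone = 1.
Proof. by apply: coset_id; rewrite center_SL set22. Qed.

Lemma pr_eq g h : g \in SL -> h \in SL -> pr g = pr h -> g = h \/ g = mone * h.
Proof.
move=> gS hS e; have hV := groupVr (hS : h \in SLg).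
have [||] := @pr_eq1 (g * h^-1) (groupM (gS : g \in SLg) hV).
- by rewrite prM // prV // e mulgV.
- by move=> e1; left; rewrite -[g](mulgKV h) e1 mul1g.
by move=> e1; right; rewrite -e1 mulgKV.
Qed.

Context (p_odd : odd p).

(** If [g ^+ p] is -1, then -g is another lift and its p-th power is 1, as [p] is odd. *)
Lemma p_lift x : x \in K -> x ^+ p = 1 -> exists2 g, g \in SL & x = pr g /\ g ^+ p = 1.
Proof.
move=> /pr_surj[g gS ->]; rewrite -prX // => e.
have gp : g ^+ p \in SLg by exact: groupX.
have [gp1|gpm] := pr_eq1 gp e; first by exists g.
exists (mone * g); first exact: (groupM (mone_SL : mone \in SLg) gS).
split; first by rewrite prM ?mone_SL // pr_mone mul1g.
have cmg : commute mone g by exact: mone_comm.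
rewrite expgMn // gpm -expgSr -(odd_double_half p.+1) /= p_odd /= add0n -mul2n expgM.
by rewrite [mone ^+ 2]expgS expg1 moneK expg1n.
Qed.

(* An automorphism of PSL(2,p) sends the standard transvections to a pair conjugate to
   [upper 1], [lower t], and [t = 1] since [upper 1 * lower (-1) * upper 1] has order 2. *)
Lemma PSL_aut (f : coset_of Zg -> coset_of Zg) :
    {in K &, {morph f : x y / x * y}} -> {in K, forall x, f x \in K} ->
    {in K &, injective f} ->
  exists h : GL, forall g, g \in SL -> f (pr g) = pr (g ^ h).
Proof.
move=> fM fK f_inj.
have f1 : f 1 = 1.
  by apply: (mulgI (f 1)); rewrite -fM ?group1 // !mulg1.
have fX x n : x \in K -> f (x ^+ n) = f x ^+ n.
  by move=> xK; elim: n => [|n IHn]; rewrite ?expg0 // !expgS fM ?IHn ?groupX.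
have fV x : x \in K -> f x^-1 = (f x)^-1.
  by move=> xK; apply: (mulIg (f x)); rewrite -fM ?groupV // !mulVg.
pose u : GL := upper 1; pose v : GL := lower 1.
have uS : u \in SL := upper_SL _; have vS : v \in SL := lower_SL _.
have uK := pr_K uS; have vK := pr_K vS.
have [|u1 u1S [eu u1p]] := p_lift (fK _ uK).
  by rewrite -fX // -prX // upperXp morph1.
have [|v1 v1S [ev v1p]] := p_lift (fK _ vK).
  by rewrite -fX // -prX // lowerXp morph1.
have ncomm : u1 * v1 <> v1 * u1.
  move=> e; have : f (pr (u * v)) = f (pr (v * u)).
    by rewrite !prM // !fM // eu ev -!prM // e.
  have uvS : u * v \in SL := groupM (uS : u \in SLg) vS.
  have vuS : v * u \in SL := groupM (vS : v \in SLg) uS.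
  move/f_inj => /(_ (pr_K uvS) (pr_K vuS)) /(pr_eq uvS vuS)[/noncentral_pair//|].
  move/(congr1 (@gtr F)); rewrite gtr_mone // gtrC => /eqP.
  rewrite -subr_eq0 opprK /u /v /upper /lower slM // gtr_sl; last by ring.
  have -> : (1 * 1 + 0 * 0 + (1 * 1 + 1 * 1) + (1 * 1 + 0 * 0 + (1 * 1 + 1 * 1)) = 2%:R * 3%:R :> F)%R by ring.
  by rewrite mulf_eq0 (negbTE n2) (negbTE n3).
have [h [t [t0 eh1 eh2]]] :=
  unipotent_pair u1S v1S (p_elt_tr u1S u1p) (p_elt_tr v1S v1p) ncomm.
have JS g k : g \in SL -> g ^ k \in SL by move=> gS; rewrite memJ_norm // SL_conj.
have dq : ((1 - t) * (1 - t) - (2%:R - t) * - t = 1)%R by ring.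
have qE s : upper 1 * (lower s)^-1 * upper 1 = gl (1 - s) (2%:R - s) (- s) (1 - s) :> GL.
  rewrite /upper /lower slV // !slM //; try by ring.
  by congr gl; ring.
have q1 : (u1 * v1^-1 * u1) ^+ 2 = 1 \/ (u1 * v1^-1 * u1) ^+ 2 = mone.
  have vVS : v^-1 \in SL := groupVr (vS : v \in SLg).
  have v1VS : v1^-1 \in SL := groupVr (v1S : v1 \in SLg).
  have uvS : u * v^-1 \in SL := groupM (uS : u \in SLg) vVS.
  have u1vS : u1 * v1^-1 \in SL := groupM (u1S : u1 \in SLg) v1VS.
  have qS : u * v^-1 * u \in SL := groupM (uvS : _ \in SLg) uS.
  have q1S : u1 * v1^-1 * u1 \in SL := groupM (u1vS : _ \in SLg) u1S.
  apply: pr_eq1; first exact: (groupX 2 (q1S : _ \in SLg)).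
  have K1 : pr u * (pr v)^-1 \in K := groupM uK (groupVr vK).
  have e : f (pr (u * v^-1 * u)) = pr (u1 * v1^-1 * u1).
    rewrite (prM uvS uS) (prM uS vVS) (prV vS) (fM _ _ K1 uK) (fM _ _ uK (groupVr vK)).
    by rewrite (fV _ vK) eu ev -(prV v1S) -(prM u1S v1VS) -(prM u1vS u1S).
  rewrite prX // -e.
  rewrite -fX ?pr_K // -prX // /u /v qE.
  have -> : gl (1 - 1) (2%:R - 1) (- 1) (1 - 1) ^+ 2 = mone.
    have d1 : ((1 - 1) * (1 - 1) - (2%:R - 1) * - 1 = 1 :> F)%R by ring.
    by rewrite expgS expg1 slM // /mone; congr gl; ring.
  by rewrite pr_mone.
have t1 : t = 1%R.
  have : ((u1 * v1^-1 * u1) ^+ 2) ^ h = 1 \/ ((u1 * v1^-1 * u1) ^+ 2) ^ h = mone.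
    case: q1 => ->; first by left; rewrite conj1g.
    right; rewrite conjgE; have [a b c d hh] := glP h.
    by apply: (mulgI (gl a b c d)); rewrite mulVKg /mone (glM (sl_nz det_m) hh) (glM hh (sl_nz det_m)); congr gl; ring.
  rewrite conjXg !conjMg conjVg eh1 eh2 qE expgS expg1 slM // gl1 /mone.
  have nz : (((1 - t) * (1 - t) + (2%:R - t) * - t) * (- t * (2%:R - t) + (1 - t) * (1 - t))
     - ((1 - t) * (2%:R - t) + (2%:R - t) * (1 - t)) * (- t * (1 - t) + (1 - t) * - t) != 0)%R.
    by apply: sl_nz; ring.
  have key : (- t * (1 - t) + (1 - t) * - t = 0 -> t = 1)%R.
    move=> e; have : (2%:R * t * (1 - t) = 0)%R.
      by rewrite -[RHS]oppr0 -e; ring.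
    by move/eqP; rewrite !mulf_eq0 (negbTE n2) (negbTE t0) /= subr_eq0 => /eqP.
  case=> e; have [||_ _ e3 _] := gl_inj _ _ e => //; try exact: key.
    by apply: sl_nz; ring.
  by apply: sl_nz; ring.
exists h^-1 => g gS.
have : g \in <<[set u; v]>>.
  have : SL \subset <<[set u; v]>>%G.
    by apply: (SL_sub_gen F_cyc (oner_neq0 F) (oner_neq0 F)); rewrite mem_gen ?set21 ?set22.
  by move/subsetP; apply.
suff : g \in <<[set u; v]>> -> g \in SL /\ f (pr g) = pr (g ^ h^-1) by move=> k /k[].
move: g {gS}; apply: gen_ind => [|x y xy [xS ex]].
  by split; [exact: (group1 SLg)|rewrite conj1g morph1].
have [yS ey] : y \in SL /\ f (pr y) = pr (y ^ h^-1).
  case/set2P: xy => ->; split=> //.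
    by rewrite eu -[u1](conjgK h) eh1.
  by rewrite ev -[v1](conjgK h) eh2 t1.
split; first exact: (groupM (xS : x \in SLg) yS).
by rewrite (prM xS yS) (fM _ _ (pr_K xS) (pr_K yS)) ex ey conjMg (prM (JS _ _ xS) (JS _ _ yS)).
Qed.

End SL2Structure.

(** * Counting centralizers *)

Section Centralizers.
Context (F : finFieldType).
Local Notation GL := (GL2 F).
Local Notation SL := (SL F).
Local Notation mone := (mone F).
Context (n2 : (2%:R != 0 :> F)%R).
Implicit Types (x y z g : GL).

Lemma sl_comm (a b c d a' b' c' d' : F) :
    (a * d - b * c = 1)%R -> (a' * d' - b' * c' = 1)%R ->
  gl a b c d * gl a' b' c' d' = gl a' b' c' d' * gl a b c d ->
  [/\ b * c' = b' * c, a * b' + b * d' = a' * b + b' * d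
    & c * a' + d * c' = c' * a + d' * c]%R.
Proof.
move=> h h'; rewrite !slM // => e.
have k (u v w z u' v' w' z' : F) : (u * z - v * w = 1 -> u' * z' - v' * w' = 1 ->
   (u * u' + v * w') * (w * v' + z * z') - (u * v' + v * z') * (w * u' + z * w') != 0 :> F)%R.
  by move=> k k'; apply: sl_nz; transitivity ((u * z - v * w) * (u' * z' - v' * w'))%R;
    [ring|rewrite k k' mulr1].
have [e1 e2 e3 _] := gl_inj (k _ _ _ _ _ _ _ _ h h') (k _ _ _ _ _ _ _ _ h' h) e.
split=> //; apply: (addrI (a * a')%R); rewrite e1; ring.
Qed.

Lemma comm_sl (a b c d a' b' c' d' : F) :
    (a * d - b * c = 1)%R -> (a' * d' - b' * c' = 1)%R ->
  [/\ b * c' = b' * c, a * b' + b * d' = a' * b + b' * d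
    & c * a' + d * c' = c' * a + d' * c]%R ->
  gl a b c d * gl a' b' c' d' = gl a' b' c' d' * gl a b c d.
Proof.
move=> h h' [e1 e2 e3]; rewrite !slM //; congr gl => //.
  by rewrite e1; ring.
transitivity (d * d' + b' * c)%R; first by ring.
by rewrite -e1; ring.
Qed.

Definition nonc x := x \notin [set 1; mone].

Lemma nonc_entries (a b c d : F) : (a * d - b * c = 1)%R -> nonc (gl a b c d) ->
  [|| (b != 0)%R, (c != 0)%R | (d - a != 0)%R].
Proof.
move=> h; apply: contraR; rewrite !negb_or !negbK => /and3P[/eqP b0 /eqP c0].
rewrite subr_eq0 => /eqP ad; move: h; rewrite b0 c0 ad mul0r subr0 => /eqP.
rewrite -expr2 sqrf_eq1 !inE => /orP[]/eqP->; last by rewrite eqxx orbT.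
by rewrite -gl1 eqxx.
Qed.

(* Commuting means that the vectors (b, c, d - a) are parallel. *)
Lemma comm_trans x y z :
    x \in SL -> y \in SL -> z \in SL -> nonc x ->
  x * y = y * x -> x * z = z * x -> y * z = z * y.
Proof.
case/slP=> a b c d h; case/slP=> a1 b1 c1 d1 h1; case/slP=> a2 b2 c2 d2 h2.
move=> /(nonc_entries h) nc /(sl_comm h h1)[e1 e2 e3] /(sl_comm h h2)[f1 f2 f3].
apply: (comm_sl h1 h2).
have e2' : (b * (d1 - a1) = b1 * (d - a))%R.
  by apply: (addrI (a * b1 + a1 * b)%R); transitivity (a * b1 + b * d1)%R; [ring|rewrite e2; ring].
have e3' : (c * (d1 - a1) = c1 * (d - a))%R.
  by apply: (addrI (c * a1 + c1 * a)%R); transitivity (c1 * a + d1 * c)%R; [ring|rewrite -e3; ring].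
have f2' : (b * (d2 - a2) = b2 * (d - a))%R.
  by apply: (addrI (a * b2 + a2 * b)%R); transitivity (a * b2 + b * d2)%R; [ring|rewrite f2; ring].
have f3' : (c * (d2 - a2) = c2 * (d - a))%R.
  by apply: (addrI (c * a2 + c2 * a)%R); transitivity (c2 * a + d2 * c)%R; [ring|rewrite -f3; ring].
suff [g1 g2 g3] : [/\ b1 * c2 = b2 * c1, b1 * (d2 - a2) = b2 * (d1 - a1)
    & c1 * (d2 - a2) = c2 * (d1 - a1)]%R.
  split=> //.
    by transitivity (a1 * b2 + a2 * b1 + b1 * (d2 - a2))%R; [ring|rewrite g2; ring].
  by transitivity (c1 * a2 + c2 * a1 + c2 * (d1 - a1))%R; [ring|rewrite -g3; ring].
have cr (u v w u1 v1 w1 u2 v2 w2 : F) : (u != 0 -> u * v1 = u1 * v -> u * w1 = u1 * w ->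
    u * v2 = u2 * v -> u * w2 = u2 * w ->
    [/\ u1 * v2 = u2 * v1, u1 * w2 = u2 * w1 & v1 * w2 = v2 * w1])%R.
  move=> u0 k1 k2 k3 k4; split; apply: (mulfI u0).
  - by transitivity (u1 * (u * v2))%R; [ring|rewrite k3; transitivity (u2 * (u1 * v))%R; [ring|rewrite -k1; ring]].
  - by transitivity (u1 * (u * w2))%R; [ring|rewrite k4; transitivity (u2 * (u1 * w))%R; [ring|rewrite -k2; ring]].
  apply: (mulfI u0).
  transitivity ((u * v1) * (u * w2))%R; first by ring.
  transitivity ((u * v2) * (u * w1))%R; last by ring.
  by rewrite k1 k2 k3 k4; ring.
case/or3P: nc => nz.
- by have [k1 k2 k3] := cr b c (d - a)%R b1 c1 (d1 - a1)%R b2 c2 (d2 - a2)%R nz e1 e2' f1 f2'.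
- have [k1 k2 k3] := cr c b (d - a)%R c1 b1 (d1 - a1)%R c2 b2 (d2 - a2)%R nz
    (etrans (mulrC _ _) (etrans (esym e1) (mulrC _ _))) e3'
    (etrans (mulrC _ _) (etrans (esym f1) (mulrC _ _))) f3'.
  by split=> //; rewrite mulrC -k1 mulrC.
have [k1 k2 k3] := cr (d - a)%R b c (d1 - a1)%R b1 c1 (d2 - a2)%R b2 c2 nz
  (etrans (mulrC _ _) (etrans (esym e2') (mulrC _ _)))
  (etrans (mulrC _ _) (etrans (esym e3') (mulrC _ _)))
  (etrans (mulrC _ _) (etrans (esym f2') (mulrC _ _)))
  (etrans (mulrC _ _) (etrans (esym f3') (mulrC _ _))).
split; first exact: k3; by rewrite mulrC -?k1 -?k2 mulrC.
Qed.

(** Commuting makes the vectors (b, c, d - a) proportional by some k, and equal traces give them the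
    same discriminant tr^2 - 4. As this is nonzero, k is 1 or -1. *)
Lemma same_trace_comm x y :
    x \in SL -> y \in SL -> x * y = y * x -> gtr y = gtr x -> nonc x ->
    (gtr x ^+ 2 != 4%:R)%R ->
  y = x \/ y = x^-1.
Proof.
case/slP=> a b c d h; case/slP=> a1 b1 c1 d1 h1 /(sl_comm h h1)[e1 e2 e3].
rewrite !gtr_sl // slV // => tr nc tn.
have [e1' e2'] : ((d1 - a1) ^+ 2 + 4%:R * b1 * c1 = (d - a) ^+ 2 + 4%:R * b * c)%R
    /\ ((d - a) ^+ 2 + 4%:R * b * c != 0)%R.
  have k (u v w z : F) : (u * z - v * w = 1 ->
      (z - u) ^+ 2 + 4%:R * v * w = (u + z) ^+ 2 - 4%:R)%R.
    move=> k; transitivity ((u + z) ^+ 2 - 4%:R * (u * z - v * w))%R; first by ring.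
    by rewrite k mulr1.
  by rewrite (k _ _ _ _ h) (k _ _ _ _ h1) tr subr_eq0.
have e2b : (b * (d1 - a1) = b1 * (d - a))%R.
  by apply: (addrI (a * b1 + a1 * b)%R); transitivity (a * b1 + b * d1)%R; [ring|rewrite e2; ring].
have e3b : (c * (d1 - a1) = c1 * (d - a))%R.
  by apply: (addrI (c * a1 + c1 * a)%R); transitivity (c1 * a + d1 * c)%R; [ring|rewrite -e3; ring].
have [k [kb kc kd]] : exists k, [/\ b1 = k * b, c1 = k * c & d1 - a1 = k * (d - a)]%R.
  have cr (u v w u1 v1 w1 : F) : (u != 0 -> u * v1 = u1 * v -> u * w1 = u1 * w ->
      exists k, [/\ u1 = k * u, v1 = k * v & w1 = k * w])%R.
    move=> u0 k1 k2; exists (u1 / u)%R; split; first by rewrite mulfVK.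
      by apply: (mulfI u0); rewrite k1; field.
    by apply: (mulfI u0); rewrite k2; field.
  case/or3P: (nonc_entries h nc) => nz.
  - have [k [k1 k2 k3]] := cr b c (d - a)%R b1 c1 (d1 - a1)%R nz e1 e2b.
    by exists k.
  - have [k [k1 k2 k3]] := cr c b (d - a)%R c1 b1 (d1 - a1)%R nz
      (etrans (mulrC _ _) (etrans (esym e1) (mulrC _ _))) e3b.
    by exists k.
  have [k [k1 k2 k3]] := cr (d - a)%R b c (d1 - a1)%R b1 c1 nz
    (etrans (mulrC _ _) (etrans (esym e2b) (mulrC _ _)))
    (etrans (mulrC _ _) (etrans (esym e3b) (mulrC _ _))).
  by exists k.
have : (k ^+ 2 == 1)%R.
  rewrite -subr_eq0; apply/eqP; apply: (mulIf e2'); rewrite mul0r.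
  apply/eqP; move/eqP: e1'; rewrite -subr_eq0 kb kc kd => /eqP <-; apply/eqP.
  by ring.
have half (u v : F) : (2%:R * u = 2%:R * v -> u = v)%R by apply: mulfI.
rewrite sqrf_eq1 => /orP[]/eqP ek; [left|right]; rewrite ek in kb kc kd.
  have ea : a1 = a by apply: half; transitivity (a1 + d1 - (d1 - a1))%R; [ring|rewrite kd tr; ring].
  have ed : d1 = d by apply: half; transitivity (a1 + d1 + (d1 - a1))%R; [ring|rewrite kd tr; ring].
  by rewrite ea ed kb kc !mul1r.
have ea : a1 = d by apply: half; transitivity (a1 + d1 - (d1 - a1))%R; [ring|rewrite kd tr; ring].
have ed : d1 = a by apply: half; transitivity (a1 + d1 + (d1 - a1))%R; [ring|rewrite kd tr; ring].
by rewrite ea ed kb kc !mulN1r.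
Qed.

Context (H : {group GL}) (sHS : H \subset SL) (mH : mone \in H).
Context (noU : forall g, g \in H -> (gtr g ^+ 2 = 4%:R)%R -> ~~ nonc g).

Let HS x : x \in H -> x \in SL. Proof. exact: (subsetP sHS). Qed.

Let Hm : [set 1; mone] \subset H. Proof. by rewrite subUset !sub1set group1. Qed.

Lemma cent_eq x y : x \in H -> nonc x -> y \in 'C_H[x] -> nonc y -> 'C_H[y] = 'C_H[x].
Proof.
move=> xH nx /setIP[yH /cent1P cxy] ny; apply/setP=> z; apply/setIP/setIP.
  case=> zH /cent1P cyz; split=> //; apply/cent1P.
  by apply/esym; apply: (comm_trans (HS yH) (HS xH) (HS zH) ny) => //; exact: esym.
case=> zH /cent1P cxz; split=> //; apply/cent1P.
by apply/esym; apply: (comm_trans (HS xH) (HS yH) (HS zH) nx) => //; exact: esym.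
Qed.

Lemma nonc_conj x g : x \in SL -> nonc (x ^ g) = nonc x.
Proof.
move=> xS; rewrite /nonc !inE; congr (~~ (_ || _)); first by rewrite -[RHS](inj_eq (@conjg_inj _ g)) conj1g.
rewrite -[RHS](inj_eq (@conjg_inj _ g)); congr (_ == _).
have [a b c d hh] := glP g; apply/esym/conjg_eq.
have det_m : ((-1) * (-1) - 0 * 0 = 1 :> F)%R by ring.
by rewrite /mone (glM (sl_nz det_m) hh) (glM hh (sl_nz det_m)); congr gl; ring.
Qed.

Definition punc x : {set GL} := 'C_H[x] :\: [set 1; mone].
(** The conjugates of a punctured centralizer. Because commuting is transitive on noncentral
    elements, two such sets are disjoint or equal. *)
Definition sweep x : {set GL} := class_support (punc x) H.

Lemma puncP x y : y \in punc x -> [/\ y \in H, y \in 'C_H[x] & nonc y].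
Proof. by case/setDP=> yC ny; have [yH _] := setIP yC. Qed.

Lemma mem_punc x : x \in H -> nonc x -> x \in punc x.
Proof. by move=> xH nx; apply/setDP; split=> //; apply/setIP; split=> //; apply: cent1id. Qed.

Lemma sub_cent x : x \in H -> [set 1; mone] \subset 'C_H[x].
Proof.
move=> xH; apply/subsetP=> y /set2P[]->; first exact: group1.
by apply/setIP; split=> //; apply/cent1P; apply: mone_comm (HS xH).
Qed.

Lemma mone_neq1 : mone != 1.
Proof.
have det_m : ((-1) * (-1) - 0 * 0 = 1 :> F)%R by ring.
have det_1 : (1 * 1 - 0 * 0 = 1 :> F)%R by ring.
apply/eqP; rewrite gl1 /mone => /(gl_inj (sl_nz det_m) (sl_nz det_1))[e _ _ _].
by move/eqP: n2; apply; rewrite -[2%:R%R]/(1 + 1)%R -{1}e addNr.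
Qed.

Lemma card_punc x : x \in H -> #|punc x| = (#|'C_H[x]| - 2)%N.
Proof.
move=> xH; rewrite cardsD (setIidPr (sub_cent xH)) cards2 eq_sym mone_neq1 //.
Qed.

Lemma cent_conj x g : g \in H -> 'C_H[x ^ g] = 'C_H[x] :^ g.
Proof. by move=> gH; rewrite conjIg conjGid // cent1J. Qed.

Lemma punc_conj x g : x \in H -> g \in H -> punc (x ^ g) = punc x :^ g.
Proof.
move=> xH gH; rewrite /punc cent_conj //; apply/setP=> y.
rewrite -[y](conjgKV g) memJ_conjg !in_setD memJ_conjg; congr (_ && _).
have [yC|yC] := boolP (y ^ g^-1 \in SL).
  exact: (nonc_conj g yC).
apply: congr1; apply/idP/idP => /set2P[]e; case/negP: yC.
- by rewrite -[y ^ _](conjgK g) e conj1g (group1 (SL_group F)).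
- rewrite -(memJ_norm _ (SL_conj g)) e; exact: mone_SL.
- by rewrite e (group1 (SL_group F)).
by rewrite e mone_SL.
Qed.

Lemma sweep_meet x y : x \in H -> y \in H -> nonc x -> nonc y ->
  ~~ [disjoint sweep x & sweep y] -> y \in sweep x.
Proof.
move=> xH yH nx ny /pred0Pn[z /andP[/imset2P[u g uP gH ->] /imset2P[v k vP kH e]]].
have [uH uC nu] := puncP uP; have [vH vC nv] := puncP vP.
have eC : 'C_H[y] :^ k = 'C_H[x] :^ g.
  rewrite -(cent_eq xH nx uC nu) -(cent_eq yH ny vC nv) -!cent_conj //.
  by rewrite /= in e; rewrite e.
have : y ^ k \in 'C_H[x] :^ g.
  by rewrite -eC memJ_conjg; apply/setIP; split=> //; apply: cent1id.
case/imsetP=> w wC ew; apply/imset2P; exists w (g * k^-1).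
- apply/setDP; split=> //; have [wH _] := setIP wC.
  by rewrite -[_ \notin _](nonc_conj g (HS wH)) -ew nonc_conj // HS.
- by rewrite groupM ?groupV.
by rewrite conjgM -ew conjgK.
Qed.

Lemma punc_normedTI x : x \in H -> nonc x -> normedTI (punc x) H 'N_H(punc x).
Proof.
move=> xH nx; apply/normedTI_P; split; first by apply/set0Pn; exists x; apply: mem_punc.
  by [].
move=> g gH /pred0Pn[z /andP[/= zP]]; have [zH zC nz] := puncP zP.
case/imsetP=> w wP ez; have [wH wC nw] := puncP wP.
have e1 := cent_eq xH nx zC nz; have e2 := cent_eq xH nx wC nw.
apply/setIP; split=> //; apply/normP; rewrite -punc_conj // /punc; congr (_ :\: _).
by rewrite -e1 ez !cent_conj // e2.
Qed.

Lemma norm_punc x : x \in H -> nonc x -> 'C_H[x] \subset 'N_H(punc x).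
Proof.
move=> xH nx; apply/subsetP=> g gC; have [gH cg] := setIP gC.
apply/setIP; split=> //; apply/normP; rewrite -punc_conj //.
by congr punc; apply/conjg_fixP/commgP/esym/cent1P.
Qed.

(** The conjugate commutes with [x] and has the same trace, which by [noU] is neither 2 nor -2, so
    [same_trace_comm] applies. *)
Lemma norm_invert x g : x \in H -> nonc x -> g \in 'N_H(punc x) ->
  x ^ g = x \/ x ^ g = x^-1.
Proof.
move=> xH nx /setIP[gH gN]; have xP := mem_punc xH nx.
have : x ^ g \in punc x by rewrite memJ_norm.
case/puncP=> xgH /setIP[_ /cent1P cx] _.
apply: (same_trace_comm (HS xH) (HS xgH) (esym cx)) => //; first exact: gtrJ.
by apply/eqP=> /(noU xH); rewrite nx.
Qed.

Lemma card_norm x : x \in H -> nonc x ->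
  #|'N_H(punc x)| = #|'C_H[x]| \/ #|'N_H(punc x)| = (2 * #|'C_H[x]|)%N.
Proof.
move=> xH nx; have sC := norm_punc xH nx.
case: (pickP [pred g in 'N_H(punc x) | g \notin 'C_H[x]]) => [g /andP[gN gC]|no]; last first.
  left; apply/eqP; rewrite eqn_leq (subset_leq_card sC) andbT; apply: subset_leq_card.
  by apply/subsetP=> g gN; have /negbT := no g; rewrite /= gN /= negbK.
right; have fixC k : k \in 'N_H(punc x) -> x ^ k = x -> k \in 'C_H[x].
  move=> /setIP[kH _] e; apply/setIP; split=> //; apply/cent1P.
  by apply/esym/commgP/conjg_fixP.
have xg : x ^ g = x^-1.
  by case: (norm_invert xH nx gN) => // e; rewrite (fixC g gN e) in gC.
have eN : 'N_H(punc x) = 'C_H[x] :|: 'C_H[x] :* g.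
  apply/setP=> k; rewrite in_setU; apply/idP/orP => [kN|[kC|]].
  - case: (norm_invert xH nx kN) => e; first by left; apply: fixC.
    right; rewrite mem_rcoset; apply: fixC; first by rewrite groupM ?groupV.
    by rewrite conjgM e -xg conjgK.
  - exact: (subsetP sC).
  by case/rcosetP=> y yC ->; rewrite groupM // (subsetP sC).
have dj : 'C_H[x] :&: 'C_H[x] :* g = set0.
  apply/setP=> k; rewrite in_set0; apply/negP => /setIP[kC].
  rewrite mem_rcoset => kg; case/negP: gC.
  by rewrite -groupV -(groupMl _ kC).
by rewrite eN cardsU dj cards0 subn0 card_rcoset mul2n addnn.
Qed.

Lemma card_norm2 x g : x \in H -> nonc x -> g \in H -> x ^ g = x^-1 -> x^-1 != x ->
  #|'N_H(punc x)| = (2 * #|'C_H[x]|)%N.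
Proof.
move=> xH nx gH xg xV; case: (card_norm xH nx) => // e.
have gN : g \in 'N_H(punc x).
  apply/setIP; split=> //; apply/normP; rewrite -punc_conj // xg /punc.
  by congr (_ :\: _); congr (_ :&: _); rewrite -!cent_cycle cycleV.
have : g \in 'C_H[x].
  suff -> : 'C_H[x] = 'N_H(punc x) by [].
  by apply/eqP; rewrite eqEcard norm_punc //= e.
case/setIP=> _ /cent1P cg; case/eqP: xV; rewrite -xg.
by apply/conjg_fixP/commgP/esym.
Qed.

Lemma card_sweep x : x \in H -> nonc x ->
  (#|sweep x| * #|'N_H(punc x)| = (#|'C_H[x]| - 2) * #|H|)%N.
Proof.
move=> xH nx; rewrite (card_support_normedTI (punc_normedTI xH nx)) card_punc //.
by rewrite -mulnA [(#|H : _| * _)%N]mulnC Lagrange ?subsetIl.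
Qed.

Lemma card_cent_even x : x \in H -> 2 %| #|'C_H[x]|.
Proof.
move=> xH; have mC : mone \in 'C_H[x] by apply: (subsetP (sub_cent xH)); rewrite set22.
have <- : #[mone] = 2.
  apply/eqP; rewrite eqn_leq order_gt1 mone_neq1 andbT.
  by apply: dvdn_leq => //; rewrite order_dvdn expgS expg1 moneK.
by apply: order_dvdG mC.
Qed.

Lemma sweep_sub x : sweep x \subset H :\: [set 1; mone].
Proof.
apply/subsetP=> _ /imset2P[u g /puncP[uH _ nu] gH ->].
by apply/setDP; split; [rewrite groupJ | have := nonc_conj g (HS uH); rewrite nu].
Qed.

Lemma sweep_card_cent x y : x \in H -> nonc x -> y \in sweep x -> #|'C_H[y]| = #|'C_H[x]|.
Proof.
move=> xH nx /imset2P[u g /puncP[uH uC nu] gH ->].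
by rewrite cent_conj // cardJg (cent_eq xH nx uC nu).
Qed.

(** By [sweep_meet] the condition on pairs makes the sweeps pairwise disjoint, so that their sizes
    add up. *)
Definition spread (s : seq GL) : bool :=
  all (fun x => (x \in H) && nonc x) s && pairwise (fun x y => y \notin sweep x) s.

Lemma spread_card s : spread s ->
  #|\bigcup_(x <- s) sweep x| = (\sum_(x <- s) #|sweep x|)%N.
Proof.
elim: s => [|x s IH]; first by rewrite !big_nil cards0.
rewrite /spread /= => /andP[/andP[/andP[xH nx] sH] /andP[xs ps]].
rewrite !big_cons cardsU IH ?/spread ?sH ?ps //.
suff -> : sweep x :&: \bigcup_(z <- s) sweep z = set0 by rewrite cards0 subn0.
apply/eqP/set0Pn => -[k /setIP[kx]]; rewrite bigcup_seq => /bigcupP[z zs kz].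
have /andP[zH nz] := allP sH z zs; case/negP: (allP xs z zs).
by apply: sweep_meet => //; apply/pred0Pn; exists k; rewrite /= kx kz.
Qed.

Lemma spread_le s : spread s -> (\sum_(x <- s) #|sweep x| <= #|H| - 2)%N.
Proof.
move=> sp; rewrite -spread_card //.
have -> : (#|H| - 2)%N = #|H :\: [set 1; mone]|.
  by rewrite cardsD (setIidPr Hm) cards2 eq_sym mone_neq1.
by apply: subset_leq_card; rewrite bigcup_seq; apply/bigcupsP=> x _; apply: sweep_sub.
Qed.

Lemma spread_extend s : spread s -> (\sum_(x <- s) #|sweep x| < #|H| - 2)%N ->
  exists z, spread (rcons s z).
Proof.
move=> sp; rewrite -spread_card //.
have -> : (#|H| - 2)%N = #|H :\: [set 1; mone]|.
  by rewrite cardsD (setIidPr Hm) cards2 eq_sym mone_neq1.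
move=> lt; case: (pickP [pred z in H :\: [set 1; mone] | z \notin \bigcup_(x <- s) sweep x]).
  move=> z /andP[/setDP[zH nz] zn]; exists z; rewrite -/(nonc z) in nz; case/andP: sp => sH ps.
  rewrite /spread all_rcons sH andbT zH nz /= pairwise_rcons ps andbT.
  apply/allP=> x xs; apply: contra zn; rewrite bigcup_seq => zx.
  by apply/bigcupP; exists x.
move=> no; move: lt; rewrite ltnNge => /negP[]; apply: subset_leq_card.
by apply/subsetP=> z zD; have /negbT := no z; rewrite /= zD negbK.
Qed.

Local Open Scope ring_scope.
Context (R : realFieldType).
(** Dividing by |H| turns the counting into a rational class equation: a sweep has density 1 -
    2/|C|, or 1/2 - 1/|C| when [x] is inverted in [H], and disjoint sweeps can be added until they
    fill 1 - 2/|H|. The case analyses become linear arithmetic. *)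
Definition invH : R := #|H|%:R^-1.
Definition invC x : R := #|'C_H[x]|%:R^-1.
Definition weight x : R := #|sweep x|%:R / #|H|%:R.

Let H_gt0 : 0 < #|H|%:R :> R. Proof. by rewrite ltr0n cardG_gt0. Qed.
Let Y_gt0 : 0 < invH. Proof. by rewrite invr_gt0. Qed.

Lemma inv_le m n : (0 < m)%N -> (m <= n)%N -> n%:R^-1 <= m%:R^-1 :> R.
Proof. by move=> m0 mn; rewrite lef_pV2 ?posrE ?ltr0n ?ler_nat // (leq_trans m0). Qed.

Lemma weight_cases x : x \in H -> nonc x ->
  (weight x = 1 - 2%:R * invC x /\ invH <= invC x) \/ (weight x = 2%:R^-1 - invC x /\ 2%:R * invH <= invC x).
Proof.
move=> xH nx; have e := card_sweep xH nx.
have C2 : (2 <= #|'C_H[x]|)%N by apply: dvdn_leq (card_cent_even xH); exact: cardG_gt0.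
have c0 : #|'C_H[x]|%:R != 0 :> R by rewrite pnatr_eq0 -lt0n cardG_gt0.
have h0 : #|H|%:R != 0 :> R by rewrite lt0r_neq0.
have le : (#|'N_H(punc x)| <= #|H|)%N by apply: subset_leq_card; apply: subsetIl.
case: (card_norm xH nx) => eN; rewrite eN in e le; [left|right]; split.
- have : (#|sweep x|%:R * #|'C_H[x]|%:R = (#|'C_H[x]|%:R - 2%:R) * #|H|%:R :> R).
    by rewrite -natrB // -!natrM e.
  move=> e'; rewrite /weight /invC; apply: (mulIf c0); apply: (mulIf h0).
  by transitivity (#|sweep x|%:R * #|'C_H[x]|%:R : R); [field|rewrite e'; field].
- by apply: inv_le => //; apply: cardG_gt0.
- have : (#|sweep x|%:R * (2%:R * #|'C_H[x]|%:R) = (#|'C_H[x]|%:R - 2%:R) * #|H|%:R :> R).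
    by rewrite -natrB // -!natrM e.
  move=> e'; rewrite /weight /invC; apply: (mulIf c0); apply: (mulIf h0).
  have t0 : 2%:R != 0 :> R by rewrite pnatr_eq0.
  apply: (mulIf t0).
  by transitivity (#|sweep x|%:R * (2%:R * #|'C_H[x]|%:R) : R); [field|rewrite e'; field].
have -> : invC x = 2%:R * (2 * #|'C_H[x]|)%:R^-1 by rewrite natrM invfM mulrA divff ?mul1r ?pnatr_eq0.
by rewrite ler_pM2l //; apply: inv_le => //; rewrite muln_gt0 cardG_gt0.
Qed.

(** The centralizer has even order because it contains [mone], and more than two elements because it
    contains [x]. *)
Lemma X_cases x : x \in H -> nonc x -> invC x = 4%:R^-1 \/ invC x <= 6%:R^-1.
Proof.
move=> xH nx; have ev := card_cent_even xH.
have C2 : (2 < #|'C_H[x]|)%N.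
  have := card_punc xH; rewrite (cardsD1 x) mem_punc //; lia.
have [e|ne] := eqVneq #|'C_H[x]| 4; first by left; rewrite /invC e.
right; apply: inv_le => //; lia.
Qed.

Lemma X_dvd x m : (0 < m)%N -> (m %| #|'C_H[x]|)%N -> invC x <= m%:R^-1.
Proof. by move=> m0 dv; apply: inv_le => //; apply: dvdn_leq => //; apply: cardG_gt0. Qed.

Lemma weight_sum s : \sum_(x <- s) weight x = (\sum_(x <- s) #|sweep x|)%N%:R / #|H|%:R.
Proof. by rewrite natr_sum mulr_suml. Qed.

Lemma H_ge2 : (2 <= #|H|)%N.
Proof. by apply: leq_trans (subset_leq_card Hm); rewrite cards2 eq_sym mone_neq1. Qed.

Let bound_eq : 1 - 2%:R * invH = (#|H| - 2)%N%:R / #|H|%:R.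
Proof. by rewrite natrB ?H_ge2 // /invH; field; apply: lt0r_neq0. Qed.

Lemma weight_le s : spread s -> \sum_(x <- s) weight x <= 1 - 2%:R * invH.
Proof.
by move=> sp; rewrite weight_sum bound_eq ler_pM2r ?invr_gt0 // ler_nat spread_le.
Qed.

Lemma weight_extend s : spread s -> \sum_(x <- s) weight x < 1 - 2%:R * invH ->
  exists z, spread (rcons s z).
Proof.
move=> sp; rewrite weight_sum bound_eq ltr_pM2r ?invr_gt0 // ltr_nat.
exact: spread_extend.
Qed.

Lemma weight_rcons s z : \sum_(x <- rcons s z) weight x = \sum_(x <- s) weight x + weight z.
Proof. by rewrite big_rcons /= addrC. Qed.

Lemma spread_last s z : spread (rcons s z) -> z \in H /\ nonc z.
Proof. by rewrite /spread all_rcons => /andP[/andP[/andP[]]]. Qed.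

Lemma weight_invert x g : x \in H -> nonc x -> g \in H -> (x ^ g = x^-1)%g -> (x^-1 != x)%g ->
  weight x = 2%:R^-1 - invC x /\ 2%:R * invH <= invC x.
Proof.
move=> xH nx gH xg xV; case: (weight_cases xH nx) => // -[_ _].
have eN := card_norm2 xH nx gH xg xV.
have c0 : #|'C_H[x]|%:R != 0 :> R by rewrite pnatr_eq0 -lt0n cardG_gt0.
have h0 : #|H|%:R != 0 :> R by rewrite lt0r_neq0.
have C2 : (2 <= #|'C_H[x]|)%N by apply: dvdn_leq (card_cent_even xH); exact: cardG_gt0.
have e := card_sweep xH nx; rewrite eN in e; split.
  have : (#|sweep x|%:R * (2%:R * #|'C_H[x]|%:R) = (#|'C_H[x]|%:R - 2%:R) * #|H|%:R :> R).
    by rewrite -natrB // -!natrM e.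
  move=> e'; rewrite /weight /invC; apply: (mulIf c0); apply: (mulIf h0).
  have t0 : 2%:R != 0 :> R by rewrite pnatr_eq0.
  apply: (mulIf t0).
  by transitivity (#|sweep x|%:R * (2%:R * #|'C_H[x]|%:R) : R); [field|rewrite e'; field].
have -> : invC x = 2%:R * (2 * #|'C_H[x]|)%:R^-1 by rewrite natrM invfM mulrA divff ?mul1r ?pnatr_eq0.
rewrite ler_pM2l //; apply: inv_le; first by rewrite muln_gt0 cardG_gt0.
by rewrite -eN; apply: subset_leq_card; apply: subsetIl.
Qed.

(** If the centralizer did not have index 2, more sweeps would be needed, each of density at least
    1/4. With 1/|C| at most 1/30 the only room is for one of density 1/2 or two of density 1/4;
    these leave a positive gap, too small for yet another sweep. *)
Lemma half_index y : y \in H -> nonc y -> invC y <= 30%:R^-1 ->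
  weight y = 2%:R^-1 - invC y -> 2%:R * invH <= invC y -> invC y = 2%:R * invH.
Proof.
move=> yH ny Xy wy Yy; apply/eqP; rewrite eq_le Yy andbT leNgt; apply/negP=> lt.
have Yp := Y_gt0.
have spy : spread [:: y] by rewrite /spread /= yH ny.
have wpos z : z \in H -> nonc z -> 4%:R^-1 <= weight z.
  move=> zH nz; case: (weight_cases zH nz) => -[-> _]; case: (X_cases zH nz) => hX; lra.
have [x2 sp2] : exists z, spread (rcons [:: y] z).
  by apply: weight_extend => //; rewrite big_seq1 wy; lra.
have [x2H nx2] := spread_last sp2; have := weight_le sp2.
rewrite weight_rcons big_seq1 wy => le2.
case: (weight_cases x2H nx2) => -[w2 Y2].
  case: (X_cases x2H nx2) => X2; rewrite w2 in le2; last by lra.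
  have [x3 sp3] : exists z, spread (rcons (rcons [:: y] x2) z).
    by apply: weight_extend => //; rewrite weight_rcons big_seq1 wy w2; lra.
  have [x3H nx3] := spread_last sp3; have := weight_le sp3.
  by rewrite !weight_rcons big_seq1 wy w2; have := wpos _ x3H nx3; lra.
have [x3 sp3] : exists z, spread (rcons (rcons [:: y] x2) z).
  by apply: weight_extend => //; rewrite weight_rcons big_seq1 wy w2; lra.
have [x3H nx3] := spread_last sp3; have := weight_le sp3.
rewrite !weight_rcons big_seq1 wy w2 => le3.
case: (weight_cases x3H nx3) => -[w3 Y3]; rewrite w3 in le3;
  case: (X_cases x2H nx2) => X2; case: (X_cases x3H nx3) => X3; try lra.
have [x4 sp4] : exists z, spread (rcons (rcons (rcons [:: y] x2) x3) z).
  by apply: weight_extend => //; rewrite !weight_rcons big_seq1 wy w2 w3; lra.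
have [x4H nx4] := spread_last sp4; have := weight_le sp4.
by rewrite !weight_rcons big_seq1 wy w2 w3; have := wpos _ x4H nx4; lra.
Qed.

Local Close Scope ring_scope.

(* The class equation of H / {1, mone}, whose punctured centralizers are TI
   sets, leaves no room for a larger centralizer of a. *)
Lemma cent_card6 y a g :
    y \in H -> a \in H -> g \in H -> nonc y -> nonc a ->
    10 %| #|'C_H[y]| -> 6 %| #|'C_H[a]| ->
    y ^ g = y^-1 -> y^-1 != y -> a ^ g = a^-1 -> a^-1 != a ->
    a ^+ 3 = mone -> a * y != y * a ->
  #|'C_H[a]| = 6.
Proof.
move=> yH aH gH ny na y10 a6 yg yV ag aV a3 ay.
have [wy Yy] := weight_invert yH ny gH yg yV.
have [wa Ya] := weight_invert aH na gH ag aV.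
have X10 := X_dvd (isT : 0 < 10) y10.
(* If [a] lies in the sweep of [y], the common order of the centralizers is divisible by 30, so that
   of [y] has index 2 by [half_index]. Then [a * a] commutes with [y], and since [a ^+ 3] is central
   so does [a]. *)
have [asw|asw] := boolP (a \in sweep y).
  have eC := sweep_card_cent yH ny asw.
  have y30 : 30 %| #|'C_H[y]|.
    rewrite (@Gauss_dvd 10 3) // y10 -eC.
    by apply: dvdn_trans a6.
  have X30 := X_dvd (isT : 0 < 30) y30.
  have eX := half_index yH ny X30 wy Yy.
  have eH : #|H| = (2 * #|'C_H[y]|)%N.
    apply/eqP; rewrite -(eqr_nat R) natrM.
    have c0 : (#|'C_H[y]|%:R != 0 :> R)%R by rewrite pnatr_eq0 -lt0n cardG_gt0.
    have h0 : (#|H|%:R != 0 :> R)%R by rewrite lt0r_neq0.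
    apply/eqP; apply: (mulIf (invr_neq0 c0)); rewrite mulfK // -/(invC y) eX /invH.
    by field.
  have aC : a \notin 'C_H[y].
    apply: contra ay => /setIP[_ /cent1P e]; exact/eqP.
  have dj : 'C_H[y] :&: 'C_H[y] :* a = set0.
    apply/setP=> k; rewrite in_set0; apply/negP => /setIP[kC].
    rewrite mem_rcoset => kg; case/negP: aC.
    by rewrite -groupV -(groupMl _ kC).
  have eU : H :=: 'C_H[y] :|: 'C_H[y] :* a.
    apply/esym/eqP; rewrite eqEcard subUset subsetIl /= cardsU dj cards0 subn0 card_rcoset.
    rewrite eH mul2n addnn leqnn andbT; apply/subsetP=> k /rcosetP[u /setIP[uH _] ->].
    by rewrite groupM.
  have : a * a \in H by rewrite groupM.
  rewrite eU => /setUP[aaC|]; last first.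
    by rewrite mem_rcoset mulgK (negbTE aC).
  case/negP: aC; rewrite -(groupMl _ aaC); have -> : a * a * a = mone.
    by rewrite -a3 !expgS expg0 mulg1 mulgA.
  by apply: (subsetP (sub_cent yH)); rewrite set22.
have X6 := X_dvd (isT : 0 < 6) a6.
have sp2 : spread [:: y; a] by rewrite /spread /= yH ny aH na asw.
have [x3 sp3] : exists z, spread (rcons [:: y; a] z).
  by apply: weight_extend => //; rewrite !big_cons big_nil wy wa; have Yp := Y_gt0; lra.
have [x3H nx3] := spread_last sp3; have := weight_le sp3.
rewrite weight_rcons !big_cons big_nil wy wa => le3.
(* In the surviving case 1/|C(y)| + 1/|C(a)| + 1/|C(x3)| exceeds 1/2. The first and last terms are
   at most 1/10 and 1/4, so the middle one exceeds 3/20, and 6 is the only multiple of 6 that allows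
   this. *)
have X6' : (12%:R^-1 < invC a)%R.
  case: (weight_cases x3H nx3) => -[w3 Y3]; rewrite w3 in le3;
  case: (X_cases x3H nx3) => X3; have Yp := Y_gt0; lra.
case/dvdnP: a6 => -[|[|k]] ek.
- by have := cardG_gt0 'C_H[a]; rewrite ek.
- by rewrite ek.
have : (invC a <= 12%:R^-1)%R by rewrite /invC ek; apply: (@inv_le 12) => //; rewrite (@leq_mul2r 6 2).
by rewrite leNgt X6'.
Qed.

End Centralizers.

(** * Traces and orders *)

Section Powers.
Context (F : finFieldType).
Local Notation GL := (GL2 F).
Local Notation SL := (SL F).
Local Notation mone := (mone F).
Implicit Types (t : F) (g u : GL).

(* Cayley-Hamilton: [g ^+ n = u g + v] with [(u, v) = ch_coef (gtr g) n]. *)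
Fixpoint ch_coef t n : F * F :=
  if n is k.+1 then ((ch_coef t k).1 * t + (ch_coef t k).2, - (ch_coef t k).1)%R
  else (0, 1)%R.

Lemma mx2D (a b c d a' b' c' d' : F) :
  (mx2 a b c d + mx2 a' b' c' d' = mx2 (a + a') (b + b') (c + c') (d + d'))%R.
Proof. by apply/matrixP=> i j; rewrite !mxE; case: ifP => _; case: ifP. Qed.

Lemma SL_expg g n : g \in SL ->
  GLval (g ^+ n) =
    ((ch_coef (gtr g) n).1 *: GLval g + ((ch_coef (gtr g) n).2 *: 1%:M))%R.
Proof.
case/slP=> a b c d h; rewrite gtr_sl //; elim: n => [|n IHn].
  by rewrite scale0r add0r scale1r.
rewrite expgS GLvalM IHn gl_val ?(sl_nz h) //.
set u := (ch_coef _ n).1; set v := (ch_coef _ n).2.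
have -> : (ch_coef (a + d) n.+1 = (u * (a + d) + v, - u))%R by [].
rewrite /= mx2_1 !mx2Z !mx2D mx2M.
have e : (b * c = a * d - 1)%R by rewrite -h; ring.
congr mx2.
- by transitivity (u * a ^+ 2 + v * a + u * (b * c))%R; [ring|rewrite e; ring].
- by ring.
- by ring.
by transitivity (u * d ^+ 2 + v * d + u * (b * c))%R; [ring|rewrite e; ring].
Qed.

Lemma GLval_mone : GLval mone = ((-1) *: 1%:M)%R.
Proof.
by rewrite mx2_1 mx2Z mulr1 mulr0 /mone gl_val // mulr0 subr0 mulrNN mulr1 oner_eq0.
Qed.

Lemma SL_expg_mone g n : g \in SL -> (ch_coef (gtr g) n = (0, -1))%R -> g ^+ n = mone.
Proof.
by move=> gS e; apply: GLval_inj; rewrite SL_expg // e scale0r add0r GLval_mone.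
Qed.

Lemma SL_expg1 g n : g \in SL -> (ch_coef (gtr g) n = (0, 1))%R -> g ^+ n = 1.
Proof.
by move=> gS e; apply: GLval_inj; rewrite SL_expg // e scale0r add0r scale1r.
Qed.

Lemma gtr0_sqr g : g \in SL -> gtr g = 0%R -> g ^+ 2 = mone.
Proof. by move=> gS e; apply: SL_expg_mone => //; rewrite e /=; congr pair; ring. Qed.

Lemma gtr1_cube g : g \in SL -> gtr g = 1%R -> g ^+ 3 = mone.
Proof. by move=> gS e; apply: SL_expg_mone => //; rewrite e /=; congr pair; ring. Qed.

Lemma gtrN1_cube g : g \in SL -> gtr g = (-1)%R -> g ^+ 3 = 1.
Proof. by move=> gS e; apply: SL_expg1 => //; rewrite e /=; congr pair; ring. Qed.

Lemma gtr_golden g : g \in SL -> (gtr g ^+ 2 = gtr g + 1)%R -> g ^+ 5 = mone.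
Proof.
move=> gS; set t := gtr g => e; apply: SL_expg_mone => //; rewrite -/t /=; congr pair.
  transitivity ((t ^+ 2) ^+ 2 - 3%:R * t ^+ 2 + 1)%R; first by ring.
  rewrite e; transitivity (t ^+ 2 - t - 1)%R; first by ring.
  by rewrite e; ring.
transitivity (- (t * t ^+ 2 - 2%:R * t))%R; first by ring.
by rewrite e; transitivity (- (t ^+ 2 - t))%R; [ring|rewrite e; ring].
Qed.

Lemma gtr2_expg g n : g \in SL -> gtr g = 2%:R%R ->
  GLval (g ^+ n) = (n%:R *: GLval g + (1 - n%:R) *: 1%:M)%R.
Proof.
move=> gS e; rewrite SL_expg // e.
suff -> : (ch_coef 2%:R n = (n%:R, 1 - n%:R))%R by [].
elim: n => [|n IHn] /=; first by rewrite subr0.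
by rewrite IHn /= -natr1; congr pair; ring.
Qed.

Lemma gtr_1 : gtr (1 : GL) = 2%:R%R. Proof. by rewrite /gtr mxtrace1. Qed.

Lemma gtr_monE : gtr mone = (- 2%:R)%R.
Proof. by rewrite -[mone]mulg1 gtr_mone ?gtr_1 // (group1 (SL_group F)). Qed.

Lemma nonc_tr g : (gtr g ^+ 2 != 4%:R)%R -> nonc g.
Proof.
by apply: contraNN => /set2P[]->; rewrite ?gtr_1 ?gtr_monE; apply/eqP; ring.
Qed.

Lemma gtrV g : g \in SL -> gtr g^-1 = gtr g.
Proof.
case/slP=> a b c d h; have h' : (d * a - - b * - c = 1)%R by rewrite -h; ring.
by rewrite slV // !gtr_sl // addrC.
Qed.

Context (p : nat) (pF : p \in [pchar F]%R) (n2 : (2%:R != 0 :> F)%R).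

Lemma mone_order g q : g \in SL -> odd q -> g ^+ q = mone -> nonc g -> g ^+ 2 != 1.
Proof.
move=> gS q_odd gq; apply: contra => /eqP g2; rewrite !inE -gq.
rewrite -[X in g ^+ X]odd_double_half q_odd expgD -mul2n expgM g2 expg1n mulg1 eqxx.
by rewrite orbT.
Qed.

(** The order divides 2q, as the square of -1 is 1; it does not divide q, because [g ^+ q] is -1,
    nor 2, by [mone_order]. *)
Lemma order_mone g q : g \in SL -> prime q -> odd q -> g ^+ q = mone -> nonc g ->
  #[g] = (2 * q)%N.
Proof.
move=> gS q_pr q_odd gq ng; have g2 := mone_order gS q_odd gq ng.
have m1 := mone_neq1 n2.
have dv : #[g] %| 2 * q by rewrite order_dvdn mulnC expgM gq expgS expg1 moneK.
have nq : ~~ (#[g] %| q) by rewrite order_dvdn gq.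
have n2' : ~~ (#[g] %| 2) by rewrite order_dvdn.
have qg : q %| #[g].
  rewrite -[q %| _]negbK -prime_coprime //; apply: contra n2' => cop.
  by move: dv; rewrite Gauss_dvdl // coprime_sym.
case/dvdnP: qg => k ek; move: dv; rewrite ek dvdn_pmul2r ?prime_gt0 //.
move: nq; rewrite ek; case: k {ek} => [|[|[|k]]] //; first by rewrite mul1n dvdnn.
Qed.

Lemma unipotent_order g : g \in SL -> gtr g = 2%:R%R -> g != 1 -> #[g] = p.
Proof.
move=> gS e g1; have p_pr := pcharf_prime pF.
apply: nt_prime_order => //; apply: GLval_inj.
by rewrite gtr2_expg // (pcharf0 pF) scale0r add0r subr0 scale1r.
Qed.

(** Up to sign [g] is a nontrivial unipotent matrix, which has order [p]. *)
Lemma trace4_order (H : {group GL}) g :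
  H \subset SL -> mone \in H -> g \in H -> (gtr g ^+ 2 = 4%:R)%R -> nonc g -> p %| #|H|.
Proof.
move=> sHS mH gH e ng; have gS := subsetP sHS g gH.
have : (gtr g ^+ 2 == 2%:R ^+ 2)%R by rewrite e; apply/eqP; ring.
rewrite eqf_sqr => /orP[]/eqP tg.
  have g1 : g != 1 by apply: contraNneq ng => ->; rewrite set21.
  by rewrite -(unipotent_order gS tg g1) order_dvdG.
have mgH : mone * g \in H by rewrite groupM.
have m1 : mone * g != 1.
  apply: contraNneq ng => /(canRL (mulKg mone)); rewrite mulg1 => ->.
  by rewrite !inE [_ == mone]eq_invg_mul moneK eqxx orbT.
rewrite -(unipotent_order (subsetP sHS _ mgH) _ m1) ?order_dvdG //.
by rewrite gtr_mone // tg opprK.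
Qed.

(* With [N = u - 1] nilpotent, [tr (u * u ^ g) = 2 - tr (g N) ^+ 2]. *)
Lemma comm_conj_tr u g : u \in SL -> u ^+ p = 1 -> g \in SL ->
  u * u ^ g = u ^ g * u -> gtr (g * u) = gtr g.
Proof.
move=> uS up gS cug; have ugS : u ^ g \in SL by rewrite memJ_norm // SL_conj.
have e2 : gtr (u * u ^ g) = 2%:R%R.
  apply: (p_elt_tr pF); first exact: (groupM (uS : u \in SL_group F)).
  by rewrite expgMn // up mul1g -conjXg up conj1g.
have t2 := p_elt_tr pF uS up; move: e2 t2; rewrite conjgE.
case/slP: uS => a b c d h; case/slP: gS => a' b' c' d' h'; rewrite slV //.
rewrite gtr_sl // /gtr !GLvalM !gl_val ?(sl_nz h) ?(sl_nz h') //; last first.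
  by rewrite mulrNN mulrC [(b' * c')%R]mulrC (_ : (_ - _ = 1)%R) ?oner_neq0 // -h'; ring.
rewrite !mx2M !mx2_tr => e2 t2; have ed : d = (2%:R - a)%R by rewrite -t2; ring.
apply/eqP; rewrite -subr_eq0 -sqrf_eq0; apply/eqP.
have k1 : (a * (2%:R - a) - b * c - 1 = 0)%R by rewrite -ed h subrr.
have k2 : (a' * d' - b' * c' - 1 = 0)%R by rewrite h' subrr.
move: e2; rewrite ed => /eqP; rewrite -subr_eq0 => /eqP e2.
set T := (X in (X = 0)%R) in e2.
transitivity (- T - (a' ^+ 2 + 2 * b' * c' + d' ^+ 2) * (a * (2%:R - a) - b * c - 1) - (- (2)) * (a' * d' - b' * c' - 1))%R.
  by rewrite /T; ring.
by rewrite e2 k1 k2 !mulr0 !subr0 oppr0.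
Qed.

Lemma unipotent_conj_gen (H : {group GL}) u g :
    (forall s t : F, (s != 0)%R -> exists n, t = (s *+ n)%R) ->
    H \subset SL -> u \in H -> g \in H -> u ^+ p = 1 -> gtr (g * u) != gtr g ->
  SL \subset H.
Proof.
move=> F_cyc sHS uH gH up ne; have uS := subsetP sHS _ uH; have gS := subsetP sHS _ gH.
have ugS : u ^ g \in SL by rewrite memJ_norm // SL_conj.
have tu := p_elt_tr pF uS up.
apply: (@unipotents_gen _ F_cyc H u (u ^ g)) => //; rewrite ?gtrJ ?groupJ //.
by move/(comm_conj_tr uS up gS)/eqP; rewrite (negbTE ne).
Qed.

End Powers.

(** * The generators *)

Section Generators.
Context (F : finFieldType) (phi s m n : F).
Local Notation GL := (GL2 F).
Local Notation SL := (SL F).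
Local Notation mone := (mone F).
Context (phiE : (phi ^+ 2 = phi + 1)%R) (sE : (s ^+ 2 = s + 1 - phi)%R).
Context (mnE : (m ^+ 2 - m * n + n ^+ 2 + phi * n + 1 = 0)%R).

(* The cofactors below come from reducing modulo this Groebner basis. *)
Lemma ideal_eq (k1 k2 k3 x y : F) :
    (x = y + k1 * (phi ^+ 2 - phi - 1) + k2 * (s ^+ 2 - s - 1 + phi)
      + k3 * (m ^+ 2 - m * n + n ^+ 2 + phi * n + 1))%R ->
  x = y.
Proof.
have e1 : (phi ^+ 2 - phi - 1 = 0)%R by rewrite phiE; ring.
have e2 : (s ^+ 2 - s - 1 + phi = 0)%R by rewrite sE; ring.
by move=> ->; rewrite e1 e2 mnE !mulr0 !addr0.
Qed.

Lemma sl_nzV (x1 x2 x3 x4 : F) :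
  (x1 * x4 - x2 * x3 = 1 -> x4 * x1 - - x2 * - x3 != 0)%R.
Proof. by move=> h; apply: sl_nz; rewrite -h; ring. Qed.

(** Orders modulo sign are encoded by traces: 1 for [gen_a] and -1 for [gen_b^-1 * gen_c] (order 3),
    [phi] for [gen_y] (order 5), and 0 for [gen_b], [gen_c] and [gen_a^-1 * gen_c] (order 2). *)
Definition gen_a : GL := gl 0 (-1) 1 1.
Definition gen_b : GL := gl m n (phi + n - m) (- m).
Definition gen_c : GL := gl (phi * s * m - 2 * phi * s * n - 2 * phi * s - 2 * phi * m + phi * n + s * m - 2 * s * n - s - 2 * m + n) (2 * phi * s * m - phi * s * n - phi * m - phi * n - 2 * phi + 2 * s * m - s * n - m - n - 1) (phi * s * m + phi * s * n + 2 * phi * s + phi * m - 2 * phi * n - 2 * phi + s * m + s * n + s + m - 2 * n - 1) (- (phi * s * m) + 2 * phi * s * n + 2 * phi * s + 2 * phi * m - phi * n - s * m + 2 * s * n + s + 2 * m - n).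
Definition gen_y : GL := gl (phi + n) (- (m) + n) (- (m)) (- (n)).
(* The normalized commutator [phi * (a y - y a)] of matrices. *)
Definition gen_d : GL := gl (2 * phi * m - phi * n) (phi * m + phi * n + phi + 1) (- (phi * m) + 2 * phi * n + phi + 1) (- (2 * phi * m) + phi * n).

Lemma det_a : (0 * 1 - (-1) * 1 = 1 :> F)%R. Proof. by ring. Qed.
Lemma det_b : (m * (- m) - n * (phi + n - m) = 1)%R.
Proof. by apply: (@ideal_eq (0)%R (0)%R (- (1))%R); ring. Qed.
Lemma det_c : ((phi * s * m - 2 * phi * s * n - 2 * phi * s - 2 * phi * m + phi * n + s * m - 2 * s * n - s - 2 * m + n) * (- (phi * s * m) + 2 * phi * s * n + 2 * phi * s + 2 * phi * m - phi * n - s * m + 2 * s * n + s + 2 * m - n) - (2 * phi * s * m - phi * s * n - phi * m - phi * n - 2 * phi + 2 * s * m - s * n - m - n - 1) * (phi * s * m + phi * s * n + 2 * phi * s + phi * m - 2 * phi * n - 2 * phi + s * m + s * n + s + m - 2 * n - 1) = 1)%R.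
Proof. by apply: (@ideal_eq (- (3 * s ^+ 2 * m ^+ 2) + 3 * s ^+ 2 * m * n - 3 * s ^+ 2 * n ^+ 2 - 6 * s ^+ 2 * n - 4 * s ^+ 2 + 3 * s * m ^+ 2 - 3 * s * m * n + 3 * s * n ^+ 2 + 6 * s * n + 4 * s + 6 * m ^+ 2 - 6 * m * n + 6 * n ^+ 2 + 12 * n + 4)%R (- (9 * phi * m ^+ 2) + 9 * phi * m * n - 9 * phi * n ^+ 2 - 15 * phi * n - 8 * phi - 6 * m ^+ 2 + 6 * m * n - 6 * n ^+ 2 - 9 * n - 5)%R (- (3 * phi) - 3)%R); ring. Qed.
Lemma det_y : ((phi + n) * (- (n)) - (- (m) + n) * (- (m)) = 1)%R.
Proof. by apply: (@ideal_eq (0)%R (0)%R (- (1))%R); ring. Qed.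
Lemma det_d : ((2 * phi * m - phi * n) * (- (2 * phi * m) + phi * n) - (phi * m + phi * n + phi + 1) * (- (phi * m) + 2 * phi * n + phi + 1) = 1)%R.
Proof. by apply: (@ideal_eq (- (3 * m ^+ 2) + 3 * m * n - 3 * n ^+ 2 - 1)%R (0)%R (- (3 * phi) - 3)%R); ring. Qed.
Lemma SL_a : gen_a \in SL. Proof. exact: sl_mem det_a. Qed.
Lemma SL_b : gen_b \in SL. Proof. exact: sl_mem det_b. Qed.
Lemma SL_c : gen_c \in SL. Proof. exact: sl_mem det_c. Qed.
Lemma SL_y : gen_y \in SL. Proof. exact: sl_mem det_y. Qed.
Lemma val_a : GLval gen_a = mx2 (0) (- (1)) (1) (1)%R.
Proof. exact: gl_val (sl_nz det_a). Qed.
Lemma val_b : GLval gen_b = mx2 m n (phi + n - m) (- m)%R.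
Proof. exact: gl_val (sl_nz det_b). Qed.
Lemma val_c : GLval gen_c = mx2 (phi * s * m - 2 * phi * s * n - 2 * phi * s - 2 * phi * m + phi * n + s * m - 2 * s * n - s - 2 * m + n) (2 * phi * s * m - phi * s * n - phi * m - phi * n - 2 * phi + 2 * s * m - s * n - m - n - 1) (phi * s * m + phi * s * n + 2 * phi * s + phi * m - 2 * phi * n - 2 * phi + s * m + s * n + s + m - 2 * n - 1) (- (phi * s * m) + 2 * phi * s * n + 2 * phi * s + 2 * phi * m - phi * n - s * m + 2 * s * n + s + 2 * m - n)%R.
Proof. exact: gl_val (sl_nz det_c). Qed.
Lemma val_y : GLval gen_y = mx2 (phi + n) (- (m) + n) (- (m)) (- (n))%R.
Proof. exact: gl_val (sl_nz det_y). Qed.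
Lemma val_d : GLval gen_d = mx2 (2 * phi * m - phi * n) (phi * m + phi * n + phi + 1) (- (phi * m) + 2 * phi * n + phi + 1) (- (2 * phi * m) + phi * n)%R.
Proof. exact: gl_val (sl_nz det_d). Qed.
Lemma val_aV : GLval gen_a^-1 = mx2 (1) (1) (- (1)) (0)%R.
Proof.
by rewrite /gen_a (slV det_a) (gl_val (sl_nzV det_a)); congr mx2; ring.
Qed.
Lemma val_bV : GLval gen_b^-1 = mx2 (- (m)) (- (n)) (- (phi) + m - n) (m)%R.
Proof.
by rewrite /gen_b (slV det_b) (gl_val (sl_nzV det_b)); congr mx2; ring.
Qed.
Lemma val_yV : GLval gen_y^-1 = mx2 (- (n)) (m - n) (m) (phi + n)%R.
Proof.
by rewrite /gen_y (slV det_y) (gl_val (sl_nzV det_y)); congr mx2; ring.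
Qed.
Lemma gen_yE : gen_y = gen_a^-1 * gen_b.
Proof. by apply: GLval_inj; rewrite GLvalM val_y val_aV val_b mx2M; congr mx2; ring. Qed.

(** The word in [gen_dE] is multiplied out factor by factor, the entries being reduced at each stage
    by the relations on [phi], [m] and [n], so that the polynomials stay small. *)
Lemma mx_yy : (mx2 (phi + n) (- (m) + n) (- (m)) (- (n)) *m mx2 (phi + n) (- (m) + n) (- (m)) (- (n)) = mx2 (phi * n + phi) (- (phi * m) + phi * n) (- (phi * m)) (- (phi * n) - 1))%R.
Proof.
rewrite mx2M; congr mx2.
- by apply: (@ideal_eq (1)%R (0)%R (1)%R); ring.
- by apply: (@ideal_eq (0)%R (0)%R (0)%R); ring.
- by apply: (@ideal_eq (0)%R (0)%R (0)%R); ring.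
- by apply: (@ideal_eq (0)%R (0)%R (1)%R); ring.
Qed.
Lemma mx_step0 : (mx2 (0) (- (1)) (1) (1) *m mx2 (phi * n + phi) (- (phi * m) + phi * n) (- (phi * m)) (- (phi * n) - 1) = mx2 (phi * m) (phi * n + 1) (- (phi * m) + phi * n + phi) (- (phi * m) - 1))%R.
Proof.
rewrite mx2M; congr mx2.
- by apply: (@ideal_eq (0)%R (0)%R (0)%R); ring.
- by apply: (@ideal_eq (0)%R (0)%R (0)%R); ring.
- by apply: (@ideal_eq (0)%R (0)%R (0)%R); ring.
- by apply: (@ideal_eq (0)%R (0)%R (0)%R); ring.
Qed.
Lemma mx_step1 : (mx2 (phi * m) (phi * n + 1) (- (phi * m) + phi * n + phi) (- (phi * m) - 1) *m mx2 (1) (1) (- (1)) (0) = mx2 (phi * m - phi * n - 1) (phi * m) (phi * n + phi + 1) (- (phi * m) + phi * n + phi))%R.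
Proof.
rewrite mx2M; congr mx2.
- by apply: (@ideal_eq (0)%R (0)%R (0)%R); ring.
- by apply: (@ideal_eq (0)%R (0)%R (0)%R); ring.
- by apply: (@ideal_eq (0)%R (0)%R (0)%R); ring.
- by apply: (@ideal_eq (0)%R (0)%R (0)%R); ring.
Qed.
Lemma mx_step2 : (mx2 (phi * m - phi * n - 1) (phi * m) (phi * n + phi + 1) (- (phi * m) + phi * n + phi) *m mx2 (phi * n + phi) (- (phi * m) + phi * n) (- (phi * m)) (- (phi * n) - 1) = mx2 (phi * m + m + 1) (phi * n + phi + n + 1) (- (phi * m) + phi * n + phi - m + n) (- (phi * m) - phi - m))%R.
Proof.
rewrite mx2M; congr mx2.
- by apply: (@ideal_eq (- (m ^+ 2) + m * n + m - n ^+ 2)%R (0)%R (- (phi) - 1)%R); ring.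
- by apply: (@ideal_eq (- (m ^+ 2) + m * n - n ^+ 2 + n)%R (0)%R (- (phi) - 1)%R); ring.
- by apply: (@ideal_eq (m ^+ 2 - m * n - m + n ^+ 2 + n + 1)%R (0)%R (phi + 1)%R); ring.
- by apply: (@ideal_eq (- (m))%R (0)%R (0)%R); ring.
Qed.
Lemma mx_step3 : (mx2 (phi * m + m + 1) (phi * n + phi + n + 1) (- (phi * m) + phi * n + phi - m + n) (- (phi * m) - phi - m) *m mx2 (1) (1) (- (1)) (0) = mx2 (phi * m - phi * n - phi + m - n) (phi * m + m + 1) (phi * n + 2 * phi + n) (- (phi * m) + phi * n + phi - m + n))%R.
Proof.
rewrite mx2M; congr mx2.
- by apply: (@ideal_eq (0)%R (0)%R (0)%R); ring.
- by apply: (@ideal_eq (0)%R (0)%R (0)%R); ring.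
- by apply: (@ideal_eq (0)%R (0)%R (0)%R); ring.
- by apply: (@ideal_eq (0)%R (0)%R (0)%R); ring.
Qed.
Lemma mx_step4 : (mx2 (phi * m - phi * n - phi + m - n) (phi * m + m + 1) (phi * n + 2 * phi + n) (- (phi * m) + phi * n + phi - m + n) *m mx2 (phi + n) (- (m) + n) (- (m)) (- (n)) = mx2 (2 * phi * m - phi * n) (phi * m + phi * n + phi + 1) (- (phi * m) + 2 * phi * n + phi + 1) (- (2 * phi * m) + phi * n))%R.
Proof.
rewrite mx2M; congr mx2.
- by apply: (@ideal_eq (m - 1)%R (0)%R (- (phi) - 1)%R); ring.
- by apply: (@ideal_eq (n)%R (0)%R (- (phi) - 1)%R); ring.
- by apply: (@ideal_eq (2)%R (0)%R (phi + 1)%R); ring.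
- by apply: (@ideal_eq (0)%R (0)%R (0)%R); ring.
Qed.

(** This word puts [gen_d] in the group generated by [gen_a] and [gen_y]. So both are inverted by an
    element of [gen_H] itself, as [cent_card6] demands. *)
Lemma gen_dE : gen_d = gen_a * (gen_y * gen_y) * gen_a^-1 * (gen_y * gen_y) * gen_a^-1 * gen_y.
Proof.
apply: GLval_inj; rewrite !GLvalM val_d val_aV val_a val_y.
by rewrite mx_yy mx_step0 mx_step1 mx_step2 mx_step3 mx_step4.
Qed.

Lemma d_inv_a : gen_a ^ gen_d = gen_a^-1.
Proof.
apply: conjg_eq; apply: GLval_inj; rewrite !GLvalM val_d val_a val_aV !mx2M; congr mx2.
- by apply: (@ideal_eq (0)%R (0)%R (0)%R); ring.
- by apply: (@ideal_eq (0)%R (0)%R (0)%R); ring.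
- by apply: (@ideal_eq (0)%R (0)%R (0)%R); ring.
- by apply: (@ideal_eq (0)%R (0)%R (0)%R); ring.
Qed.
Lemma d_inv_y : gen_y ^ gen_d = gen_y^-1.
Proof.
apply: conjg_eq; apply: GLval_inj; rewrite !GLvalM val_d val_y val_yV !mx2M; congr mx2.
- by apply: (@ideal_eq (2 * m - n)%R (0)%R (0)%R); ring.
- by apply: (@ideal_eq (0)%R (0)%R (0)%R); ring.
- by apply: (@ideal_eq (0)%R (0)%R (0)%R); ring.
- by apply: (@ideal_eq (2 * m - n)%R (0)%R (0)%R); ring.
Qed.
Lemma tr_a : gtr gen_a = 1%R. Proof. by rewrite /gtr val_a mx2_tr; ring. Qed.
Lemma tr_b : gtr gen_b = 0%R. Proof. by rewrite /gtr val_b mx2_tr; ring. Qed.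
Lemma tr_c : gtr gen_c = 0%R. Proof. by rewrite /gtr val_c mx2_tr; ring. Qed.
Lemma tr_y : gtr gen_y = phi. Proof. by rewrite /gtr val_y mx2_tr; ring. Qed.
Lemma tr_aVc : gtr (gen_a^-1 * gen_c) = (0)%R.
Proof.
rewrite /gtr !GLvalM val_aV val_c !mx2M mx2_tr.
by apply: (@ideal_eq (0)%R (0)%R (0)%R); ring.
Qed.
Lemma tr_bVc : gtr (gen_b^-1 * gen_c) = (-1)%R.
Proof.
rewrite /gtr !GLvalM val_bV val_c !mx2M mx2_tr.
by apply: (@ideal_eq (- (2 * s * m) + s * n + m - 2 * n + 2)%R (0)%R (3 * phi + 3)%R); ring.
Qed.
Lemma tr_bc : gtr (gen_b * gen_c) = (1)%R.
Proof.
rewrite /gtr !GLvalM val_b val_c !mx2M mx2_tr.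
by apply: (@ideal_eq (2 * s * m - s * n - m + 2 * n - 2)%R (0)%R (- (3 * phi) - 3)%R); ring.
Qed.
(** This and the next two traces are the values, up to sign, that tr(bc) could take if [c] were a
    power of [a] times [d]. *)
Lemma tr_ba0d : gtr (gen_b * gen_d) = (- (phi) + 1)%R.
Proof.
rewrite /gtr !GLvalM val_b val_d !mx2M mx2_tr.
by apply: (@ideal_eq (m - 2 * n + 1)%R (0)%R (3 * phi)%R); ring.
Qed.
Lemma tr_ba1d : gtr (gen_b * gen_a * gen_d) = (0)%R.
Proof.
rewrite /gtr !GLvalM val_a val_b val_d !mx2M mx2_tr.
by apply: (@ideal_eq (2 * m - n)%R (0)%R (0)%R); ring.
Qed.
Lemma tr_ba2d : gtr (gen_b * gen_a * gen_a * gen_d) = (phi - 1)%R.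
Proof.
rewrite /gtr !GLvalM val_a val_b val_d !mx2M mx2_tr.
by apply: (@ideal_eq (m + n - 1)%R (0)%R (- (3 * phi))%R); ring.
Qed.
Lemma tr_abc : (gtr (gen_a * gen_b * gen_c) - gtr (gen_c * gen_b * gen_a) = 1 - 2%:R * s)%R.
Proof.
rewrite /gtr !GLvalM val_a val_b val_c !mx2M !mx2_tr.
by apply: (@ideal_eq (- (3 * s * n) + 4 * s + 3 * m - 2)%R (0)%R (6 * phi * s - 3 * phi + 6 * s - 3)%R); ring.
Qed.

(** The quadratic form X^2 - XY + Y^2 vanishes on the off-diagonal entries of a nilpotent N whose
    image is an eigenline of [a]. If it is also an eigenline of [y], these entries are proportional
    to the two quantities here, on which the form is nonzero. *)
Lemma no_common_line : ((phi + 2%:R * n - m) ^+ 2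
  - (phi + 2%:R * n - m) * (phi + n + m) + (phi + n + m) ^+ 2 = phi - 2%:R)%R.
Proof. by apply: (@ideal_eq (1)%R (0)%R (3)%R); ring. Qed.

Context (p : nat) (pF : p \in [pchar F]%R).
Context (F_cyc : forall s t : F, (s != 0)%R -> exists n, t = (s *+ n)%R).
Context (n2 : (2%:R != 0 :> F)%R) (n3 : (3%:R != 0 :> F)%R) (n5 : (5%:R != 0 :> F)%R).

Lemma golden_neq k l : (k ^+ 2 - k - 1 = l)%R -> (l != 0)%R -> phi != k.
Proof. by move=> <-; apply: contraNneq => <-; rewrite phiE; apply/eqP; ring. Qed.

Lemma golden_neq0 : phi != 0%R.
Proof. by apply: (@golden_neq _ (-1)%R); rewrite ?oppr_eq0 ?oner_neq0 //; ring. Qed.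

Lemma golden_neq2 : phi != 2%:R%R.
Proof. by apply: (@golden_neq _ 1%R); rewrite ?oner_neq0 //; ring. Qed.

Lemma golden_neqN2 : phi != (- 2%:R)%R.
Proof. by apply: (@golden_neq _ 5%:R%R) => //; ring. Qed.

Lemma nonc_a : nonc gen_a.
Proof.
apply: nonc_tr; rewrite tr_a expr1n; apply: contraNneq n3 => e.
have e3 : (3%:R = 4%:R - 1 :> F)%R by ring.
by rewrite e3 -e subrr.
Qed.

Lemma nonc_y : nonc gen_y.
Proof.
apply: nonc_tr; rewrite tr_y (_ : 4%:R = 2%:R ^+ 2 :> F)%R; last by ring.
by rewrite eqf_sqr negb_or golden_neq2 golden_neqN2.
Qed.

Lemma gen_a3 : gen_a ^+ 3 = mone. Proof. exact: gtr1_cube SL_a tr_a. Qed.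
Lemma gen_b2 : gen_b ^+ 2 = mone. Proof. exact: gtr0_sqr SL_b tr_b. Qed.
Lemma gen_c2 : gen_c ^+ 2 = mone. Proof. exact: gtr0_sqr SL_c tr_c. Qed.
Lemma gen_y5 : gen_y ^+ 5 = mone. Proof. by apply: gtr_golden SL_y _; rewrite tr_y. Qed.

Lemma gen_aVc2 : (gen_a^-1 * gen_c) ^+ 2 = mone.
Proof.
by apply: gtr0_sqr tr_aVc; apply: (@groupM _ (SL_group F)); rewrite ?groupV; [exact: SL_a|exact: SL_c].
Qed.

Lemma gen_bVc3 : (gen_b^-1 * gen_c) ^+ 3 = 1.
Proof.
by apply: gtrN1_cube tr_bVc; apply: (@groupM _ (SL_group F)); rewrite ?groupV; [exact: SL_b|exact: SL_c].
Qed.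

Lemma c_inv_a : gen_a ^ gen_c = gen_a^-1.
Proof.
apply: conjg_eq; have := gen_aVc2; rewrite -gen_c2 !expgS expg0 !mulg1.
by rewrite mulgA => /mulIg e; rewrite -[in LHS]e -!mulgA mulKVg.
Qed.

Definition gen_H : {group GL} := <<[set gen_a; gen_b; gen_c]>>%G.

Lemma H_a : gen_a \in gen_H. Proof. by rewrite mem_gen // !inE eqxx. Qed.
Lemma H_b : gen_b \in gen_H. Proof. by rewrite mem_gen // !inE eqxx orbT. Qed.
Lemma H_c : gen_c \in gen_H. Proof. by rewrite mem_gen // !inE eqxx !orbT. Qed.
Lemma H_y : gen_y \in gen_H. Proof. by rewrite gen_yE groupM ?groupV ?H_a ?H_b. Qed.
Lemma H_d : gen_d \in gen_H. Proof. by rewrite gen_dE !groupM ?groupV ?H_a ?H_y. Qed.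
Lemma H_mone : mone \in gen_H. Proof. by rewrite -gen_b2 groupX ?H_b. Qed.

Lemma H_sub : gen_H \subset SL.
Proof.
rewrite (gen_subG _ (SL_group F)); apply/subsetP=> x; rewrite !inE.
by case/orP=> [/orP[]|] /eqP->; [have := SL_a | have := SL_b | have := SL_c]; rewrite inE.
Qed.

Lemma order_a : #[gen_a] = 6.
Proof. exact: (order_mone n2 SL_a _ _ gen_a3 nonc_a). Qed.

Lemma order_y : #[gen_y] = 10.
Proof. exact: (order_mone n2 SL_y _ _ gen_y5 nonc_y). Qed.

Lemma ay_neq : gen_a * gen_y != gen_y * gen_a.
Proof.
apply/eqP; rewrite /gen_a /gen_y => /(sl_comm det_a det_y)[e1 _ e3].
have en : n = (2%:R * m)%R.
  by transitivity ((- m + n) * 1 + m)%R; [ring|rewrite -e1; ring].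
have ef : phi = (- 3%:R * m)%R.
  by transitivity (1 * (phi + n) + 1 * - m - n + m)%R; [ring|rewrite e3 en; ring].
case/eqP: golden_neq2; transitivity (phi ^+ 2 - 1)%R; first by rewrite phiE; ring.
transitivity (2%:R - 3%:R * (m ^+ 2 - m * n + n ^+ 2 + phi * n + 1))%R.
  by rewrite ef en; ring.
by rewrite mnE; ring.
Qed.

Lemma gen_p : p %| #|gen_H|.
Proof.
apply: contraT => pH.
have noU g : g \in gen_H -> (gtr g ^+ 2 = 4%:R)%R -> ~~ nonc g.
  move=> gH e; apply: contra pH => ng.
  exact: (trace4_order pF H_sub H_mone gH e ng).
have mV g q : g \in SL -> odd q -> g ^+ q = mone -> nonc g -> g^-1 != g.
  move=> gS q_odd gq ng; have := mone_order gS q_odd gq ng; apply: contraNneq => e.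
  by rewrite expgS expg1 -{1}e mulVg.
have C6 : #|'C_gen_H[gen_a]| = 6.
  apply: (@cent_card6 _ n2 gen_H H_sub H_mone noU rat gen_y gen_a gen_d) => //.
  - exact: H_y.
  - exact: H_a.
  - exact: H_d.
  - exact: nonc_y.
  - exact: nonc_a.
  - by rewrite -order_y order_dvdG //; apply/setIP; split; [exact: H_y | exact: cent1id].
  - by rewrite -order_a order_dvdG //; apply/setIP; split; [exact: H_a | exact: cent1id].
  - exact: d_inv_y.
  - exact: (mV _ 5 SL_y isT gen_y5 nonc_y).
  - exact: d_inv_a.
  - exact: (mV _ 3 SL_a isT gen_a3 nonc_a).
  - exact: gen_a3.
  exact: ay_neq.
have eC : 'C_gen_H[gen_a] = <[gen_a]>.
  apply/esym/eqP; rewrite eqEcard C6 -[#|<[_]>|]/(#[gen_a]) order_a leqnn andbT cycle_subG.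
  by apply/setIP; split; [exact: H_a | exact: cent1id].
(* Both [gen_c] and [gen_d] invert [gen_a], so their quotient centralizes it and is one of its
   powers. As [gen_a ^+ 3] is -1, exponents 0, 1 and 2 suffice up to sign. *)
have : gen_c * gen_d^-1 \in 'C_gen_H[gen_a].
  apply/setIP; split; first by rewrite groupM ?groupV ?H_c ?H_d.
  apply/cent1P/esym/commgP/conjg_fixP; rewrite conjgM c_inv_a.
  by rewrite -d_inv_a conjgK.
rewrite eC => /cycleP[i /(canRL (mulgKV gen_d)) ec].
have aq k : gen_a ^+ (k %/ 3 * 3) = mone ^+ (k %/ 3) by rewrite mulnC expgM gen_a3.
have sgn k x : x \in SL -> gtr (mone ^+ k * x) = gtr x \/ gtr (mone ^+ k * x) = (- gtr x)%R.
  move=> xS; elim: k => [|k IHk]; first by rewrite expg0 mul1g; left.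
  have mxS : mone ^+ k * x \in SL.
    by apply: (@groupM _ (SL_group F)) => //; apply: (@groupX _ (SL_group F)); apply: mone_SL.
  rewrite expgS -mulgA gtr_mone //.
  by case: IHk => ->; [right|left; rewrite opprK].
have [j [j3 ebc]] : exists j, j < 3 /\
    (gtr (gen_b * gen_a ^+ j * gen_d) = 1 \/ gtr (gen_b * gen_a ^+ j * gen_d) = -1)%R.
  exists (i %% 3); split; first by rewrite ltn_mod.
  have xS : gen_b * gen_a ^+ (i %% 3) * gen_d \in SL.
    apply: (subsetP H_sub); rewrite !groupM ?groupX ?H_a ?H_b ?H_d //.
  have e : gen_b * gen_c = mone ^+ (i %/ 3) * (gen_b * gen_a ^+ (i %% 3) * gen_d).
    rewrite ec {1}(divn_eq i 3) expgD aq !mulgA; congr (_ * _ * _).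
    by apply: commuteX; apply: (esym (mone_comm SL_b)).
  have := tr_bc; rewrite e; case: (sgn (i %/ 3) _ xS) => -> h; [left|right] => //.
  by rewrite -h opprK.
(* One of 1 - [phi], 0 and [phi] - 1 would have to be 1 or -1, but [phi] is neither 0 nor 2. *)
have p1 : phi != 0%R := golden_neq0; have p2 := golden_neq2.
have contra0 (x : F) : (x = 0 -> x = 1 \/ x = -1 -> False)%R.
  by move=> -> [|] /eqP; rewrite eq_sym ?oppr_eq0 oner_eq0.
have contra1 (x : F) : (x = phi - 1 \/ x = - phi + 1 -> x = 1 \/ x = -1 -> False)%R.
  have aux (z : F) : (z = phi - 1 -> z = 1 \/ z = -1 -> False)%R.
    move=> -> [] /eqP; rewrite subr_eq.
      by rewrite (_ : 1 + 1 = 2%:R :> F)%R // (negbTE p2).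
    by rewrite addNr (negbTE p1).
  move=> [e|e] h; first exact: (aux x e h).
  apply: (aux (- x)%R); first by rewrite e; ring.
  by case: h => ->; [right|left; rewrite opprK].
case: j j3 ebc => [|[|[|//]]] _; rewrite ?expg0 ?mulg1 ?expg1 ?expgS ?mulgA ?mulg1.
- by rewrite tr_ba0d => h; case: (contra1 _ (or_intror erefl) h).
- by rewrite tr_ba1d => h; case: (contra0 _ erefl h).
- by rewrite tr_ba2d => h; case: (contra1 _ (or_introl erefl) h).
Qed.

(** Write u = 1 + N for an element of order [p]. If tr(g u) = tr g, then tr(g N) = 0, and the image
    of N is an eigenline of g. By [no_common_line] this cannot happen for both [gen_a] and [gen_y],
    so conjugating by one of them gives a transvection that does not commute with u. *)
Lemma gen_full : SL \subset gen_H.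
Proof.
have p_pr := pcharf_prime pF.
have [u uH ou] := Cauchy p_pr gen_p; have uS := subsetP H_sub _ uH.
have up : u ^+ p = 1 by rewrite -ou expg_order.
have u1 : u != 1 by rewrite -order_gt1 ou prime_gt1.
have tu := p_elt_tr pF uS up.
have [ea|na] := eqVneq (gtr (gen_a * u)) (gtr gen_a); last first.
  exact: (unipotent_conj_gen pF F_cyc H_sub uH H_a up na).
have [ey|ny] := eqVneq (gtr (gen_y * u)) (gtr gen_y); last first.
  exact: (unipotent_conj_gen pF F_cyc H_sub uH H_y up ny).
case/eqP: u1; move: ea ey tu; case/slP: uS => x1 B C x2 h.
rewrite gtr_sl // tr_a tr_y /gtr !GLvalM val_a val_y gl_val ?(sl_nz h) // !mx2M !mx2_tr.
move=> ea ey tu; pose x := (x1 - 1)%R.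
have ex1 : x1 = (1 + x)%R by rewrite /x; ring.
have ex2 : x2 = (1 - x)%R by apply: (addrI x1); rewrite tu ex1; ring.
rewrite ex1 ex2 in h ea ey *.
have xBC : x = (B - C)%R.
  by apply/eqP; rewrite -subr_eq0; apply/eqP; move/eqP: ea; rewrite -subr_eq0 => /eqP ea; rewrite -[RHS]oppr0 -ea; ring.
have nil : (B ^+ 2 - B * C + C ^+ 2 = 0)%R.
  by move/eqP: h; rewrite -subr_eq0 xBC => /eqP h; rewrite -[RHS]oppr0 -h; ring.
have prop : (B * (phi + 2%:R * n - m) = C * (phi + n + m))%R.
  move/eqP: ey; rewrite -subr_eq0 xBC => /eqP ey; apply/eqP; rewrite -subr_eq0; apply/eqP.
  by rewrite -ey; ring.
have nz : (phi - 2%:R != 0)%R by rewrite subr_eq0 golden_neq2.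
set al := (phi + 2%:R * n - m)%R in prop; set be := (phi + n + m)%R in prop.
have ncl : (al ^+ 2 - al * be + be ^+ 2 = phi - 2%:R)%R := no_common_line.
have B0 : B = 0%R.
  apply/eqP; rewrite -sqrf_eq0; apply/eqP; apply: (mulIf nz); rewrite mul0r -ncl.
  transitivity ((B * al) ^+ 2 - (B * al) * (B * be) + (B * be) ^+ 2)%R; first by ring.
  rewrite prop; transitivity (be ^+ 2 * (B ^+ 2 - B * C + C ^+ 2))%R; first by ring.
  by rewrite nil mulr0.
have C0 : C = 0%R.
  by apply/eqP; rewrite -sqrf_eq0; apply/eqP; rewrite -nil B0; ring.
by rewrite xBC B0 C0 gl1; congr gl; ring.
Qed.

Lemma gen_SL : gen_H = SL_group F.
Proof. by apply/val_inj/eqP; rewrite eqEsubset H_sub gen_full. Qed.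

Local Notation Zg := 'Z(SL_group F).
Local Notation pr := (coset Zg).

(** Lifting the equations to matrices costs signs, which the nonzero traces of a, a^-1 b and bc
    determine. Then abc is conjugate to the inverse of cba and so has the trace of cba, against
    [tr_abc]. *)
Lemma no_inverting_conj (h : GL) : (2%:R * s != 1)%R ->
    pr (gen_a ^ h) = (pr gen_a)^-1 -> pr (gen_b ^ h) = (pr gen_b)^-1 ->
    pr (gen_c ^ h) = (pr gen_c)^-1 -> False.
Proof.
move=> s1 ea eb ec.
have lift x : x \in SL -> pr (x ^ h) = (pr x)^-1 -> x ^ h = x^-1 \/ x ^ h = mone * x^-1.
  move=> xS e; have xV := groupVr (xS : x \in SL_group F).
  have xJ : x ^ h \in SL by rewrite memJ_norm // SL_conj.
  by apply: (pr_eq xJ xV); rewrite e prV.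
have inS x : x \in SL -> x^-1 \in SL by move=> xS; apply: (groupVr (xS : x \in SL_group F)).
have mulS x y : x \in SL -> y \in SL -> x * y \in SL.
  by move=> xS yS; apply: (@groupM _ (SL_group F)).
have neq_opp (x : F) : x != 0%R -> (x = - x)%R -> False.
  move=> x0 e; case/negP: n2; apply/eqP; apply: (mulIf x0); rewrite mul0r.
  by transitivity (x + x)%R; [ring|rewrite {1}e addNr].
have oneN0 : (1 != 0 :> F)%R by apply: oner_neq0.
have ha : gen_a ^ h = gen_a^-1.
  case: (lift _ SL_a ea) => // e; have := gtrJ gen_a h.
  by rewrite e gtr_mone ?inS ?SL_a // gtrV ?SL_a // tr_a => /esym/(neq_opp _ oneN0).
have trab : gtr (gen_a * gen_b^-1) = phi.
  by rewrite -[_ * _]invgK gtrV ?invMg ?invgK ?mulS ?inS ?SL_a ?SL_b // gtrC -gen_yE tr_y.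
have hb : gen_b ^ h = gen_b^-1.
  case: (lift _ SL_b eb) => // e; have := gtrJ gen_y h.
  rewrite {1}gen_yE conjMg conjVg ha invgK e mulgA -(mone_comm SL_a) -mulgA.
  by rewrite gtr_mone ?mulS ?inS ?SL_a ?SL_b // trab tr_y => /esym/(neq_opp _ golden_neq0).
have trbc : gtr (gen_b^-1 * gen_c^-1) = 1%R.
  by rewrite -invMg gtrV ?mulS ?SL_b ?SL_c // gtrC tr_bc.
have hc : gen_c ^ h = gen_c^-1.
  case: (lift _ SL_c ec) => // e; have := gtrJ (gen_b * gen_c) h.
  rewrite conjMg hb e mulgA -(mone_comm (inS _ SL_b)) -mulgA.
  by rewrite gtr_mone ?mulS ?inS ?SL_b ?SL_c // trbc tr_bc => /esym/(neq_opp _ oneN0).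
have := gtrJ (gen_a * gen_b * gen_c) h.
rewrite !conjMg ha hb hc -mulgA -!invMg -mulgA gtrV ?mulS ?SL_a ?SL_b ?SL_c // mulgA => e.
have := tr_abc; rewrite e subrr => /esym/eqP; rewrite subr_eq0 eq_sym.
by rewrite (negbTE s1).
Qed.

End Generators.

(** * Arithmetic of the prime field *)

Section PrimeFieldArithmetic.
Local Open Scope ring_scope.

(** * Squares and conics over a finite field *)

Section Squares.
Context (F : finFieldType) (n2 : 2%:R != 0 :> F).
Implicit Types x y z k : F.

Definition squares : {set F} := [set x ^+ 2 | x in [set: F]].

Lemma squaresP x : reflect (exists y, x = y ^+ 2) (x \in squares).
Proof.
by apply: (iffP imsetP) => [[y _ ->]|[y ->]]; exists y; rewrite ?inE.
Qed.

(** Squaring is at most two to one, and only 0 lies over 0. *)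
Lemma card_squares : (#|F| < 2 * #|squares|)%N.
Proof.
have S0 : 0 \in squares by apply/squaresP; exists 0; rewrite expr0n.
have -> : #|F| = (\sum_(z in squares) \sum_(x : F | (x ^+ 2 == z)%R) 1)%N.
  rewrite -sum1_card (partition_big (fun x => x ^+ 2) (mem squares)) //=.
  by move=> x _; apply/squaresP; exists x.
rewrite mulnC -sum_nat_const (bigD1 0) //= [X in (_ < X)%N](bigD1 0) //=.
rewrite -addSn leq_add //.
  rewrite (bigD1 0) /= ?expr0n //= big1 ?addn0 // => x /andP[].
  by rewrite sqrf_eq0 => ->.
apply: leq_sum => _ /andP[/squaresP[y ->] _]; rewrite sum1_card.
have sub : [pred x | x ^+ 2 == y ^+ 2] \subset [set y; - y].
  by apply/subsetP=> x; rewrite !inE eqf_sqr.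
by apply: leq_trans (subset_leq_card sub) _; rewrite cards2; case: eqP.
Qed.

(** Two sets that each contain more than half of the field must meet. *)
Lemma two_squares k z : k != 0 -> exists x y, y ^+ 2 + k * x ^+ 2 = z.
Proof.
move=> k0; pose T := [set z - k * x | x in squares].
have cT : #|T| = #|squares|.
  by apply: card_imset => x y /addrI/oppr_inj/(mulfI k0).
have [dj|] := boolP [disjoint squares & T].
  have := max_card (squares :|: T); rewrite cardsU cT.
  move: dj; rewrite -setI_eq0 => /eqP->; rewrite cards0 subn0 addnn -mul2n.
  by rewrite leqNgt card_squares.
case/pred0Pn=> w /andP[/squaresP[y ->] /imsetP[_ /squaresP[x ->] e]].
by exists x, y; rewrite e subrK.
Qed.

(** The multiples of the squares by a nonsquare meet the squares only in 0, so by counting the two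
    sets cover the field. *)
Lemma mul_nonsquares x y : x \notin squares -> y \notin squares -> x * y \in squares.
Proof.
move=> xS yS; have S0 : 0 \in squares by apply/squaresP; exists 0; rewrite expr0n.
have x0 : x != 0 by apply: contraNneq xS => ->.
pose T := [set x * z | z in squares].
have cT : #|T| = #|squares| by apply: card_imset => u v /(mulfI x0).
have ST : squares :&: T = [set 0].
  apply/setP=> w; rewrite !inE; apply/andP/eqP => [[/squaresP[u eu]]|->]; last first.
    by split=> //; apply/imsetP; exists 0; rewrite ?mulr0.
  case/imsetP=> _ /squaresP[v ->] ev; apply/eqP; apply: contraNT xS => w0.
  have v0 : v != 0 by apply: contraNneq w0 => v0; rewrite ev v0 expr0n mulr0.
  apply/squaresP; exists (u / v); rewrite exprMn exprVn -eu ev mulfK //.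
  by rewrite sqrf_eq0.
have full : squares :|: T = [set: F].
  apply/eqP; rewrite eqEcard subsetT /= cardsT cardsU cT ST cards1 addnn -mul2n.
  by have := card_squares; case: (2 * _)%N => // n; rewrite ltnS subn1.
have : y \in squares :|: T by rewrite full inE.
rewrite inE (negbTE yS) => /imsetP[_ /squaresP[v ->] ->].
by apply/squaresP; exists (x * v); ring.
Qed.

(** Completing squares: twelve times the left side is 3 (2m - n)^2 + (3n + 2 phi)^2 - (4 phi^2 -
    12). *)
Lemma conic_point (phi : F) : 3%:R != 0 :> F ->
  exists m n : F, m ^+ 2 - m * n + n ^+ 2 + phi * n + 1 = 0.
Proof.
move=> n3; have [x [y e]] := two_squares (4%:R * phi ^+ 2 - 12%:R) n3.
pose n := (y - 2%:R * phi) / 3%:R; pose m := (x + n) / 2%:R.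
have ey : y = 3%:R * n + 2%:R * phi by rewrite /n; field.
have ex : x = 2%:R * m - n by rewrite /m; field.
exists m, n; apply: (mulfI n2); apply: (mulfI n2); apply: (mulfI n3).
rewrite !mulr0; apply/eqP; rewrite -(subrr (4%:R * phi ^+ 2 - 12%:R)) -{1}e ex ey.
by apply/eqP; ring.
Qed.

End Squares.

Lemma root_of_unity (L : finFieldType) q : prime q -> (q %| #|L|.-1)%N ->
  exists2 z : L, z ^+ q = 1 & z != 1.
Proof.
move=> q_pr; rewrite -card_finField_unit => /(Cauchy q_pr)[x _ ox].
exists (val x); first by rewrite -FinRing.val_unitX -ox expg_order.
apply: contraTneq (prime_gt1 q_pr) => e; rewrite -ox (_ : x = 1%g) ?order1 //.
exact: val_inj.
Qed.

(** * Gauss periods *)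

Section Periods.
Context (L : finFieldType).

Definition period (z : L) (s : seq nat) : L := \sum_(k <- s) z ^+ k.

Lemma cyclotomic_sum n (z : L) : z ^+ n = 1 -> z != 1 -> \sum_(i < n) z ^+ i = 0.
Proof.
move=> zn z1; apply: (@mulfI _ (z - 1)); first by rewrite subr_eq0.
by rewrite -subrX1 zn subrr mulr0.
Qed.

Lemma period5 (z : L) : z ^+ 5 = 1 -> z != 1 ->
  period z [:: 1; 4]%N ^+ 2 + period z [:: 1; 4]%N = 1.
Proof.
move=> zn /(cyclotomic_sum zn); rewrite /period !big_cons big_nil !big_ord_recr big_ord0 /= => e.
transitivity (1 + ((- 1%:R) * z ^+ 0 + 2%:R * z ^+ 1 + (- 1%:R) * z ^+ 3 + 1%:R * z ^+ 4) *
  (0 + z ^+ 0 + z ^+ 1 + z ^+ 2 + z ^+ 3 + z ^+ 4)); first by ring.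
by rewrite e mulr0 addr0.
Qed.

(** The exponents are the quadratic residues modulo 11, and the relation says that twice the period
    plus 1 is a square root of -11. The cofactor is the quotient by the cyclotomic polynomial 1 + z
    + ... + z^10. *)
Lemma period11 (z : L) : z ^+ 11 = 1 -> z != 1 ->
  period z [:: 1; 3; 4; 5; 9]%N ^+ 2 + period z [:: 1; 3; 4; 5; 9]%N = - 3%:R.
Proof.
move=> zn /(cyclotomic_sum zn); rewrite /period !big_cons big_nil !big_ord_recr big_ord0 /= => e.
transitivity (- 3%:R + (3%:R * z ^+ 0 + (- 2%:R) * z ^+ 1 + 2%:R * z ^+ 4 + (- 1%:R) * z ^+ 7 + 1%:R * z ^+ 8) *
  (0 + z ^+ 0 + z ^+ 1 + z ^+ 2 + z ^+ 3 + z ^+ 4 + z ^+ 5 + z ^+ 6 + z ^+ 7 + z ^+ 8 + z ^+ 9 + z ^+ 10)); first by ring.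
by rewrite e mulr0 addr0.
Qed.

Lemma periods11_sum (z : L) : z ^+ 11 = 1 -> z != 1 ->
  period z [:: 1; 3; 4; 5; 9]%N + period z [:: 2; 6; 7; 8; 10]%N = - 1.
Proof.
move=> zn /(cyclotomic_sum zn); rewrite /period !big_cons !big_nil !big_ord_recr big_ord0 /= => e.
transitivity (- 1 + (0 + z ^+ 0 + z ^+ 1 + z ^+ 2 + z ^+ 3 + z ^+ 4 + z ^+ 5 + z ^+ 6 + z ^+ 7 + z ^+ 8 + z ^+ 9 + z ^+ 10)); first by ring.
by rewrite e addr0.
Qed.

Context (p : nat) (p_pr : prime p) (pL : p \in [pchar L]).

(** The images of 0, ..., p - 1 already exhaust the roots of X^p - X. *)
Lemma prime_field_fixed (x : L) : x ^+ p = x -> exists n : nat, x = n%:R.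
Proof.
move=> xp; case: (pickP (fun i : 'I_p => x == i%:R)) => [i /eqP->|no]; first by exists i.
pose P : {poly L} := 'X^p - 'X.
have sP : size P = p.+1.
  by rewrite size_polyDl ?size_polyXn // size_polyN size_polyX ltnS prime_gt1.
have P0 : P != 0 by rewrite -size_poly_eq0 sP.
have rP y : y ^+ p = y -> root P y.
  by move=> e; rewrite /root !hornerE ?hornerXn e subrr.
pose s := x :: [seq (nat_of_ord i)%:R | i <- enum 'I_p].
have : (size s < size P)%N.
  apply: max_poly_roots P0 _ _.
    rewrite /= rP //=; apply/allP=> _ /mapP[i _ ->]; apply: rP.
    by rewrite -[LHS](pFrobenius_autE pL) pFrobenius_aut_nat.
  rewrite /= map_inj_uniq ?enum_uniq ?andbT.
    by apply/mapP=> -[i _ e]; have := no i; rewrite e eqxx.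
  move=> i j; wlog le_ij : i j / (i <= j)%N.
    by case/orP: (leq_total i j) => ? ? ?; [|symmetry]; auto.
  move=> /esym/eqP; rewrite -subr_eq0 -natrB // -(dvdn_pcharf pL) => dv.
  apply: val_inj; apply/eqP; rewrite eqn_leq le_ij -subn_eq0 /=.
  apply: contraTT dv; rewrite -lt0n => gt0; apply/negP=> /(dvdn_leq gt0).
  by rewrite leqNgt (leq_ltn_trans (leq_subr _ _)).
by rewrite /s /= size_map size_enum_ord sP ltnn.
Qed.

Lemma period_frobenius n z s : z ^+ n = 1 ->
  period z s ^+ p = period z [seq ((k * p) %% n)%N | k <- s].
Proof.
move=> zn; rewrite -[LHS](pFrobenius_autE pL) rmorph_sum /period big_map.
by apply: eq_bigr => k _; rewrite /= pFrobenius_autE -exprM expr_mod.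
Qed.

End Periods.

(** The field with p^2 elements contains a primitive fifth root of unity. As [p] is 1 or -1 modulo
    5, Frobenius preserves the exponents 1 and 4, so the period lies in the prime field; twice the
    period plus 1 squares to 5. *)
Lemma sqrt5_Fp p : prime p -> (p %% 5 \in [:: 1; 4])%N ->
  exists t : 'F_p, t ^+ 2 = 5%:R.
Proof.
move=> p_pr p5; have [L pL cL] := pPrimePowerField p_pr (isT : 0 < 2)%N.
have [z z5 z1] : exists2 z : L, z ^+ 5 = 1 & z != 1.
  apply: root_of_unity => //; rewrite cL -subn1 -eqn_mod_dvd ?expn_gt0 ?prime_gt0 //.
  by rewrite -modnXm; case/or3P: p5 => // /eqP->.
have psi_p : period z [:: 1; 4]%N ^+ p = period z [:: 1; 4]%N.
  rewrite (period_frobenius pL _ z5) /period; apply: perm_big => /=.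
  by rewrite -![((_ * p) %% 5)%N]modnMmr; case/or3P: p5 => // /eqP->.
have [n en] := prime_field_fixed p_pr pL psi_p.
have := period5 z5 z1; rewrite en => /eqP; rewrite -subr_eq0 => /eqP e.
have : (p %| n ^ 2 + n + p.-1)%N.
  rewrite (dvdn_pcharf pL) !natrD natrX -subn1 natrB ?prime_gt0 // (pcharf0 pL) sub0r.
  by rewrite e.
rewrite (dvdn_pcharf (pchar_Fp p_pr)) !natrD natrX -subn1 natrB ?prime_gt0 //.
rewrite (pcharf0 (pchar_Fp p_pr)) sub0r => /eqP e'.
exists (2%:R * n%:R + 1).
by rewrite -[RHS]addr0 -[X in _ = _ + X](mulr0 4%:R) -e'; ring.
Qed.

(** In the field with p^10 elements Frobenius exchanges the two periods, [p] being a nonresidue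
    modulo 11. A root of -11 in the prime field would equal 2 eta + 1 up to sign and make eta fixed.
    Then the two periods coincide, their sum -1 gives 2 eta + 1 = 0, and so 11 = 0. *)
Lemma nonsquare_m11 p (w : 'F_p) : prime p -> p != 2%N -> (p %% 11 \in [:: 2; 6; 7; 8; 10])%N ->
  w ^+ 2 = - 11%:R -> False.
Proof.
move=> p_pr pn2 p11 ew; have [L pL cL] := pPrimePowerField p_pr (isT : 0 < 10)%N.
have cop : coprime p 11.
  rewrite coprime_sym prime_coprime //; apply/negP=> /eqP e; by rewrite e in p11.
have [z z11 z1] : exists2 z : L, z ^+ 11 = 1 & z != 1.
  apply: root_of_unity => //; rewrite cL -subn1 -eqn_mod_dvd ?expn_gt0 ?prime_gt0 //.
  by have := Euler_exp_totient cop; rewrite totient_prime // => ->.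
set eta := period z [:: 1; 3; 4; 5; 9]%N.
have eta_p : eta ^+ p = period z [:: 2; 6; 7; 8; 10]%N.
  rewrite (period_frobenius pL _ z11) /period; apply: perm_big => /=.
  by rewrite -![((_ * p) %% 11)%N]modnMmr; move: p11; rewrite !inE;
    do ![case/orP => [/eqP-> //|]] => /eqP->.
pose W : L := (val w)%:R.
have eW : W ^+ 2 = - 11%:R.
  have : (p %| (val w) ^ 2 + 11)%N.
    by rewrite (dvdn_pcharf (pchar_Fp p_pr)) natrD natrX natr_Zp ew addNr.
  by rewrite (dvdn_pcharf pL) natrD natrX addr_eq0 => /eqP.
have Wp : W ^+ p = W by rewrite -[LHS](pFrobenius_autE pL) pFrobenius_aut_nat.
have : (2%:R * eta + 1) ^+ 2 = W ^+ 2.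
  rewrite eW; transitivity (4%:R * (eta ^+ 2 + eta) + 1); first by ring.
  by rewrite period11 //; ring.
have p2 : 2%:R != 0 :> L.
  by rewrite -(dvdn_pcharf pL) dvdn_prime2.
have fr (x : L) : (2%:R * x + 1) ^+ p = 2%:R * x ^+ p + 1.
  by rewrite -!(pFrobenius_autE pL) rmorphD rmorphM rmorph1 rmorph_nat.
have : (2%:R * eta + 1) ^+ 2 = W ^+ 2 -> (2%:R * eta + 1) ^+ p = 2%:R * eta + 1.
  move/eqP; rewrite eqf_sqr => /orP[]/eqP->; first exact: Wp.
  by rewrite -[LHS](pFrobenius_autE pL) rmorphN /= pFrobenius_autE Wp.
move=> h e; have := h e; rewrite fr => /addIr/(mulfI p2); rewrite eta_p => e2.
have := periods11_sum z11 z1; rewrite e2 -/eta => e3.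
have : (p %| 11)%N.
  rewrite (dvdn_pcharf pL) -oppr_eq0 -eW -e sqrf_eq0.
  by rewrite mulr_natl mulr2n e3 addNr.
rewrite dvdn_prime2 // => /eqP e4; by move: cop; rewrite e4.
Qed.

Lemma golden_parameters p : prime p -> (p %% 5 \in [:: 1; 4])%N ->
    ((p %% 11 \in [:: 1; 3; 4; 5; 9])%N /\
     exists sqrt5 : 'F_p,
       [/\ sqrt5 ^+ 2 = 5%:R,
           exists a : 'F_p, 3%:R + 2%:R * sqrt5 = a ^+ 2
         & exists b : 'F_p, 3%:R - 2%:R * sqrt5 = b ^+ 2])
    \/ (p %% 11 \in [:: 2; 6; 7; 8; 10])%N ->
  [/\ 2%:R != 0 :> 'F_p, 3%:R != 0 :> 'F_p, 5%:R != 0 :> 'F_p &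
   exists phi s : 'F_p, [/\ phi ^+ 2 = phi + 1, s ^+ 2 = s + 1 - phi & 2%:R * s != 1]].
Proof.
move=> p_pr p5 p11; have pF := pchar_Fp p_pr.
(* The primes 2, 3 and 5 have the wrong residue modulo 5, and 11 has residue 0 modulo 11, which is
   in neither list. *)
have nz q : prime q -> (q %% 5 \notin [:: 1; 4])%N \/ q = 11 -> q%:R != 0 :> 'F_p.
  move=> q_pr hq; rewrite -(dvdn_pcharf pF) dvdn_prime2 //; apply/negP=> /eqP e; subst q.
  case: hq => [|e]; first by rewrite p5.
  by case: p11 => [[+ _]|]; rewrite e.
have n2 : 2%:R != 0 :> 'F_p by apply: nz => //; left.
have n3 : 3%:R != 0 :> 'F_p by apply: nz => //; left.
have n5 : 5%:R != 0 :> 'F_p by apply: nz => //; left.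
have n11 : 11%:R != 0 :> 'F_p by apply: nz => //; right.
split=> //.
have [t [r [et er]]] : exists t r : 'F_p, t ^+ 2 = 5%:R /\ 3%:R - 2%:R * t = r ^+ 2.
  case: p11 => [[_ [t [et _ [b eb]]]]|p11]; first by exists t, b.
  have [t et] := sqrt5_Fp p_pr p5.
  have [/squaresP[r er]|sq1] := boolP (3%:R - 2%:R * t \in squares 'F_p).
    by exists t, r.
  have [/squaresP[r er]|sq2] := boolP (3%:R + 2%:R * t \in squares 'F_p).
    by exists (- t), r; rewrite sqrrN mulrN opprK.
  have /squaresP[w ew] := mul_nonsquares sq1 sq2.
  case: (@nonsquare_m11 p w) => //; first by apply: contraTneq p5 => ->.
  rewrite -ew.
  by transitivity (9%:R - 4%:R * t ^+ 2); [ring|rewrite et; ring].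
have half (x y : 'F_p) : 4%:R * x = 4%:R * y -> x = y.
  by move=> e; apply: (mulfI n2); apply: (mulfI n2); rewrite !mulrA -!natrM.
pose phi := (1 + t) / 2%:R; pose s := (1 + r) / 2%:R.
have ep : t = 2%:R * phi - 1 by rewrite /phi; field.
have es : r = 2%:R * s - 1 by rewrite /s; field.
exists phi, s; split.
- apply: half; transitivity (t ^+ 2 + 2%:R * t + 1); first by rewrite ep; ring.
  by rewrite et ep; ring.
- apply: half; transitivity (r ^+ 2 + 2%:R * r + 1); first by rewrite es; ring.
  by rewrite -er es ep; ring.
(* If 2 s = 1 then r = 0, so 3 = 2 t and 9 = 20, that is, 11 = 0. *)
apply: contraNneq n11 => e; have r0 : r = 0 by rewrite es e subrr.
apply/eqP; transitivity (4%:R * 5%:R - 3%:R ^+ 2 : 'F_p); first by ring.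
have e3 : 3%:R = 2%:R * t by apply/eqP; rewrite -subr_eq0 er r0 expr0n.
by rewrite e3 -et; ring.
Qed.

End PrimeFieldArithmetic.

(** * Simplicity *)

Section ProjectiveSpecialLinear.
Context (F : finFieldType).
Local Notation GL := (GL2 F).
Local Notation SL := (SL F).
Local Notation SLg := (SL_group F).
Local Notation Zg := 'Z(SL_group F).
Local Notation pr := (coset Zg).
Local Notation K := (SLg / Zg)%G.

(** The determinant takes each nonzero value equally often, so the order of GL_2 is divided by |F| -
    1. *)
Lemma card_SL : #|SL| = (#|F| * (#|F| ^ 2 - 1))%N.
Proof.
have memS (h : GL) : (h \in SL) = (\det (GLval h) == 1)%R by rewrite inE.
have F1 : 1 < #|F| by apply/card_gt1P; exists 0%R, 1%R; rewrite eq_sym oner_neq0.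
have eF : #|F| = #|F|.-1.+1 by rewrite prednK // ltnW.
have : (#|SL| * #|F|.-1 = #|[set: GL]|)%N.
  rewrite [in RHS]cardsE -[RHS]sum1_card.
  rewrite (partition_big (fun g : GL => (\det (GLval g))%R) (fun t : F => (t != 0)%R)) /=; last first.
    by move=> g _; have := GL_unitmx g; rewrite unitmxE unitfE.
  have fib (t : F) : (t != 0)%R -> (\sum_(g : GL | (\det (GLval g) == t)%R) 1 = #|SL|)%N.
    move=> t0; rewrite sum1_card -(card_lcoset SL (gl t 0 0 1)); apply: eq_card => g.
    have dt : (t * 1 - 0 * 0 != 0 :> F)%R by rewrite mulr1 mulr0 subr0.
    rewrite mem_lcoset memS GLvalM det_mulmx -[LHS]/(\det (GLval g) == t)%R.
    have e : (\det (GLval (gl t 0 0 1)^-1) = t^-1)%R.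
      apply: (mulIf t0); rewrite mulVf //.
      have dg : (\det (GLval (gl t 0 0 1)) = t)%R by rewrite gl_val // mx2_det; ring.
      by rewrite -[X in (_ * X)%R]dg -det_mulmx -GLvalM mulVg det1.
    rewrite e; apply/eqP/eqP => [->|h]; first by rewrite mulVf.
    by rewrite -[t]mulr1 -h mulrA mulfV // mul1r.
  rewrite (eq_bigr (fun _ => #|SL|)) // sum_nat_const mulnC; congr (_ * _)%N.
  by apply: esym; apply: etrans (cardC1 (0%R : F)); apply: eq_card.
have := card_GL_2 F; rewrite -[#|'GL_2[F]|]/(#|[set: GL]|) => -> e.
apply/eqP; rewrite -(@eqn_pmul2r #|F|.-1) ?e; last by rewrite -ltnS -eF.
apply/eqP; rewrite -!mulnA; congr (_ * _)%N.
rewrite eF /=; move: #|F|.-1 => k.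
have -> : (k.+1 ^ 2 - 1 = k * k.+2)%N by rewrite expnS expn1 mulSn !mulnS; lia.
by rewrite mulnC.
Qed.

Context (F_cyc : forall s t : F, (s != 0)%R -> exists n, t = (s *+ n)%R).
Context (n2 : (2%:R != 0 :> F)%R) (n3 : (3%:R != 0 :> F)%R) (n5 : (5%:R != 0 :> F)%R).

Lemma card_PSL : (#|K| * 2 = #|SL|)%N.
Proof.
have -> : 2 = #|Zg| by rewrite center_SL cards2 eq_sym mone_neq1.
by rewrite card_quotient ?normal_norm ?center_normal // mulnC Lagrange ?center_sub.
Qed.

(** A nontrivial [N] pulls back to a normal subgroup that contains a noncentral matrix, and
    [SL_normal_full] makes that subgroup everything. *)
Lemma PSL_simple (N : {group coset_of Zg}) : N \subset K -> K \subset 'N(N) ->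
  N :=: 1 \/ N :=: K.
Proof.
move=> sNK nN; case: (pickP [pred x in N | x != 1]) => [x /andP[xN x1]|no]; last first.
  left; apply/eqP; rewrite eqEsubset sub1G andbT; apply/subsetP=> x xN.
  by have /negbT := no x; rewrite /= xN negbK inE.
right; have [g gS ex] := pr_surj (subsetP sNK x xN).
pose M0 : {set GL} := [set h in SL | pr h \in N].
have gM : group_set M0.
  apply/group_setP; split=> [|u v].
    by rewrite inE (group1 SLg) morph1 group1.
  rewrite !(in_set, inE) -!/(_ \in SL) => /andP[uS uN] /andP[vS vN].
  have uS' : u \in SL by rewrite inE.
  have vS' : v \in SL by rewrite inE.
  by rewrite prM // groupM // andbT; have := groupM (uS' : u \in SLg) vS'; rewrite inE.
pose M : {group GL} := Group gM.
have memM h : (h \in M) = (h \in SL) && (pr h \in N) by rewrite in_set.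
have sM : SL \subset 'N(M).
  apply/subsetP=> h hS; rewrite inE; apply/subsetP=> _ /imsetP[u uM ->].
  move: uM; rewrite !memM => /andP[uS uN].
  have uh : u ^ h \in SL by rewrite memJ_norm // SL_conj.
  have hV := groupVr (hS : h \in SLg); have huS := groupM (uS : u \in SLg) (hS : h \in SLg).
  rewrite uh conjgE prM // prM // prV // -conjgE memJ_norm //.
  by apply: (subsetP nN); apply: pr_K.
have gM' : g \in M by rewrite memM gS -ex.
have gZ : g \notin Zg.
  by apply: contra x1 => gZ; rewrite ex coset_id.
have full := SL_normal_full F_cyc n2 n3 n5 sM gM' gS gZ.
apply/eqP; rewrite eqEsubset sNK; apply/subsetP=> y /pr_surj[h hS ->].
by have := subsetP full h hS; rewrite memM => /andP[].
Qed.

Lemma PSL_center u : u \in K -> (forall k, k \in K -> u * k = k * u) -> u = 1.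
Proof.
move=> uK cu; have sC : 'Z(K) \subset K by apply: center_sub.
have uZ : u \in 'Z(K).
  by apply/centerP; split=> // k kK; apply: cu.
case: (PSL_simple sC (normal_norm (center_normal K))) => eC.
  by move: uZ; rewrite /= eC => /set1P.
have inK (t : F) : pr (upper t) \in K /\ pr (lower t) \in K.
  by split; apply: pr_K; [apply: upper_SL | apply: lower_SL].
have [u1 _] := inK 1%R; have [_ l1] := inK 1%R.
have : pr (upper 1) \in 'Z(K) by rewrite eC.
case/centerP=> _ /(_ _ l1); rewrite -/(commute _ _) => /esym.
rewrite -!prM ?upper_SL ?lower_SL // => e.
have ulS : upper 1 * lower 1 \in SL by apply: (@groupM _ SLg); [apply: upper_SL | apply: lower_SL].
have luS : lower 1 * upper 1 \in SL by apply: (@groupM _ SLg); [apply: lower_SL | apply: upper_SL].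
case: (pr_eq luS ulS e) => [/esym|em]; first by move/noncentral_pair.
have := congr1 (@gtr F) em; rewrite gtr_mone // gtrC => e'.
have det_u : (1 * 1 - 1 * 0 = 1 :> F)%R by ring.
have det_l : (1 * 1 - 0 * 1 = 1 :> F)%R by ring.
have e3 : gtr (upper 1 * lower 1) = 3%:R%R :> F.
  by rewrite /gtr GLvalM !gl_val ?(sl_nz det_u) ?(sl_nz det_l) // mx2M mx2_tr; ring.
have : (2%:R * 3%:R = 0 :> F)%R.
  by transitivity (3%:R - (- 3%:R) : F)%R; [ring | rewrite -{1}e3 -e3 {1}e' subrr].
by move/eqP; rewrite mulf_eq0 (negbTE n2) (negbTE n3).
Qed.

End ProjectiveSpecialLinear.

(** * Chirality of the mix *)

Section GoldenGenerators.
Context (F : finFieldType) (p : nat) (pF : p \in [pchar F]%R) (p_odd : odd p).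
Context (F_cyc : forall s t : F, (s != 0)%R -> exists n, t = (s *+ n)%R).
Context (n2 : (2%:R != 0 :> F)%R) (n3 : (3%:R != 0 :> F)%R) (n5 : (5%:R != 0 :> F)%R).
Context (phi s : F) (phiE : (phi ^+ 2 = phi + 1)%R) (sE : (s ^+ 2 = s + 1 - phi)%R).
Context (s1 : (2%:R * s != 1)%R).
Local Notation SLg := (SL_group F).
Local Notation Zg := 'Z(SL_group F).
Local Notation K := (SLg / Zg)%G.

Lemma PSL_generators : exists a b c : coset_of Zg,
  [/\ [/\ a \in K, b \in K & c \in K],
      [/\ a ^+ 3 = 1, b ^+ 2 = 1 & c ^+ 2 = 1],
      [/\ (a^-1 * b) ^+ 5 = 1, (b^-1 * c) ^+ 3 = 1 & (a^-1 * c) ^+ 2 = 1],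
      forall N : {group coset_of Zg}, a \in N -> b \in N -> c \in N -> K \subset N
    & forall f, {in K &, {morph f : x y / x * y}} -> {in K, forall x, f x \in K} ->
        {in K &, injective f} -> f a = a^-1 -> f b = b^-1 -> f c = c^-1 -> False].
Proof.
have [m [n mnE]] := conic_point n2 phi n3.
pose ga := gen_a F; pose gb := gen_b phi m n; pose gc := gen_c phi s m n.
have Sa : ga \in SL F by apply: SL_a.
have Sb : gb \in SL F by apply: (SL_b phiE sE mnE).
have Sc : gc \in SL F by apply: (SL_c phiE sE mnE).
have inV x : x \in SL F -> x^-1 \in SL F by move=> xS; apply: (groupVr (xS : x \in SLg)).
have inM x y : x \in SL F -> y \in SL F -> x * y \in SL F.
  by move=> xS yS; apply: (@groupM _ SLg).
have prVM x y : x \in SL F -> y \in SL F ->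
    (coset Zg x)^-1 * coset Zg y = coset Zg (x^-1 * y).
  by move=> xS yS; rewrite prM ?inV // prV.
have ea : ga ^+ 3 = mone F by apply: gen_a3.
have eb : gb ^+ 2 = mone F by apply: (gen_b2 phiE sE mnE).
have ec : gc ^+ 2 = mone F by apply: (gen_c2 phiE sE mnE).
have ey : (ga^-1 * gb) ^+ 5 = mone F by rewrite -(gen_yE phiE sE mnE); apply: (gen_y5 phiE sE mnE).
have ebc : (gb^-1 * gc) ^+ 3 = 1 by apply: (gen_bVc3 phiE sE mnE).
have eac : (ga^-1 * gc) ^+ 2 = mone F by apply: (gen_aVc2 phiE sE mnE).
exists (coset Zg ga), (coset Zg gb), (coset Zg gc); split.
- by split; apply: pr_K.
- by split; rewrite -prX // ?ea ?eb ?ec pr_mone.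
- split; rewrite prVM // -prX; rewrite ?inM ?inV // ?ey ?ebc ?eac ?pr_mone //.
  exact: morph1.
- move=> N aN bN cN; apply/subsetP=> _ /pr_surj[g gS ->].
  have nZ x : x \in SL F -> x \in 'N(Zg).
    by move=> xS; apply: (subsetP (normal_norm (center_normal SLg))).
  have sH : gen_H phi s m n \subset coset Zg @*^-1 N.
    rewrite gen_subG; apply/subsetP=> x; rewrite !in_setU !in_set1.
    by case/orP=> [/orP[]|] /eqP->; apply/morphpreP; split=> //; apply: nZ.
  have := subsetP sH g; rewrite (gen_SL phiE sE mnE pF F_cyc n2 n3 n5) => /(_ gS).
  by case/morphpreP.
move=> f fM fK f_inj fa fb fc.
have [g hg] := PSL_aut pF F_cyc n2 n3 p_odd fM fK f_inj.
apply: (no_inverting_conj phiE sE mnE n2 s1 (h := g)).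
- by rewrite -[RHS]fa hg.
- by rewrite -[RHS]fb hg.
by rewrite -[RHS]fc hg.
Qed.

End GoldenGenerators.

Section MixWithSimple.
Context (kT : finGroupType) (K : {group kT}).
Context (simpK : forall N : {group kT}, N \subset K -> K \subset 'N(N) -> N :=: 1 \/ N :=: K).
Context (cK : forall u, u \in K -> (forall k, k \in K -> u * k = k * u) -> u = 1).
Context (a b c : kT) (Ka : a \in K) (Kb : b \in K) (Kc : c \in K).
Context (a3 : a ^+ 3 = 1) (b2 : b ^+ 2 = 1) (c2 : c ^+ 2 = 1).
Context (ab5 : (a^-1 * b) ^+ 5 = 1) (bc3 : (b^-1 * c) ^+ 3 = 1) (ac2 : (a^-1 * c) ^+ 2 = 1).
Context (genK : forall N : {group kT}, a \in N -> b \in N -> c \in N -> K \subset N).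
Context (no_inv : forall f, {in K &, {morph f : x y / x * y}} ->
  {in K, forall x, f x \in K} -> {in K &, injective f} ->
  f a = a^-1 -> f b = b^-1 -> f c = c^-1 -> False).
Context (d : Order.disp_t) (Q : finPOrderType d) (Phi : {set Q}).
Context (Qpoly : is_polytope 4 Q) (Qsph : locally_spherical Q).
Context (Qdr : directly_regular 4 Q) (Qtype : regular_type Q [:: 3; 5; 3]).
Context (fPhi : Phi \in flags Q).
Local Notation R := (rotation_subgroup 4 Phi).
Context (KR : ~~ (#|K| %| #|R|)).
Local Notation E := (Dg Phi a b c 0).
Local Notation w := (wgen Phi a b c).

Let wE i : i < 4 -> w i \in E. Proof. exact: wgenE. Qed.

Let wK i : i < 4 -> (w i).1 \in K.
Proof. by case: i => [|[|[|[|i]]]] // _; apply: group1. Qed.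

Let wR i : i < 4 -> (w i).2 \in R.
Proof. by move=> lt; apply: (E_rot Qpoly Qdr fPhi (wE lt)). Qed.

Lemma mix_group : E :=: setX K R.
Proof.
apply: (goursat_simple simpK KR).
- apply/subsetP; apply: E_ind; first exact: group1.
  move=> g i k lti ltk _ gX; apply: (groupM gX); apply: groupM.
    by rewrite groupV inE wK // wR.
  by rewrite inE wK // wR.
- move=> k kK; pose fE := ([morphism of @fst kT {perm Q}] @* E)%G.
  have wf i : i < 4 -> (w i).1 \in fE.
    by move=> lt; apply: (mem_morphim [morphism of @fst kT {perm Q}]); rewrite ?inE ?wE.
  have := subsetP (genK (wf 1%N isT) (wf 2%N isT) (wf 3%N isT)) k kK.
  by case/morphimP=> -[x t] _ xE ->; exists t.
move=> t tR; have [[k t'] kE /= <-] := rot_E Qpoly Qdr fPhi a b c tR.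
by exists k.
Qed.

Lemma mix_no_endo f : ~ inverting_endo 3 E w f.
Proof.
case=> fM fX f_inj fw; rewrite mix_group in fM fX f_inj.
have [h [hM hK h_inj hE]] := setX_endo simpK KR cK fM fX f_inj.
have inv i : i < 4 -> h (w i).1 = (w i).1^-1.
  by move=> lt; rewrite -(hE _ _ (wK lt) (wR lt)) -surjective_pairing fw.
exact: (no_inv hM hK h_inj (inv 1%N isT) (inv 2%N isT) (inv 3%N isT)).
Qed.

Lemma mix_simple : exists (d' : Order.disp_t) (P : finPOrderType d'),
  [/\ is_polytope 4 P, locally_spherical P, chiral P, chiral_type P [:: 3; 5; 3]
    & Gamma P \isog setX K R].
Proof.
have [P1 P2 P3 P4 P5] := mix_chiral_polytope Qpoly Qdr Qtype fPhi a3 b2 c2 ab5 bc3 ac2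
  mix_no_endo Qsph.
exists d, (mixP Qpoly Qdr Qtype fPhi a3 b2 c2 ab5 bc3 ac2).
by split=> //; rewrite -mix_group.
Qed.

End MixWithSimple.

Lemma Fp_cyclic p (s t : 'F_p) : (s != 0)%R -> exists n, t = (s *+ n)%R.
Proof.
move=> s0; exists (val (t / s)%R).
by rewrite -mulr_natr natr_Zp mulrC divfK.
Qed.

Close Scope group_scope.

Theorem theorem7p2 (p : nat) (p_prime : prime p)
  (p_mod5 : p %% 5 \in [:: 1; 4])
  (p_mod11 :
    (p %% 11 \in [:: 1; 3; 4; 5; 9] /\
     exists sqrt5 : 'F_p,
       [/\ (sqrt5 ^+ 2 = 5%:R)%R,
           exists a : 'F_p, (3%:R + 2%:R * sqrt5 = a ^+ 2)%R
         & exists b : 'F_p, (3%:R - 2%:R * sqrt5 = b ^+ 2)%R])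
    \/ p %% 11 \in [:: 2; 6; 7; 8; 10])
  (d : Order.disp_t) (Q : finPOrderType d)
  (Q_polytope : is_polytope 4 Q)
  (Q_spherical : locally_spherical Q)
  (Q_directly_regular : directly_regular 4 Q)
  (Q_type : regular_type Q [:: 3; 5; 3])
  (Q_order : ~~ (p * (p ^ 2 - 1) %| #|Gamma Q|))
  (Phi : {set Q}) (Phi_flag : Phi \in flags Q) :
  exists (d' : Order.disp_t) (P : finPOrderType d'),
    [/\ is_polytope 4 P, locally_spherical P, chiral P,
        chiral_type P [:: 3; 5; 3]
      & Gamma P \isog setX (L2 p) (rotation_subgroup 4 Phi)].
Proof.
have [n2 n3 n5 [phi [s [phiE sE s1]]]] := golden_parameters p_prime p_mod5 p_mod11.
have p_odd : odd p.
  by case: (even_prime p_prime) => // p2; move: p_mod5; rewrite p2.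
have pF := pchar_Fp p_prime; have F_cyc := @Fp_cyclic p.
have [a [b [c [[Ka Kb Kc] [a3 b2 c2] [ab5 bc3 ac2] genK no_inv]]]] :=
  PSL_generators pF p_odd F_cyc n2 n3 n5 phiE sE s1.
(* The group [L2 p] unfolds to the quotient of [SL_group 'F_p] by its centre. *)
apply: (mix_simple (PSL_simple F_cyc n2 n3 n5) (PSL_center F_cyc n2 n3 n5) Ka Kb Kc
  a3 b2 c2 ab5 bc3 ac2 genK no_inv) => //.
(* The order of [L2 p] is half of p(p^2 - 1), and by direct regularity the rotation group has half
   the order of [Gamma Q]; the factors 2 cancel in the divisibility. *)
apply: contra Q_order => dv; have [_ /(_ _ Phi_flag) i2] := Q_directly_regular.
rewrite -(Lagrange (rot_sub Q_polytope Q_directly_regular Phi_flag)) i2.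
have <- : #|SL 'F_p| = (p * (p ^ 2 - 1))%N by rewrite card_SL card_Fp.
by rewrite -(card_PSL n2) dvdn_pmul2r.
Qed.
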